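(* Let $(V,\omega,h,G,\mathbf{J})$ be a Hamiltonian $G$-vector space: $(V,\omega)$ is a finite-dimensional symplectic vector space, $G$ is a compact Lie group with Lie algebra $\mathfrak{g}$ acting linearly and canonically on $V$, $h\in C^\infty(V)^G$ is a smooth $G$-invariant Hamiltonian, and $\mathbf{J}:V\to\mathfrak{g}^*$ is the equivariant momentum map $\langle\mathbf{J}(v),\eta\rangle=\frac12\omega(\eta\cdot v,v)$. Suppose that $h(0)=0$ and $\mathbf{d}h(0)=0$. Let $\xi\in\mathfrak{g}$ be a root of the polynomial equation $$\det\left(\mathbf{d}^2\left(h-\mathbf{J}^\xi\right)(0)\right)=0 .$$ Let $G^\xi:=\{g\in G\mid\mathrm{Ad}_g\xi=\xi\}$, define $$V_0:=\ker\left(\mathbf{d}^2\left(h-\mathbf{J}^\xi\right)(0)\right),$$ and suppose that: (i) The quadratic form $Q:=\mathbf{d}^2h(0)|_{V_0}$, $Q(v_0)=\mathbf{d}^2h(0)(v_0,v_0)$, on $V_0$ is definite. (ii) Let $\|\cdot\|$ be the norm on $V_0$ defined by $\|v_0\|^2:=\mathbf{d}^2h(0)(v_0,v_0)$, $v_0\in V_0$ (with a minus sign if $Q$ is negative definite), let $l=\dim V_0$, and let $S^{l-1}$ be the unit sphere in $V_0$ for this norm. The function $j\in C^\infty(S^{l-1})$ defined by $j(u):=\frac12\mathbf{d}^2\mathbf{J}^\xi(0)(u,u)$, $u\in S^{l-1}$, is of Morse–Bott type with respect to the $G^\xi$-action on $S^{l-1}$. Then, for every neighborhood $\mathcal{N}$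 of $\xi$ in $\mathfrak{g}$, there exist a $G$-invariant open neighborhood $U$ of $0$ in $V$ and $\epsilon_0>0$ such that, for each $\epsilon\neq0$ with $|\epsilon|<\epsilon_0$ and with the same sign as the definite form $Q$, and with level sets understood as their parts lying in $U$, there are at least $$\mathrm{Cat}\left(h|_{V_0}^{-1}(\epsilon)/G^\xi\right)=\mathrm{Cat}\left(Q^{-1}(\epsilon)/G^\xi\right)$$ $G^\xi$-distinct relative equilibria of $h$ on the energy level $h^{-1}(\epsilon)$, with velocities lying in $\mathcal{N}$ (in particular the displayed equality holds). If the subgroup $G^\xi$ contains a maximal torus $T^\xi$ such that the subspace $(V_0)^{T^\xi}$ of $T^\xi$-fixed vectors in $V_0$ is trivial, that is, $(V_0)^{T^\xi}=\{0\}$, then the lower bound above can be replaced by $$\frac{\dim V_0}{2(1+\dim G^\xi-\dim T^\xi)} .$$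
   Context: Canonical action means that it preserves $\omega$; $\eta\cdot v$ denotes the induced Lie algebra representation (infinitesimal generator at $v$). $\mathbf{J}^\xi:=\langle\mathbf{J},\xi\rangle\in C^\infty(V)$. The Hamiltonian vector field $X_h$ is defined by $\mathbf{i}_{X_h}\omega=\mathbf{d}h$. The determinant and kernel of a Hessian are those of its matrix (symmetric bilinear form) in a basis of $V$. The subspace $V_0$ is $G^\xi$-invariant, and $G^\xi$ acts on $S^{l-1}$ by restriction. A point $v$ is a relative equilibrium of $h$ with velocity $\eta\in\mathfrak{g}$ if the integral curve of $X_h$ starting at $v$ is $t\mapsto\exp(t\eta)\cdot v$; equivalently $\mathbf{d}(h-\mathbf{J}^\eta)(v)=0$. For a closed subgroup $K\subset G$, two relative equilibria are called $K$-distinct if their classes in the quotient space $V/K$ are distinct, i.e. they lie in different $K$-orbits. If a Lie group $K$ with Lie algebra $\mathfrak{k}$ acts on a manifold $S$, a $K$-invariant function $f\in C^\infty(S)^K$ is of Morse–Bott type (with respect to the $K$-action) if every critical point $z$ of $f$ satisfies $\ker\mathbf{d}^2f(z)=\mathfrak{k}\cdot z$, where $\mathfrak{k}\cdot z=T_z(K\cdot z)$ is the tangent space to the $K$-orbit at $z$. $\mathrm{Cat}(X)$ denotes the Lusternik–Schnirelman category of a compact topological space $X$: the minimal number of closed contractible sets (contractible within $X$) needed to cover $X$. Definite means positive definite or negative definite. *)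

(* Defs.v *)
From HB Require Import structures.
From mathcomp Require Import all_boot all_order all_algebra.
From mathcomp Require Import generic_quotient.
From mathcomp Require Import all_classical all_reals all_analysis.

Set Implicit Arguments.
Unset Strict Implicit.
Unset Printing Implicit Defensive.

Import Order.TTheory GRing.Theory Num.Theory.
Import numFieldNormedType.Exports.

Local Open Scope quotient_scope.
Local Open Scope classical_set_scope.
Local Open Scope ring_scope.

(* Meant for an open [D] in a finite-dimensional space, where a map is of
   class C^{k+1} iff it is differentiable with C^k directional derivatives. *)
Fixpoint Ck_on (R : realType) (U W : normedModType R) (k : nat) (D : set U)
    (f : U -> W) : Prop :=
  if k is k'.+1 then
    (forall x, D x -> differentiable f x) /\
    (forall v : U, Ck_on k' D (fun x => 'D_v f x))
  else forall x, D x -> {for x, continuous f}.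

Definition smooth_on (R : realType) (U W : normedModType R) (D : set U)
    (f : U -> W) : Prop := forall k, Ck_on k D f.

Definition d2 (R : realType) (U : normedModType R) (f : U -> R) (x u v : U) : R :=
  'D_u (fun y => 'D_v f y) x.

Definition hessian (R : realType) (n : nat) (f : 'cV[R]_n -> R) (x : 'cV[R]_n)
    : 'M[R]_n :=
  \matrix_(i, j) d2 f x (delta_mx i 0) (delta_mx j 0).

Definition hess_ker (R : realType) (n : nat) (f : 'cV[R]_n -> R) (x : 'cV[R]_n)
    : set 'cV[R]_n :=
  [set v | hessian f x *m v = 0].

(* The dimension of a set of vectors that happens to be a linear subspace. *)
Definition subspace_dim (R : realType) (E : vectType R) (S : set E) : nat :=
  xget 0%N [set k | exists X : k.-tuple E,
    free X /\ forall x, S x <-> x \in <<X>>%VS].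

HB.mixin Record hasContinuousGroupOps G of Group G & Topological G := {
  mulg_continuous : continuous (fun p : G * G => (p.1 * p.2)%g);
  invg_continuous : continuous (fun x : G => (x^-1)%g)
}.

#[short(type="topologicalGroupType")]
HB.structure Definition TopologicalGroup :=
  {G of hasContinuousGroupOps G & Group G & Topological G}.

(* [chart_fun] and [chart_inv] are total functions that are only meaningful on
   [chart_dom] and [chart_img] respectively. *)
Record chart (R : realType) (d : nat) (T : topologicalType) := Chart {
  chart_fun :> T -> 'cV[R]_d;
  chart_inv : 'cV[R]_d -> T;
  chart_dom : set T;
  chart_img : set 'cV[R]_d;
  chart_dom_open : open chart_dom;
  chart_img_open : open chart_img;
  chart_funP : forall x, chart_dom x -> chart_img (chart_fun x);
  chart_invP : forall y, chart_img y -> chart_dom (chart_inv y);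
  chart_funK : forall x, chart_dom x -> chart_inv (chart_fun x) = x;
  chart_invK : forall y, chart_img y -> chart_fun (chart_inv y) = y;
  chart_fun_continuous : forall x, chart_dom x -> {for x, continuous chart_fun};
  chart_inv_continuous : forall y, chart_img y -> {for y, continuous chart_inv}
}.

HB.mixin Record isLieGroup (R : realType) (d : nat) G of TopologicalGroup G := {
  lie_hausdorff : hausdorff_space G;
  lie_second_countable : @second_countable G;
  atlas : set (chart R d G);
  atlas_cover : forall x : G, exists2 c, atlas c & chart_dom c x;
  atlas_compatible : forall c1 c2, atlas c1 -> atlas c2 ->
    smooth_on [set y | chart_img c1 y /\ chart_dom c2 (chart_inv c1 y)]
      (fun y => c2 (chart_inv c1 y));
  mulg_smooth : forall c1 c2 c3, atlas c1 -> atlas c2 -> atlas c3 ->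
    smooth_on
      [set p : 'cV[R]_d * 'cV[R]_d |
        [/\ chart_img c1 p.1, chart_img c2 p.2 &
            chart_dom c3 (chart_inv c1 p.1 * chart_inv c2 p.2)%g]]
      (fun p => c3 (chart_inv c1 p.1 * chart_inv c2 p.2)%g);
  invg_smooth : forall c1 c2, atlas c1 -> atlas c2 ->
    smooth_on [set y | chart_img c1 y /\ chart_dom c2 ((chart_inv c1 y)^-1)%g]
      (fun y => c2 ((chart_inv c1 y)^-1)%g)
}.

#[short(type="lieGroupType")]
HB.structure Definition LieGroup (R : realType) (d : nat) :=
  {G of isLieGroup R d G & TopologicalGroup G}.

Section LieAlgebra.
Context (R : realType) (d : nat) (G : lieGroupType R d).

Definition is_subgroup (K : set G) : Prop :=
  [/\ K 1%g, forall x y, K x -> K y -> K (x * y)%g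
    & forall x, K x -> K (x^-1)%g].

Definition is_torus (T : set G) : Prop :=
  [/\ is_subgroup T, compact T, connected T
    & forall x y, T x -> T y -> (x * y = y * x)%g].

Definition is_maximal_torus (T K : set G) : Prop :=
  [/\ is_torus T, T `<=` K
    & forall T', is_torus T' -> T `<=` T' -> T' `<=` K -> T' = T].

(* Given a chart [e] of the atlas around [1], the Lie algebra (the tangent space
   at [1]) is identified with ['cV[R]_d]: a tangent vector is represented by its
   coordinates in [e].  All the notions below are independent of [e], up to the
   change of coordinates. *)
Variable e : chart R d G.

(* [gamma] is [t |-> exp (t eta)]. *)
Definition one_parameter (eta : 'cV[R]_d) (gamma : R -> G) : Prop :=
  [/\ continuous gamma, forall s t, gamma (s + t) = (gamma s * gamma t)%g
    & is_derive (0 : R) 1 (fun t => e (gamma t)) eta].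

(* The Lie algebra of a closed subgroup [K]. *)
Definition lie_subalgebra (K : set G) : set 'cV[R]_d :=
  [set eta | exists gamma, one_parameter eta gamma /\ forall t, K (gamma t)].

Definition lie_dim (K : set G) : nat := subspace_dim (lie_subalgebra K).

Definition Ad (g : G) (eta : 'cV[R]_d) : 'cV[R]_d :=
  'D_eta (fun y => e (g * chart_inv e y * g^-1)%g) (e 1%g).

Definition Ad_stabilizer (xi : 'cV[R]_d) : set G := [set g | Ad g xi = xi].

End LieAlgebra.

Section LinearAction.
Context (R : realType) (d n : nat) (G : lieGroupType R d).

Definition is_representation (rho : G -> 'M[R]_n) : Prop :=
  [/\ rho 1%g = 1%:M, forall g g', rho (g * g')%g = rho g *m rho g'
    & forall c : chart R d G, atlas c ->
        smooth_on (chart_img c) (fun y => rho (chart_inv c y))].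

Variables (e : chart R d G) (rho : G -> 'M[R]_n).

(* [eta . v] *)
Definition inf_action (eta : 'cV[R]_d) (v : 'cV[R]_n) : 'cV[R]_n :=
  'D_eta (fun y => rho (chart_inv e y) *m v) (e 1%g).

Definition orbit_of (K : set G) (v : 'cV[R]_n) : set 'cV[R]_n :=
  [set rho g *m v | g in K].

(* The tangent space [k . z] to the [K]-orbit of [z]. *)
Definition orbit_tangent (K : set G) (z : 'cV[R]_n) : set 'cV[R]_n :=
  [set inf_action eta z | eta in lie_subalgebra e K].

Definition fixed_by (K : set G) : set 'cV[R]_n :=
  [set v | forall g, K g -> rho g *m v = v].

(* The parametrization [phi], defined on the open set [D] and taking values in
   the submanifold [S], is the inverse of a chart of [S]. *)
Definition is_parametrization (S : set 'cV[R]_n) (k : nat) (D : set 'cV[R]_k)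
    (phi : 'cV[R]_k -> 'cV[R]_n) : Prop :=
  [/\ open D, smooth_on D phi,
      {in D &, injective phi},
      forall x a, D x -> 'D_a phi x = 0 -> a = 0
    & forall D', open D' -> D' `<=` D ->
        exists2 W, open W & phi @` D' = S `&` W].

(* For a submanifold [S] of the representation space stable under [K]; only the
   restriction of [f] to [S] matters.  At a critical point [z = phi x] of [f] on
   [S], the kernel of the Hessian, a subspace of [T_z S], is the image under the
   differential of [phi] of the kernel of the Hessian of [f \o phi]. *)
Definition morse_bott (K : set G) (S : set 'cV[R]_n) (f : 'cV[R]_n -> R) : Prop :=
  forall (k : nat) (D : set 'cV[R]_k) (phi : 'cV[R]_k -> 'cV[R]_n),
    is_parametrization S D phi ->
  forall x, D x -> (forall a, 'D_a (f \o phi) x = 0) ->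
    [set 'D_a phi x | a in hess_ker (f \o phi) x] = orbit_tangent K (phi x).

Definition same_orbit (K : set G) (A : set 'cV[R]_n) : rel (set_type A) :=
  fun x y => `[< orbit_of K (set_val x) = orbit_of K (set_val y) >].

Lemma same_orbit_equiv (K : set G) (A : set 'cV[R]_n) :
  equiv_class_of (@same_orbit K A).
Proof.
split=> [x|x y|y x z]; first exact/asboolP.
- by apply/asboolP/asboolP.
- by move=> /asboolP xy /asboolP yz; apply/asboolP; rewrite xy.
Qed.

Definition orbit_equiv (K : set G) (A : set 'cV[R]_n) : equiv_rel (set_type A) :=
  EquivRelPack (same_orbit_equiv K A).

(* [A / K] for an invariant subset [A]. *)
Definition orbit_space (K : set G) (A : set 'cV[R]_n) : topologicalType :=
  quotient_topology {eq_quot (orbit_equiv K A)}.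

(* There are at least [x] points of [P] in pairwise distinct [K]-orbits, where
   [x] need not be an integer and can be infinite. *)
Definition at_least_orbits (x : \bar R) (K : set G) (P : set 'cV[R]_n) : Prop :=
  forall c : nat, (c%:R%:E < x)%E ->
    exists v : 'I_c.+1 -> 'cV[R]_n,
      (forall i, P (v i)) /\
      (forall i j, i != j -> orbit_of K (v i) <> orbit_of K (v j)).

End LinearAction.

Definition contractible_in (R : realType) (X : topologicalType) (A : set X) : Prop :=
  exists H : X * R -> X,
    [/\ {within A `*` `[0 : R, 1 : R], continuous H},
        forall a, A a -> H (a, 0) = a
      & exists x0, forall a, A a -> H (a, 1) = x0].

(* [+oo] if no finite cover exists. *)
Definition Cat (R : realType) (X : topologicalType) : \bar R :=
  ereal_inf [set (k%:R%:E : \bar R) | k in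
    [set k : nat | exists F : 'I_k -> set X,
      [/\ forall i, closed (F i), forall i, contractible_in R (F i)
        & \bigcup_i F i = setT]]].

Section Hamiltonian.
Context (R : realType) (d n : nat) (G : lieGroupType R d).

(* The symplectic form with matrix [Omega]. *)
Definition sform (Omega : 'M[R]_n) (u v : 'cV[R]_n) : R := (u^T *m Omega *m v) 0 0.

Definition symplectic (Omega : 'M[R]_n) : Prop :=
  Omega^T = - Omega /\ Omega \in unitmx.

Variables (Omega : 'M[R]_n) (e : chart R d G) (rho : G -> 'M[R]_n).

(* [J^eta] *)
Definition momentum (eta : 'cV[R]_d) (v : 'cV[R]_n) : R :=
  2^-1 * sform Omega (inf_action e rho eta v) v.

Definition is_hamiltonian_vf (h : 'cV[R]_n -> R) (X : 'cV[R]_n -> 'cV[R]_n) : Prop :=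
  forall v w, sform Omega (X v) w = 'D_w h v.

Definition relative_equilibrium (X : 'cV[R]_n -> 'cV[R]_n)
    (eta : 'cV[R]_d) (v : 'cV[R]_n) : Prop :=
  exists2 gamma, one_parameter e eta gamma &
    forall t : R,
      is_derive t 1 (fun t' => rho (gamma t') *m v) (X (rho (gamma t) *m v)).

End Hamiltonian.

(* Main.v *)
Require Import Defs.
From HB Require Import structures.
From mathcomp Require Import all_boot all_order all_algebra.
From mathcomp Require Import generic_quotient.
From mathcomp Require Import all_classical all_reals all_analysis.
From mathcomp Require Import ring lra zify.

(** Let [A] and [B] be the Hessians at [0] of [h] and of [J^xi].  They agree on
    [V0], the kernel of [A - B], so that on the unit sphere [S] of [V0] the
    function [j] is constant, equal to [s / 2].  Every point [z] of [S] is then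
    critical with zero Hessian, and the Morse-Bott condition says that the tangent
    space of the orbit of [z] under [Gxi] is the whole tangent space of [S]
    ([sphere_tangent]; the parametrization of [S] needed to use the condition is
    the inverse stereographic projection).  Hence [Gxi], being compact, is
    transitive on [S] ([sphere_transitive]).

    Close to the origin [s * h] increases strictly along the rays of [V0], so
    that the level sets in [V0] of [h], like those of [Q], are single orbits
    ([energy_level_orbit], [quadratic_level_orbit]): both quotients are points
    and both categories are equal to 1.  The other lower bound is at most 1 as
    well ([resonant_dimension]): if [l] is the dimension of [V0], the Lie algebra
    of [Gxi] maps onto a space of dimension at least [l - 1] by the orbit map at
    [z], whereas that of a torus maps onto an isotropic space [I] such that [I]
    and [xi . I] are independent in [V0], of dimension at most [l / 2].

    It remains to find one relative equilibrium on each energy level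
    ([resonant_relative_equilibrium]).  Fix [z] in [S], and let the columns of [b]
    be a basis of the orthogonal of [z] in [V0].  To the critical point equation
    [dh (v) = (1 + mu) B v] on [h (v) = eps] one adds a penalty [M v], where the
    quadratic form of [M] is the squared norm of [b^T A v]; the linearized problem
    is now invertible and Newton's method gives a solution [v] close to the ray of [z]
    ([constrained_critical_point]).  Invariance of [h] and of [J^xi] shows that
    [M v] vanishes on the vectors [eta . v] with [eta] in the Lie algebra of [Gxi];
    as these are numerous enough, [M v = 0], and [v] is a relative equilibrium of
    velocity [(1 + mu) xi].

    The Lie-theoretic prerequisites are proved from the smoothness of the product
    in a chart around the identity, where it is the addition of coordinates up to
    a small Lipschitz error ([mul_strict]).  From this follow the existence of the
    one-parameter subgroup of a given velocity ([one_parameter_limit]), its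
    uniqueness ([one_parameter_unique]), the linearity of the Lie algebra of a
    closed subgroup ([lie_subalgebraD]) and the description of [Gxi] as a
    centralizer ([Ad_stabilizerP]). *)

Set Implicit Arguments.
Unset Strict Implicit.
Unset Printing Implicit Defensive.
Import Order.TTheory GRing.Theory Num.Theory.
Import numFieldNormedType.Exports.
Local Open Scope classical_set_scope.
Local Open Scope ring_scope.

(** * Calculus in several variables *)

Section Calculus.
Context {R : realType}.

Lemma line_quotient (U W : normedModType R) (f : U -> W) (y v : U) (t : R) :
  (fun k : R => k^-1 *: (((fun t : R => f (y + t *: v)) \o shift t) (k *: (1 : R)) -
     f (y + t *: v))) =
  (fun k : R => k^-1 *: ((f \o shift (y + t *: v)) (k *: v) - f (y + t *: v))).
Proof.
apply/funext => k /=; congr (_ *: (f _ - _)).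
by rewrite [k *: 1]mulr1 scalerDl addrCA.
Qed.

Lemma derive_line (U W : normedModType R) (f : U -> W) (y v : U) (t : R) :
  'D_1 (fun t : R => f (y + t *: v)) t = 'D_v f (y + t *: v).
Proof. by rewrite /derive line_quotient. Qed.

Lemma is_derive_line (U W : normedModType R) (f : U -> W) (y v : U) (t : R) :
  derivable f (y + t *: v) v ->
  is_derive t 1 (fun t : R => f (y + t *: v)) ('D_v f (y + t *: v)).
Proof.
by move=> df; apply: DeriveDef; [rewrite /derivable line_quotient|exact: derive_line].
Qed.

Lemma mean_value_line (U : normedModType R) (f : U -> R) (y v : U) :
  (forall t : R, 0 <= t <= 1 -> derivable f (y + t *: v) v) ->
  exists2 t : R, 0 <= t <= 1 & f (y + v) - f y = 'D_v f (y + t *: v).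
Proof.
move=> df; pose g (t : R) := f (y + t *: v).
have dg (t : R) : 0 <= t <= 1 -> is_derive t 1 g ('D_v f (y + t *: v)).
  by move=> t01; exact/is_derive_line/df.
have [||t] := @MVT _ g (fun t : R => 'D_v f (y + t *: v)) 0 1 ltr01.
- by move=> t; rewrite in_itv/= => /andP[t0 t1]; apply: dg; rewrite !ltW.
- apply: continuous_in_subspaceT => r; rewrite inE/= in_itv/= => r01.
  have [/derivable1_diffP + _] := dg r r01.
  exact: differentiable_continuous.
rewrite in_itv/= subr0 mulr1 => /andP[t0 t1].
rewrite /g scale1r scale0r addr0 => e; exists t => //.
by rewrite !ltW.
Qed.

(** A finite-dimensional normed space, presented by a basis with Lipschitz
    coordinates: a common setting for column vectors and pairs of them. *)
Definition finite_coordinates (U : normedModType R) :=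
  exists N (b : 'I_N -> U) (c : U -> 'I_N -> R),
    forall x, x = \sum_i c x i *: b i /\ forall i, `|c x i| <= `|x|.

Lemma cV_coord_le n (x : 'cV[R]_n) i : `|x i 0| <= `|x|.
Proof.
rewrite [leRHS]/Num.Def.normr /= mx_normrE.
exact: (@le_bigmax _ _ _ _ (fun ij : 'I_n * 'I_1 => `|x ij.1 ij.2|) (i, 0)).
Qed.

Lemma cV_norm_le n (x : 'cV[R]_n) k :
  0 <= k -> (forall i, `|x i 0| <= k) -> `|x| <= k.
Proof.
move=> k0 xk; rewrite [leLHS]/Num.Def.normr/= mx_normrE.
by apply/bigmax_leP; split=> // -[i j] _; rewrite ord1.
Qed.

Lemma cV_sum_delta n (x : 'cV[R]_n) : x = \sum_i x i 0 *: delta_mx i 0.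
Proof. by rewrite {1}[x]matrix_sum_delta; apply: eq_bigr => i _; rewrite big_ord1. Qed.

Lemma finite_coordinates_cV n : finite_coordinates 'cV[R]_n.
Proof.
exists n, (fun i => delta_mx i 0), (fun (x : 'cV_n) i => x i 0) => x; split.
  exact: cV_sum_delta.
exact: cV_coord_le.
Qed.

Lemma finite_coordinates_pair (U V : normedModType R) :
  finite_coordinates U -> finite_coordinates V -> finite_coordinates (U * V)%type.
Proof.
move=> [N [b [c bc]]] [M [b' [c' bc']]].
exists (N + M)%N, (fun k : 'I_(N + M) => match fintype.split k with
    | inl i => (b i, 0) | inr j => (0, b' j) end),
  (fun (x : U * V) (k : 'I_(N + M)) =>
    match fintype.split k with inl i => c x.1 i | inr j => c' x.2 j end).
move=> [x y]; split; last first.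
  move=> k; rewrite prod_normE le_max /=.
  by case: fintype.split => i; [rewrite (bc x).2|rewrite (bc' y).2 orbT].
rewrite big_split_ord /= (eq_bigr (fun i => ((c x i *: b i, 0) : U * V))); last first.
  by move=> i _; rewrite (unsplitK (inl i)); congr pair; rewrite scaler0.
rewrite [X in _ + X](eq_bigr (fun i => ((0, c' y i *: b' i) : U * V))); last first.
  by move=> i _; rewrite (unsplitK (inr i)); congr pair; rewrite scaler0.
have p1 K (F : 'I_K -> U) : \sum_i ((F i, 0) : U * V) = (\sum_i F i, 0).
  elim/big_rec2: _ => // i u1 u2 _ ->; congr pair => /=.
  by rewrite addr0.
have p2 K (F : 'I_K -> V) : \sum_i ((0, F i) : U * V) = (0, \sum_i F i).
  elim/big_rec2: _ => // i u1 u2 _ ->; congr pair => /=.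
  by rewrite addr0.
rewrite p1 p2 -(bc x).1 -(bc' y).1; congr pair => /=; first by rewrite addr0.
by rewrite add0r.
Qed.

Lemma deriveD_dir (U W : normedModType R) (f : U -> W) x u v :
  differentiable f x -> 'D_(u + v) f x = 'D_u f x + 'D_v f x.
Proof. by move=> df; rewrite !deriveE// linearD. Qed.

Lemma deriveZ_dir (U W : normedModType R) (f : U -> W) x k u :
  differentiable f x -> 'D_(k *: u) f x = k *: 'D_u f x.
Proof. by move=> df; rewrite !deriveE// linearZ. Qed.

Lemma derive_sum_dir (U W : normedModType R) (f : U -> W) x N
    (c : 'I_N -> R) (b : 'I_N -> U) :
  differentiable f x ->
  'D_(\sum_i c i *: b i) f x = \sum_i c i *: 'D_(b i) f x.
Proof.
move=> df; rewrite deriveE// linear_sum; apply: eq_bigr => i _.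
by rewrite linearZ deriveE.
Qed.

(** By the mean value theorem an increment of [f] is the derivative at an
    intermediate point, and the partial derivatives there are close to those at
    [p]: finitely many of them give the estimate in all directions. *)
Lemma strictly_differentiable (U : normedModType R) (D : set U) (f : U -> R) p :
  finite_coordinates U -> open D -> D p -> Ck_on 1 D f ->
  forall eps, 0 < eps -> exists2 del, 0 < del & forall x y,
    `|p - x| < del -> `|p - y| < del ->
    `|f x - f y - 'D_(x - y) f p| <= eps * `|x - y|.
Proof.
move=> [N [b [c bc]]] oD Dp [df cf] eps eps0.
pose k := eps / (N.+1%:R).
have k0 : 0 < k by rewrite divr_gt0.
have : \forall q \near p, D q /\ forall i, `|'D_(b i) f p - 'D_(b i) f q| < k.
  apply: filterI; first exact: open_nbhs_nbhs.
  apply: filter_forall => i; have /cvgrPdist_lt := cf (b i) p Dp.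
  exact.
move=> /nbhs_ballP[del /= del0 pdel]; exists del => // x y px py.
have pq (t : R) : 0 <= t <= 1 -> ball p del (y + t *: (x - y)).
  move=> /andP[t0 t1]; rewrite -ball_normE /ball_/=.
  have -> : p - (y + t *: (x - y)) = (1 - t) *: (p - y) + t *: (p - x).
    have -> : p - x = p - y - (x - y) by rewrite opprB subrKA.
    by rewrite [t *: (_ - _ - _)]scalerBr scalerBl scale1r addrA subrK opprD addrA.
  rewrite (le_lt_trans (ler_normD _ _))// !normrZ (ger0_norm t0).
  rewrite ger0_norm ?subr_ge0//.
  have [->|tn0] := eqVneq t 0; first by rewrite subr0 mul1r mul0r addr0.
  have tp : 0 < t by rewrite lt_def tn0.
  rewrite [ltRHS](_ : del = (1 - t) * del + t * del); last by rewrite -mulrDl subrK mul1r.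
  by rewrite ler_ltD// ?ltr_pM2l// ler_wpM2l ?subr_ge0// ltW.
have [t t01|t t01] := @mean_value_line U f y (x - y).
  by apply: diff_derivable; apply: df; apply: (pdel _ _).1; exact: pq.
rewrite [y + (x - y)]addrC subrK => ->.
set q := y + _.
have [Dq qk] := pdel _ (pq _ t01); rewrite -/q in qk.
rewrite (bc (x - y)).1 !derive_sum_dir//; try exact: df.
rewrite -sumrB -(bc (x - y)).1 (le_trans (ler_norm_sum _ _ _))//.
rewrite (@le_trans _ _ (\sum_(i < N) `|x - y| * k))//.
  apply: ler_sum => i _; rewrite -scalerBr normrM ler_pM ?(bc _).2//.
  by rewrite distrC ltW.
rewrite sumr_const card_ord -mulr_natr mulrC /k mulrCA mulrA.
by rewrite [leRHS]mulrC -mulrA ler_wpM2l// mulrCA ler_piMr ?ltW// ltr_pdivrMr// mul1r ltr_nat.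
Qed.

Lemma shift_quotient (U W : normedModType R) (f : U -> W) (a x v : U) :
  (fun k : R => k^-1 *: (((fun y => f (a + y)) \o shift x) (k *: v) - f (a + x))) =
  (fun k : R => k^-1 *: ((f \o shift (a + x)) (k *: v) - f (a + x))).
Proof. by apply/funext => k /=; rewrite addrCA. Qed.

Lemma derive_shift_arg (U W : normedModType R) (f : U -> W) (a x v : U) :
  'D_v (fun y => f (a + y)) x = 'D_v f (a + x).
Proof. by rewrite /derive shift_quotient. Qed.

Lemma derivable_shift_arg (U W : normedModType R) (f : U -> W) (a x v : U) :
  derivable f (a + x) v -> derivable (fun y => f (a + y)) x v.
Proof. by rewrite /derivable shift_quotient. Qed.

Lemma is_derive_lineP (U W : normedModType R) (f : U -> W) (y v : U) w :
  is_derive (0 : R) 1 (fun t : R => f (y + t *: v)) w -> is_derive y v f w.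
Proof.
move=> [df <-]; have y0 : y = y + (0 : R) *: v by rewrite scale0r addr0.
apply: DeriveDef; last by rewrite derive_line -y0.
by move: df; rewrite /derivable line_quotient -y0.
Qed.

Lemma is_derive_chain (U W : normedModType R) (f : U -> W) (c : R -> U) (t : R) w :
  is_derive t 1 c w -> differentiable f (c t) ->
  is_derive t 1 (f \o c) ('D_w f (c t)).
Proof.
move=> [/derivable1_diffP dc cw] df.
have dfc : differentiable (f \o c) t by exact: differentiable_comp.
apply: DeriveDef; first exact: diff_derivable.
by rewrite deriveE// diff_comp// deriveE//= -(deriveE _ dc) cw.
Qed.

Lemma differentiable_cV_coord (U : normedModType R) n (f : U -> 'cV[R]_n) x i :
  differentiable f x -> differentiable (fun y => f y i 0) x.
Proof.
move=> df; apply: (@differentiable_comp _ _ _ _ f (fun M : 'cV[R]_n => M i 0)) => //.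
exact: differentiable_coord.
Qed.

Lemma derive_cV_coord (U : normedModType R) n (f : U -> 'cV[R]_n) x v i :
  derivable f x v -> 'D_v (fun y => f y i 0) x = 'D_v f x i 0.
Proof. by move=> df; rewrite derive_mx// mxE. Qed.

Lemma Ck_on1_coord (U : normedModType R) n D (f : U -> 'cV[R]_n) i :
  open D -> Ck_on 1 D f -> Ck_on 1 D (fun y => f y i 0).
Proof.
move=> oD [df cf]; split=> [x Dx|v x Dx].
  exact/differentiable_cV_coord/df.
have fD y : D y -> 'D_v f y i 0 = 'D_v (fun y => f y i 0) y.
  by move=> Dy; rewrite derive_cV_coord//; exact/diff_derivable/df.
rewrite /prop_for /continuous_at -(fD _ Dx).
have /cvgrPdist_lt cc := @continuous_comp _ _ _ ('D_v f)
  (fun M : 'cV[R]_n => M i 0) x (cf v x Dx) (@coord_continuous _ _ _ _ _ _).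
apply/cvgrPdist_lt => e e0; near=> y.
have Dy : D y by near: y; exact: open_nbhs_nbhs.
by rewrite -(fD _ Dy); near: y; exact: cc.
Unshelve. all: by end_near. Qed.

Lemma strictly_differentiable_cV (U : normedModType R) n D (f : U -> 'cV[R]_n) p :
  finite_coordinates U -> open D -> D p -> Ck_on 1 D f ->
  forall eps, 0 < eps -> exists2 del, 0 < del & forall x y,
    `|p - x| < del -> `|p - y| < del ->
    `|f x - f y - 'D_(x - y) f p| <= eps * `|x - y|.
Proof.
move=> fU oD Dp cf eps eps0.
have H i : exists del : {posnum R}, forall x y,
    `|p - x| < del%:num -> `|p - y| < del%:num ->
    `|f x i 0 - f y i 0 - 'D_(x - y) (fun y => f y i 0) p| <= eps * `|x - y|.
  have [del del0 H] := strictly_differentiable fU oD Dp (Ck_on1_coord i oD cf) eps0.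
  by exists (PosNum del0).
have [del {}H] := choice H.
exists (\big[Num.min/1]_i (del i)%:num).
  by elim/big_ind: _ => // x y x0 y0; rewrite lt_min x0.
have le_del i x : x < \big[Num.min/1]_i (del i)%:num -> x < (del i)%:num.
  by move/lt_le_trans; apply; exact: bigmin_le.
move=> x y px py; apply: cV_norm_le => [|i]; first by rewrite mulr_ge0// ltW.
rewrite !mxE -derive_cV_coord; first exact: H (le_del _ _ px) (le_del _ _ py).
exact/diff_derivable/cf.1.
Qed.

(** Schwarz's theorem: the second difference of [f] along [s *: u] and
    [s *: v] is [s ^+ 2] times either mixed derivative, up to [o(s ^+ 2)]. *)
Lemma d2_sym (U : normedModType R) (f : U -> R) p u v :
  finite_coordinates U -> Ck_on 2 setT f -> d2 f p u v = d2 f p v u.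
Proof.
move=> fU [df cf].
have key u' v' : forall eps, 0 < eps -> \forall s \near 0^'+,
    `|f (p + s *: u' + s *: v') - f (p + s *: u') - f (p + s *: v') + f p
      - s ^+ 2 * d2 f p u' v'| <= eps * s ^+ 2.
  move=> e e0.
  have e'0 : 0 < e / (`|u'| + 1) by rewrite divr_gt0// ltr_wpDl.
  have [del del0 H] := @strictly_differentiable _ _ _ p fU openT I (cf v') _ e'0.
  have k0 : 0 < `|u'| + `|v'| + 1 by rewrite ltr_wpDl// addr_ge0.
  near=> s.
  have s0 : 0 < s by [].
  have small : s * (`|u'| + `|v'| + 1) < del.
    by rewrite -ltr_pdivlMr//; near: s; apply: nbhs_right_lt; rewrite divr_gt0.
  pose g x := f (s *: u' + x) - f x.
  have dg x w : derivable (fun y => f (s *: u' + y)) x w.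
    exact/derivable_shift_arg/diff_derivable/df.
  have [|t /andP[t0 t1]] := @mean_value_line _ g p (s *: v').
    by move=> t _; apply: derivableB => //; exact/diff_derivable/df.
  rewrite /g deriveB//; last exact/diff_derivable/df.
  rewrite derive_shift_arg => E.
  set q := p + t *: (s *: v') in E.
  have tsv : `|t *: (s *: v')| <= s * `|v'|.
    by rewrite !normrZ (ger0_norm t0) (gtr0_norm s0) ler_piMl// mulr_ge0// ltW.
  have pq : `|p - q| < del.
    rewrite /q opprD addNKr normrN (le_lt_trans tsv)// (le_lt_trans _ small)//.
    by rewrite ler_pM2l// -addrA addrCA lerDl addr_ge0.
  have pq' : `|p - (s *: u' + q)| < del.
    rewrite /q opprD addrCA opprD addNKr -opprD normrN.
    rewrite (le_lt_trans (ler_normD _ _))// (le_lt_trans _ small)//.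
    rewrite normrZ (gtr0_norm s0) -addrA mulrDr lerD2l (le_trans tsv)//.
    by rewrite ler_pM2l// lerDl.
  have := H _ _ pq' pq; rewrite addrK deriveZ_dir; last exact: (cf v').1.
  rewrite (_ : f _ - _ - _ + _ = s * ('D_v' f (s *: u' + q) - 'D_v' f q)); last first.
    rewrite mulrBr -![s * _]/(s *: _) -!deriveZ_dir; try exact: df.
    rewrite -E [p + _ + _]addrAC [s *: u' + _]addrC [s *: u' + p]addrC.
    by ring.
  rewrite normrZ (gtr0_norm s0) /d2; set X := _ - 'D_v' f q; set Y := 'D_u' _ p => {}H.
  rewrite [X in `|X|](_ : _ = s * (X - s *: Y)); last by rewrite /GRing.scale/=; ring.
  rewrite normrM (gtr0_norm s0) [leRHS]mulrCA ler_pM2l// (le_trans H)//.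
  rewrite mulrCA [leRHS]mulrC ler_pM2l// -mulrA ger_pMr// mulrC ler_pdivrMr.
    by rewrite mul1r lerDl.
  by rewrite ltr_wpDl.
apply/eqP; rewrite -subr_eq0 -normr_le0; apply/ler_addgt0Pr => e e0.
rewrite add0r.
have e20 : 0 < e / 2 by rewrite divr_gt0.
(* both mixed derivatives approximate the same second difference *)
have aux (A B S a a' b c r : R) : 0 < S -> a' = a ->
    `|a - b - c + r - S * A| <= e / 2 * S ->
    `|a' - c - b + r - S * B| <= e / 2 * S -> `|A - B| <= e.
  move=> S0 -> h1 h2; rewrite -(ler_pM2l S0) -[X in X * `|_|](gtr0_norm S0) -normrM.
  move: h1 h2; rewrite !ler_norml => /andP[h1 h2] /andP[h3 h4].
  by apply/andP; split; lra.
have [s [[h1 h2] s0]] := filter_ex (filterI (filterI (key u v _ e20) (key v u _ e20))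
  (nbhs_right_gt (0 : R))).
exact: (aux _ _ _ _ _ _ _ _ (exprn_gt0 2 s0)
  (congr1 f (addrAC p (s *: v) (s *: u))) h1 h2).
Unshelve. all: by end_near. Qed.

End Calculus.

(** * Bilinear forms and second-order expansions *)

Lemma is_derive_quadratic {R : realType} (a b c : R) :
  is_derive (0 : R) (1 : R) (fun t : R => a + b * t + c * t ^+ 2) b.
Proof.
have := is_derive_poly (a%:P + b *: 'X + c *: 'X^2) (0 : R).
rewrite (_ : horner _ = fun t : R => a + b * t + c * t ^+ 2).
  by rewrite !derivD !derivZ derivC derivX derivXn !hornerE /=.
by apply/funext => t; rewrite !hornerE.
Qed.

Section BilinearForms.
Context {R : realType} {n : nat}.
Implicit Types (M : 'M[R]_n) (u v w : 'cV[R]_n).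

Lemma sformDl M u u' v : sform M (u + u') v = sform M u v + sform M u' v.
Proof. by rewrite /sform linearD /= !mulmxDl mxE. Qed.

Lemma sformZl M k u v : sform M (k *: u) v = k * sform M u v.
Proof. by rewrite /sform linearZ /= -!scalemxAl mxE. Qed.

Lemma sformDr M u v v' : sform M u (v + v') = sform M u v + sform M u v'.
Proof. by rewrite /sform mulmxDr mxE. Qed.

Lemma sformZr M k u v : sform M u (k *: v) = k * sform M u v.
Proof. by rewrite /sform -scalemxAr mxE. Qed.

Lemma sform0l M v : sform M 0 v = 0.
Proof. by rewrite -[0](scale0r (0 : 'cV[R]_n)) sformZl mul0r. Qed.

Lemma sform0r M v : sform M v 0 = 0.
Proof. by rewrite -[0](scale0r (0 : 'cV[R]_n)) sformZr mul0r. Qed.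

Lemma sformNl M u v : sform M (- u) v = - sform M u v.
Proof. by rewrite -scaleN1r sformZl mulN1r. Qed.

Lemma sformNr M u v : sform M u (- v) = - sform M u v.
Proof. by rewrite -scaleN1r sformZr mulN1r. Qed.

Lemma sformBl M u u' v : sform M (u - u') v = sform M u v - sform M u' v.
Proof. by rewrite sformDl sformNl. Qed.

Lemma sformBr M u v v' : sform M u (v - v') = sform M u v - sform M u v'.
Proof. by rewrite sformDr sformNr. Qed.

Lemma sform_tr M u v : sform M u v = sform M^T v u.
Proof.
rewrite /sform; have -> : u^T *m M *m v = (v^T *m M^T *m u)^T.
  by rewrite !trmx_mul !trmxK mulmxA.
by rewrite mxE.
Qed.

Lemma sform_sym M u v : M^T = M -> sform M u v = sform M v u.
Proof. by move=> sM; rewrite sform_tr sM. Qed.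

Lemma sform_mull M (P : 'M[R]_n) u v : sform M (P *m u) v = sform (P^T *m M) u v.
Proof. by rewrite /sform trmx_mul !mulmxA. Qed.

Lemma sform_mulr M (P : 'M[R]_n) u v : sform M u (P *m v) = sform (M *m P) u v.
Proof. by rewrite /sform !mulmxA. Qed.

Lemma sform_delta M i j : sform M (delta_mx i 0) (delta_mx j 0) = M i j.
Proof. by rewrite /sform trmx_delta -rowE -colE !mxE. Qed.

Lemma sform_mulmx M u v : sform M u v = sform 1%:M u (M *m v).
Proof. by rewrite sform_mulr mul1mx. Qed.

Lemma sform_mxB M N u v : sform (M - N) u v = sform M u v - sform N u v.
Proof. by rewrite /sform mulmxBr mulmxBl !mxE. Qed.

Lemma sform1_eq0 v : (forall u, sform 1%:M u v = 0) -> v = 0.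
Proof.
move=> uv; apply/colP => i; rewrite mxE.
by have := uv (delta_mx i 0); rewrite /sform mulmx1 trmx_delta -rowE mxE.
Qed.

Lemma sform_eqP M N : (forall u v, sform M u v = sform N u v) -> M = N.
Proof. by move=> MN; apply/matrixP => i j; rewrite -!sform_delta. Qed.

Lemma sform_sum M u v : sform M u v = \sum_j (\sum_i u i 0 * M i j) * v j 0.
Proof.
rewrite /sform mxE; apply: eq_bigr => j _; rewrite mxE; congr (_ * _).
by apply: eq_bigr => i _; rewrite mxE.
Qed.

Lemma sform_bounded M : exists2 C, 0 < C & forall u v, `|sform M u v| <= C * `|u| * `|v|.
Proof.
exists (\sum_j \sum_i `|M i j| + 1) => [|u v].
  by rewrite ltr_wpDl// sumr_ge0// => j _; apply: sumr_ge0.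
apply: (@le_trans _ _ ((\sum_j \sum_i `|M i j|) * `|u| * `|v|)); last first.
  by rewrite ler_wpM2r// ler_wpM2r// lerDl.
rewrite sform_sum (le_trans (ler_norm_sum _ _ _))// !mulr_suml.
apply: ler_sum => j _; rewrite normrM ler_pM ?cV_coord_le//.
rewrite (le_trans (ler_norm_sum _ _ _))// mulr_suml; apply: ler_sum => i _.
by rewrite normrM mulrC ler_wpM2l// cV_coord_le.
Qed.

Lemma mulmx_bounded m (P : 'M[R]_(m, n)) :
  exists2 C, 0 < C & forall u, `|P *m u| <= C * `|u|.
Proof.
exists (\sum_j \sum_i `|P i j| + 1) => [|u].
  by rewrite ltr_wpDl// sumr_ge0// => j _; apply: sumr_ge0.
have S0 : 0 <= \sum_j \sum_i `|P i j| by rewrite sumr_ge0// => j _; apply: sumr_ge0.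
apply: cV_norm_le => [|i]; first by rewrite mulr_ge0// addr_ge0.
rewrite mxE (le_trans (ler_norm_sum _ _ _))// mulrDl mul1r -[leLHS]addr0 lerD//.
rewrite mulr_suml; apply: ler_sum => j _; rewrite normrM ler_pM ?cV_coord_le//.
by rewrite (bigD1 i)//= lerDl sumr_ge0.
Qed.

Lemma is_derive_sform M v w :
  is_derive v w (fun x => sform M x x) (sform M w v + sform M v w).
Proof.
apply: is_derive_lineP.
rewrite (_ : (fun t : R => _) = fun t => sform M v v +
    (sform M w v + sform M v w) * t + sform M w w * t ^+ 2).
  exact: is_derive_quadratic.
apply/funext => t; rewrite sformDl !sformDr !sformZl !sformZr.
ring.
Qed.

Lemma is_derive_sformr M u v w :
  is_derive v w (fun x => sform M u x) (sform M u w).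
Proof.
apply: is_derive_lineP.
rewrite (_ : (fun t : R => _) =
    fun t => sform M u v + sform M u w * t + 0 * t ^+ 2).
  exact: is_derive_quadratic.
by apply/funext => t; rewrite sformDr sformZr mul0r addr0 mulrC.
Qed.

End BilinearForms.

Section SecondOrder.
Context {R : realType} {n : nat}.
Implicit Types (h : 'cV[R]_n -> R) (u v w x y : 'cV[R]_n).

Definition gradient h v : 'cV[R]_n := \col_j 'D_(delta_mx j 0) h v.

Lemma derive_gradient h v w :
  differentiable h v -> 'D_w h v = sform 1%:M w (gradient h v).
Proof.
move=> dh; rewrite {1}(cV_sum_delta w) derive_sum_dir// /sform mulmx1 mxE.
by apply: eq_bigr => i _; rewrite !mxE.
Qed.

Lemma hessian_sym h x : Ck_on 2 setT h -> (hessian h x)^T = hessian h x.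
Proof.
move=> ch; apply/matrixP => i j; rewrite !mxE; apply: d2_sym => //.
exact: finite_coordinates_cV.
Qed.

Lemma d2_sform h x u v : Ck_on 2 setT h -> d2 h x u v = sform (hessian h x) u v.
Proof.
move=> [dh ch]; rewrite /d2.
have -> : (fun y => 'D_v h y) = fun y => \sum_j v j 0 *: 'D_(delta_mx j 0) h y.
  by apply/funext => y; rewrite {1}(cV_sum_delta v) derive_sum_dir//; exact: dh.
rewrite (_ : (fun y => _) = \sum_j (v j 0 *: 'D_(delta_mx j 0) h)); last first.
  by apply/funext => y; rewrite fct_sumE.
rewrite derive_sum; last first.
  by move=> j; apply/derivableZ/diff_derivable/(ch _).1.
rewrite sform_sum; apply: eq_bigr => j _.
rewrite deriveZ; last exact/diff_derivable/(ch _).1.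
rewrite mulrC; congr (_ * _).
rewrite {1}(cV_sum_delta u) derive_sum_dir; last exact: (ch _).1.
by apply: eq_bigr => i _; rewrite mxE.
Qed.

(** Strict differentiability at the origin of the partial derivatives. *)
Lemma gradient_expansion h : Ck_on 2 setT h -> forall k, 0 < k ->
  exists2 del, 0 < del & forall x y, `|x| < del -> `|y| < del ->
    `|gradient h x - gradient h y - hessian h 0 *m (x - y)| <= k * `|x - y|.
Proof.
move=> ch k k0; have [dh dch] := ch.
have H i : exists del : {posnum R}, forall x y,
    `|0 - x| < del%:num -> `|0 - y| < del%:num ->
    `|'D_(delta_mx i 0) h x - 'D_(delta_mx i 0) h y
      - 'D_(x - y) ('D_(delta_mx i 0) h) 0| <= k * `|x - y|.
  have [del del0 H] := @strictly_differentiable _ _ _ _ 0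
    (finite_coordinates_cV n) openT I (dch (delta_mx i 0)) _ k0.
  by exists (PosNum del0).
have [del {}H] := choice H.
exists (\big[Num.min/1]_i (del i)%:num).
  by elim/big_ind: _ => // x y x0 y0; rewrite lt_min x0.
have le_del i (x : R) : x < \big[Num.min/1]_i (del i)%:num -> x < (del i)%:num.
  by move/lt_le_trans; apply; exact: bigmin_le.
move=> x y px py; apply: cV_norm_le => [|i]; first by rewrite mulr_ge0// ltW.
have := H i x y; rewrite !sub0r !normrN => /(_ (le_del _ _ px) (le_del _ _ py)).
rewrite !mxE; congr (`|_ - _| <= _).
rewrite -[LHS]/(d2 h 0 (x - y) (delta_mx i 0)) (d2_sform _ _ _ ch) sform_sum.
rewrite (bigD1 i)//= [X in _ + X = _]big1 => [|j /negbTE ji]; last by rewrite mxE ji mulr0.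
rewrite mxE !eqxx mulr1 addr0; apply: eq_bigr => j _.
by rewrite mulrC -{1}(hessian_sym 0 ch) mxE.
Qed.

Lemma dot_bounded u v : `|sform 1%:M u v| <= n%:R * `|u| * `|v|.
Proof.
rewrite /sform mulmx1 mxE (le_trans (ler_norm_sum _ _ _))//.
rewrite -mulrA mulr_natl -[X in _ *+ X]card_ord -sumr_const.
by apply: ler_sum => i _; rewrite mxE normrM ler_pM ?cV_coord_le.
Qed.

(** The mean value theorem, applied to [h] minus its quadratic part, whose
    gradient is controlled by [gradient_expansion]. *)
Lemma energy_expansion h : Ck_on 2 setT h -> (forall v, 'D_v h 0 = 0) ->
  forall k, 0 < k -> exists2 del, 0 < del & forall r x y,
    r < del -> `|x| <= r -> `|y| <= r ->
    `|h x - h y - 2^-1 * (sform (hessian h 0) x x - sform (hessian h 0) y y)|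
      <= k * r * `|x - y|.
Proof.
move=> ch dh0 k k0; have [dh dch] := ch; set A := hessian h 0.
have k'0 : 0 < k / n.+1%:R by rewrite divr_gt0.
have [del del0 H] := gradient_expansion ch k'0.
exists del => // r x y rdel xr yr.
pose g z := h z - 2^-1 * sform A z z.
have dg z w : is_derive z w g ('D_w h z - 2^-1 * (sform A w z + sform A z w)).
  apply: is_deriveB; first exact/derivableP/diff_derivable/dh.
  exact/is_deriveZ/is_derive_sform.
have [|t /andP[t0 t1] E] := @mean_value_line _ _ g y (x - y).
  by move=> t _; have [] := dg (y + t *: (x - y)) (x - y).
rewrite (_ : h x - h y - _ = g (y + (x - y)) - g y); last first.
  by rewrite [y + (x - y)]addrC subrK /g; ring.
rewrite {}E; set q := y + _; have [_ ->] := dg q (x - y).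
have qr : `|q| <= r.
  rewrite /q scalerBr addrCA -[y in _ + (y - _)]scale1r -scalerBl.
  rewrite (le_trans (ler_normD _ _))// !normrZ (ger0_norm t0) ger0_norm ?subr_ge0//.
  have -> : r = t * r + (1 - t) * r by rewrite -mulrDl addrCA subrr addr0 mul1r.
  by rewrite lerD// ler_wpM2l// subr_ge0.
have g0 : gradient h 0 = 0 by apply/colP => i; rewrite !mxE dh0.
have := H q 0 (le_lt_trans qr rdel); rewrite normr0 subr0 g0 subr0 => /(_ del0) {}H.
rewrite derive_gradient; last exact: dh.
rewrite (sform_sym q); last exact: hessian_sym.
rewrite (_ : 2^-1 * (_ + _) = sform A (x - y) q); last by field.
rewrite (sform_mulmx A).
rewrite -sformBr (le_trans (dot_bounded _ _))//.
set w := `|_ - _ *m q| in H *.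
rewrite (_ : n%:R * _ * w = w * n%:R * `|x - y|); last by ring.
rewrite ler_wpM2r// (le_trans (ler_wpM2r _ H))//.
apply: (@le_trans _ _ (k / n.+1%:R * r * n%:R)).
  by rewrite ler_wpM2r// ler_wpM2l// ltW.
rewrite mulrAC ler_wpM2r ?(le_trans _ xr)//.
by rewrite -mulrA ler_piMr ?ltW// mulrC ltr_pdivrMr// mul1r ltr_nat.
Qed.

End SecondOrder.

(** * The exponential map of a Lie group *)

(* Proves identities between linear combinations of column vectors. *)
Ltac vec := apply/matrixP => ? ?; rewrite !mxE; ring.

Lemma is_derive_unique {R : numFieldType} {V W : normedModType R} (f : V -> W) x v a b :
  is_derive x v f a -> is_derive x v f b -> a = b.
Proof. by move=> [_ <-] [_ <-]. Qed.

Lemma ultra_cvg {T : topologicalType} (A : set T) (f : nat -> T) (F : set_system nat) :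
  UltraFilter F -> compact A -> (\forall k \near F, A (f k)) ->
  exists g, A g /\ f @ F --> g.
Proof.
move=> UF cA FA; have [g [Ag gF]] := cA _ (fmap_proper_filter f _) FA.
exists g; split=> // B gB; case: (in_ultra_setVsetC (f @^-1` B) UF) => // FB.
by have [x [nBx Bx]] : (~` B) `&` B !=set0 by apply: gF.
Qed.

Lemma is_derive_of_estimate {R : realType} {W : normedModType R} (f : R -> W) w :
  (forall eps, 0 < eps -> \forall t \near (0 : R), `|f t - f 0 - t *: w| <= eps * `|t|) ->
  is_derive (0 : R) 1 f w.
Proof.
move=> H; have c : (fun k : R => k^-1 *: ((f \o shift 0) (k *: (1 : R)) - f 0)) @ 0^' --> w.
  apply/cvgrPdist_le => eps eps0; rewrite near_withinE.
  near=> k; move=> k0 /=; have -> : k *: (1 : R) = k by exact: mulr1.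
  rewrite addr0; have -> : w - k^-1 *: (f k - f 0) = k^-1 *: (k *: w - (f k - f 0)).
    by rewrite [RHS]scalerBr scalerA mulVf// scale1r.
  rewrite normrZ normfV distrC mulrC ler_pdivrMr ?normr_gt0//.
  by near: k; exact: H.
by apply: DeriveDef; [apply/cvg_ex; exists w|apply: cvg_lim].
Unshelve. all: by end_near. Qed.

Section LieGroup.
Context {R : realType} {d : nat} {G : lieGroupType R d} (e : chart R d G).
Hypotheses (he : atlas e) (he1 : chart_dom e 1%g).
Local Notation o := (e 1%g).

Let mul_dom : set ('cV[R]_d * 'cV[R]_d) :=
  [set p | [/\ chart_img e p.1, chart_img e p.2 &
     chart_dom e (chart_inv e p.1 * chart_inv e p.2)%g]].

Let mul_coord (p : 'cV[R]_d * 'cV[R]_d) : 'cV[R]_d :=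
  e (chart_inv e p.1 * chart_inv e p.2)%g.

Lemma mul_dom_open (c1 c2 c3 : chart R d G) :
  open [set p : 'cV[R]_d * 'cV[R]_d | [/\ chart_img c1 p.1, chart_img c2 p.2 &
     chart_dom c3 (chart_inv c1 p.1 * chart_inv c2 p.2)%g]].
Proof.
rewrite openE => -[x y] [/= Dx Dy Dxy].
have c : {for (x, y), continuous
    (fun p : 'cV[R]_d * 'cV[R]_d => (chart_inv c1 p.1 * chart_inv c2 p.2)%g)}.
  apply: (@continuous_comp _ _ _
    (fun p : 'cV[R]_d * 'cV[R]_d => (chart_inv c1 p.1, chart_inv c2 p.2))
    (fun p => (p.1 * p.2)%g)); last exact: mulg_continuous.
  rewrite /prop_for /continuous_at /=; apply: cvg_pair.
    by apply: (@cvg_comp _ _ _ fst (chart_inv c1) _ (nbhs x)); [exact: cvg_fst|exact: chart_inv_continuous].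
  by apply: (@cvg_comp _ _ _ snd (chart_inv c2) _ (nbhs y)); [exact: cvg_snd|exact: chart_inv_continuous].
have o3 := c _ (open_nbhs_nbhs (conj (chart_dom_open c3) Dxy)).
have o1 : nbhs ((x, y) : 'cV[R]_d * 'cV[R]_d) (fst @^-1` chart_img c1).
  apply: (@cvg_fst _ _ (nbhs x) (nbhs y)); apply: open_nbhs_nbhs; split=> //.
  exact: chart_img_open.
have o2 : nbhs ((x, y) : 'cV[R]_d * 'cV[R]_d) (snd @^-1` chart_img c2).
  apply: (@cvg_snd _ _ (nbhs x) (nbhs y)); apply: open_nbhs_nbhs; split=> //.
  exact: chart_img_open.
by near=> p; split=> /=; near: p.
Unshelve. all: by end_near. Qed.

Lemma mul_dom1 : mul_dom (o, o).
Proof.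
split=> /=; try exact: chart_funP.
by rewrite !chart_funK// mulg1.
Qed.

Lemma mul_coord_differentiable : differentiable mul_coord (o, o).
Proof. exact: (mulg_smooth _ _ _ he he he 1%N).1 mul_dom1. Qed.

Lemma near_img : \forall y \near o, chart_img e y.
Proof. by apply: open_nbhs_nbhs; split; [exact: chart_img_open|exact: chart_funP]. Qed.

Lemma derive_mul_coord u v : 'D_(u, v) mul_coord (o, o) = u + v.
Proof.
have dm := mul_coord_differentiable.
have -> : (u, v) = (u, 0) + (0, v) :> 'cV[R]_d * 'cV[R]_d.
  by rewrite [RHS]/GRing.add/= /add_pair /= addr0 add0r.
rewrite deriveD_dir//; congr (_ + _).
- have := is_derive_line (y := (o, o)) (v := (u, 0)) (t := 0 : R).
  move=> /(_ _ mul_coord); rewrite scale0r addr0 => /(_ (diff_derivable dm)) D1.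
  have D2 : is_derive (0 : R) 1 (fun t : R => mul_coord ((o, o) + t *: (u, 0))) u.
    apply: (@near_eq_is_derive _ _ _ (fun t : R => o + t *: u)); last first.
      have := @is_derive_line _ _ _ id o u (0 : R) (@derivable_id _ _ _ _).
      by rewrite derive_id.
    have c : (fun t : R => o + t *: u) @ (0 : R) --> o + (0 : R) *: u.
      by apply: cvgD; [exact: cvg_cst|apply: cvgZr_tmp; exact: cvg_id].
    rewrite scale0r addr0 in c.
    near=> t; rewrite /mul_coord /= scaler0 addr0 (chart_funK he1) mulg1 chart_invK//.
    by near: t; exact: c _ near_img.
  exact: is_derive_unique D1 D2.
- have := is_derive_line (y := (o, o)) (v := (0, v)) (t := 0 : R).
  move=> /(_ _ mul_coord); rewrite scale0r addr0 => /(_ (diff_derivable dm)) D1.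
  have D2 : is_derive (0 : R) 1 (fun t : R => mul_coord ((o, o) + t *: (0, v))) v.
    apply: (@near_eq_is_derive _ _ _ (fun t : R => o + t *: v)); last first.
      have := @is_derive_line _ _ _ id o v (0 : R) (@derivable_id _ _ _ _).
      by rewrite derive_id.
    have c : (fun t : R => o + t *: v) @ (0 : R) --> o + (0 : R) *: v.
      by apply: cvgD; [exact: cvg_cst|apply: cvgZr_tmp; exact: cvg_id].
    rewrite scale0r addr0 in c.
    near=> t; rewrite /mul_coord /= scaler0 addr0 (chart_funK he1) mul1g chart_invK//.
    by near: t; exact: c _ near_img.
  exact: is_derive_unique D1 D2.
Unshelve. all: by end_near. Qed.

Definition small (del : R) (g : G) := chart_dom e g /\ `|e g - o| < del.

Lemma nbhs_small del : 0 < del -> nbhs (1%g : G) (small del).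
Proof.
move=> del0; apply: filterI; first by apply: open_nbhs_nbhs; split => //; exact: chart_dom_open.
have /cvgrPdist_lt/(_ _ del0) := chart_fun_continuous he1.
by apply: filterS => g; rewrite distrC.
Qed.

Lemma smallW del del' g : del <= del' -> small del g -> small del' g.
Proof. by move=> dd' [Dg gd]; split => //; exact: lt_le_trans dd'. Qed.

Lemma small1 del : 0 < del -> small del 1%g.
Proof. by move=> del0; split=> //; rewrite subrr normr0. Qed.

Lemma chart_fun_inj g g' : chart_dom e g -> chart_dom e g' -> e g = e g' -> g = g'.
Proof. by move=> Dg Dg' gg'; rewrite -(chart_funK Dg) gg' chart_funK. Qed.

(** Strict differentiability of the multiplication at the identity: it is the
    addition of coordinates up to a small Lipschitz error. *)
Lemma mul_strict eps : 0 < eps -> exists2 del, 0 < del &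
  forall a b a' b', small del a -> small del b -> small del a' -> small del b' ->
  [/\ chart_dom e (a * b)%g, chart_dom e (a' * b')%g &
    `|e (a * b)%g - e (a' * b')%g - ((e a - e a') + (e b - e b'))|
      <= eps * Num.max `|e a - e a'| `|e b - e b'|].
Proof.
move=> eps0.
have fcU := finite_coordinates_pair (finite_coordinates_cV (R := R) d) (finite_coordinates_cV d).
have [del1 del10 H] := strictly_differentiable_cV fcU (@mul_dom_open e e e) mul_dom1
  (mulg_smooth _ _ _ he he he 1%N) eps0.
have /nbhs_ballP[del2 /= del20 D] :=
  open_nbhs_nbhs (conj (@mul_dom_open e e e) mul_dom1).
exists (Num.min del1 del2) => [|a b a' b']; first by rewrite lt_min del10.
have Dm g g' : small (Num.min del1 del2) g -> small (Num.min del1 del2) g' ->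
    chart_dom e (g * g')%g /\ `|((o, o) : 'cV[R]_d * 'cV[R]_d) - (e g, e g')| < del1.
  move=> [Dg]; rewrite lt_min => /andP[g1 g2] [Dg']; rewrite lt_min => /andP[g'1 g'2].
  split; last by rewrite prod_normE gt_max /= distrC g1 distrC.
  have [|_ _] := D (e g, e g'); last by rewrite /= !chart_funK.
  by rewrite -ball_normE /ball_ /= prod_normE gt_max /= distrC g2 distrC.
move=> sa sb sa' sb'; have [Dab ab1] := Dm _ _ sa sb; have [Da'b' ab'1] := Dm _ _ sa' sb'.
split=> //; have := H _ _ ab1 ab'1.
rewrite -/mul_coord [(e a, e b) - _]/GRing.add/= /add_pair/= derive_mul_coord.
by rewrite /mul_coord /= prod_normE/= (chart_funK sa.1) (chart_funK sb.1)
  (chart_funK sa'.1) (chart_funK sb'.1).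
Qed.

Lemma mul_estimate eps : 0 < eps -> exists2 del, 0 < del &
  forall a b, small del a -> small del b -> chart_dom e (a * b)%g /\
    `|e (a * b)%g - o - ((e a - o) + (e b - o))| <= eps * `|e b - o|.
Proof.
move=> eps0; have [del del0 H] := mul_strict eps0; exists del => // a b sa sb.
have [Dab _] := H a b a 1%g sa sb sa (small1 del0).
rewrite mulg1 subrr add0r normr0 max_r// => E; split=> //.
by move: E; congr (`|_| <= _); vec.
Qed.

Lemma small_basis (W : set G) : nbhs (1%g : G) W ->
  exists2 del, 0 < del & forall g, small del g -> W g.
Proof.
rewrite -{1}(chart_funK he1) => W1.
have := chart_inv_continuous (chart_funP he1) W1.
move=> /nbhs_ballP[del /= del0 H]; exists del => // g [Dg gd].
rewrite -(chart_funK Dg); apply: H.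
by rewrite -ball_normE /ball_/= distrC.
Qed.

(** Apply [mul_estimate] to the product of an element and its inverse. *)
Lemma inv_estimate eps : 0 < eps -> exists2 del, 0 < del &
  forall a, small del a -> chart_dom e (a^-1)%g /\
    `|e (a^-1)%g - o + (e a - o)| <= eps * `|e a - o|.
Proof.
move=> eps0; have [del del0 H] := mul_estimate eps0.
have [|del' del'0 sub] := @small_basis (fun g => small del (g^-1)%g).
  by apply: (invg_continuous (1%g : G)); rewrite invg1; exact: nbhs_small.
exists (Num.min del del') => [|a sa]; first by rewrite lt_min del0.
have sV : small del (a^-1)%g.
  by apply: sub; apply: smallW sa; rewrite ge_min lexx orbT.
have sa' : small del a by apply: smallW sa; rewrite ge_min lexx.
have [_] := H _ _ sV sa'; rewrite mulVg subrr sub0r normrN => E.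
by split => //; case: sV.
Qed.

(** The errors of [i] successive multiplications by [p] add up; the factor [2]
    keeps the intermediate powers in the domain of [mul_estimate]. *)
Lemma power_estimate eps : 0 < eps -> eps <= 1 -> exists2 del, 0 < del &
  forall p i, chart_dom e p -> i%:R * 2 * `|e p - o| < del ->
    [/\ chart_dom e (p ^+ i)%g, `|e (p ^+ i)%g - o| <= i%:R * 2 * `|e p - o| &
    `|e (p ^+ i)%g - o - i%:R *: (e p - o)| <= eps * i%:R * `|e p - o|].
Proof.
move=> eps0 eps1; have [del del0 H] := mul_estimate eps0; exists del => // p i Dp.
elim: i => [_|i IH lt_del].
  by rewrite expg0 scale0r subrr subr0 normr0 !mulr0 !mul0r.
have x0 : 0 <= `|e p - o| by [].
have i0 : 0 <= i%:R :> R by [].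
have i1 : i.+1%:R = i%:R + 1 :> R by rewrite natr1.
have i_lt : i%:R * 2 * `|e p - o| < del.
  by apply: le_lt_trans lt_del; rewrite ler_wpM2r// ler_wpM2r// ler_nat.
have [Di id ie] := IH i_lt.
have pd : `|e p - o| < del by apply: le_lt_trans lt_del; rewrite i1; nra.
have [Dip] := H (p ^+ i)%g p (conj Di (le_lt_trans id i_lt)) (conj Dp pd).
rewrite -expgSr in Dip * => ipe.
have E : `|e (p ^+ i.+1)%g - o - i.+1%:R *: (e p - o)| <= eps * i.+1%:R * `|e p - o|.
  rewrite [X in `|X|](_ : _ = e (p ^+ i.+1)%g - o - (e (p ^+ i)%g - o + (e p - o)) +
    (e (p ^+ i)%g - o - i%:R *: (e p - o))); last by rewrite i1; vec.
  by rewrite (le_trans (ler_normD _ _))// (le_trans (lerD ipe ie))// i1; nra.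
split=> //; rewrite -[X in `|X|](subrK (i.+1%:R *: (e p - o))).
rewrite (le_trans (ler_normD _ _))// normrZ normr_nat (le_trans (lerD E (lexx _)))//.
have J0 : 0 <= i.+1%:R :> R by [].
have := mulr_ge0 (mulr_ge0 (_ : 0 <= 1 - eps) J0) x0; rewrite subr_ge0 => /(_ eps1).
lra.
Qed.

Lemma cV_closed_ball_compact (c : 'cV[R]_d) r :
  compact [set y : 'cV[R]_d | `|y - c| <= r].
Proof.
have cT : continuous (trmx : 'rV[R]_d -> 'cV[R]_d).
  move=> x A /nbhs_ballP[eps eps0 H]; apply/nbhs_ballP; exists eps => // y [_ xy].
  by apply: H; split=> // i j; rewrite !mxE; exact: xy.
have nT (x : 'rV[R]_d) : `|x^T| = `|x|.
  apply/eqP; rewrite eq_le; apply/andP; split.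
    apply: cV_norm_le => // i; rewrite mxE [leRHS]/Num.Def.normr/= mx_normrE.
    exact: (@le_bigmax _ _ _ _ (fun ij : 'I_1 * 'I_d => `|x ij.1 ij.2|) (0, i)).
  rewrite [leLHS]/Num.Def.normr/= mx_normrE; apply/bigmax_leP; split=> // -[i j] _ /=.
  by rewrite ord1 (le_trans _ (cV_coord_le _ j))// mxE.
rewrite (_ : mkset _ = trmx @` [set y : 'rV[R]_d | `|y - c^T| <= r]).
  apply: continuous_compact; first exact: continuous_subspaceT.
  apply: bounded_closed_compact.
    exists (`|c^T| + r); split=> [|M cM y yr]; first exact: num_real.
    apply: le_trans (ltW cM); rewrite -[X in `|X|](subrK c^T) addrC.
    by rewrite (le_trans (ler_normD _ _))// lerD2l.
  rewrite (_ : mkset _ = closed_ball_ Num.norm c^T r); first exact: closed_closed_ball_.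
  by apply/funext => y; rewrite /closed_ball_ /= distrC.
apply/seteqP; split=> [y yr|_ [y yr <-]] /=.
  by exists y^T => /=; rewrite ?trmxK// -linearB -nT trmxK.
by rewrite -[c]trmxK -linearB nT.
Qed.

(** Let [p k] tend to the identity with [k *: (e (p k) - o)] tending to [eta].  The
    limits [L t] of the powers [p k ^+ truncn (k t)] define a one-parameter
    semigroup, extended to negative times by [L t * (L (- t))^-1]. *)
Section Powers.
Variables (p : nat -> G) (eta : 'cV[R]_d) (F : set_system nat) (L : R -> G).
Hypotheses (UF : UltraFilter F) (p1 : p @ F --> (1%g : G)).
Hypothesis peta : (fun k => k%:R *: (e (p k) - o)) @ F --> eta.
Let pw (t : R) (k : nat) : G := (p k ^+ Num.truncn (k%:R * t))%g.
Hypothesis pwL : forall t, pw t @ F --> L t.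

Let limit_unique (f : nat -> G) (g g' : G) : f @ F --> g -> f @ F --> g' -> g = g'.
Proof. by move=> fg fg'; apply: (cvg_unique (@lie_hausdorff _ _ G) fg fg'). Qed.

Let limit_mul (f f' : nat -> G) (g g' : G) :
  f @ F --> g -> f' @ F --> g' -> (fun k => (f k * f' k)%g) @ F --> (g * g')%g.
Proof.
move=> fg fg'; apply: (@cvg_comp _ _ _ (fun k => (f k, f' k))
  (fun q : G * G => (q.1 * q.2)%g) _ (nbhs (g, g'))); first exact: cvg_pair.
exact: (@mulg_continuous G (g, g')).
Qed.

Let L_le0 t : t <= 0 -> L t = 1%g.
Proof.
move=> t0; apply: (limit_unique (@pwL t)).
rewrite (_ : pw t = fun=> 1%g); first exact: cvg_cst.
apply/funext => k; rewrite /pw; suff -> : Num.truncn (k%:R * t) = 0%N by [].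
apply/truncn0Pn; rewrite -ltNge (le_lt_trans _ ltr01)//.
by rewrite mulr_ge0_le0.
Qed.

Let L_comm s t : (L s * L t = L t * L s)%g.
Proof.
apply: (limit_unique (limit_mul (@pwL s) (@pwL t))).
rewrite (_ : (fun k => _) = fun k => (pw t k * pw s k)%g); first exact: limit_mul.
by apply/funext => k; rewrite /pw -!expgnDr addnC.
Qed.

(* The integer parts of [k s] and [k t] add up to that of [k (s + t)] or to its
   predecessor, and [p k] tends to the identity. *)
Let L_add s t : 0 <= s -> 0 <= t -> L (s + t) = (L s * L t)%g.
Proof.
move=> s0 t0; pose j k := (Num.truncn (k%:R * (s + t)) -
   (Num.truncn (k%:R * s) + Num.truncn (k%:R * t)))%N.
have trn k : Num.truncn (k%:R * (s + t)) =
    (Num.truncn (k%:R * s) + Num.truncn (k%:R * t) + j k)%N /\ (j k <= 1)%N.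
  have k0 : 0 <= k%:R :> R by [].
  have /andP[a1 a2] := truncn_itv (mulr_ge0 k0 s0).
  have /andP[b1 b2] := truncn_itv (mulr_ge0 k0 t0).
  have /andP[c1 c2] := truncn_itv (mulr_ge0 k0 (addr_ge0 s0 t0)).
  have h1 : (Num.truncn (k%:R * s) + Num.truncn (k%:R * t) <
      (Num.truncn (k%:R * (s + t))).+1)%N.
    by rewrite -(ltr_nat R) natrD (le_lt_trans _ c2)// mulrDr lerD.
  have h2 : (Num.truncn (k%:R * (s + t)) <
      (Num.truncn (k%:R * s)).+1 + (Num.truncn (k%:R * t)).+1)%N.
    by rewrite -(ltr_nat R) natrD (le_lt_trans c1)// mulrDr ltrD.
  by rewrite /j subnKC// leq_subLR; split=> //; move: h2; rewrite addSn addnS !ltnS addn1.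
apply: (limit_unique (@pwL (s + t))).
rewrite (_ : pw (s + t) = fun k => (pw s k * pw t k * p k ^+ j k)%g); last first.
  by apply/funext => k; rewrite /pw (trn k).1 !expgnDr.
rewrite -[X in _ --> X]mulg1; apply: limit_mul; first exact: limit_mul.
move=> A A1; have := p1 A1; rewrite /nbhs/=; apply: filterS => k Ak.
suff : A (p k ^+ j k)%g by [].
have := (trn k).2.
case: (j k) => [_|[_|//]]; last by rewrite expg1.
by rewrite expg0; exact: nbhs_singleton.
Qed.

Let L_estimate eps : 0 < eps -> eps <= 1 -> exists2 del, 0 < del &
  forall t, 0 <= t -> t * 2 * (`|eta| + 1) < del -> chart_dom e (L t) /\
    `|e (L t) - o - t *: eta| <= eps * t * (`|eta| + 1).
Proof.
move=> eps0 eps1; have [del1 del10 H] := power_estimate eps0 eps1.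
have /nbhs_ballP[r /= r0 Hr] := near_img.
exists (Num.min del1 (r / 2)) => [|t t0]; first by rewrite lt_min del10 divr_gt0.
set N := `|eta| + 1; rewrite lt_min => /andP[tN tr].
have eta0 : 0 <= `|eta| by [].
have N1 : 1 <= N by rewrite lerDr.
have bnd k : chart_dom e (p k) -> `|eta - k%:R *: (e (p k) - o)| < 1 ->
    (Num.truncn (k%:R * t))%:R * `|e (p k) - o| <= t * N.
  move=> _ kN; have k0 : 0 <= k%:R :> R by [].
  have /andP[i1 _] := truncn_itv (mulr_ge0 k0 t0).
  apply: (@le_trans _ _ (k%:R * t * `|e (p k) - o|)); first by rewrite ler_wpM2r.
  rewrite mulrAC mulrC ler_wpM2l// -[leLHS]ger0_norm// ?mulr_ge0//.
  rewrite -(normr_id (_ - _)) normr_id -[X in `|X * _|](ger0_norm k0) -normrZ normr_id.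
  rewrite -[X in `|X|](subrK eta) addrC (le_trans (ler_normD _ _))// lerD2l.
  by rewrite distrC ltW.
have Dp : \forall k \near F, chart_dom e (p k).
  by apply: p1; apply: open_nbhs_nbhs; split=> //; exact: chart_dom_open.
have peta1 kap : 0 < kap -> \forall k \near F, `|eta - k%:R *: (e (p k) - o)| < kap.
  by move=> kap0; exact: cvgr_dist_lt.
have est k : chart_dom e (p k) -> `|eta - k%:R *: (e (p k) - o)| < 1 ->
  [/\ chart_dom e (pw t k), `|e (pw t k) - o| <= r / 2 &
    `|e (pw t k) - o - (Num.truncn (k%:R * t))%:R *: (e (p k) - o)| <= eps * t * N].
  move=> Dk kN; have b := bnd k Dk kN.
  have b2 : (Num.truncn (k%:R * t))%:R * 2 * `|e (p k) - o| <= t * 2 * N.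
    by rewrite mulrAC [leRHS]mulrAC ler_wpM2r.
  have [Dpw e1 e2] := H _ _ Dk (le_lt_trans b2 tN).
  split=> //; first exact: le_trans e1 (le_trans b2 (ltW tr)).
  by apply: (le_trans e2); rewrite -!mulrA ler_wpM2l// ltW.
have near1 : \forall k \near F, chart_dom e (p k) /\ `|eta - k%:R *: (e (p k) - o)| < 1.
  by apply: filterI => //; exact: peta1.
(* the coordinates of the powers stay in a compact ball inside the chart, so
   that [L t] lies in the domain of the chart *)
have [y [yr ylim]] := @ultra_cvg _ _ (fun k => e (pw t k)) F UF
  (cV_closed_ball_compact (c := o) (r := r / 2))
  (filterS (fun k (q : chart_dom e (p k) /\ _) => let: And3 _ a _ := est k q.1 q.2 in a) near1).
have yimg : chart_img e y.
  apply: Hr; rewrite -ball_normE /ball_/= distrC (le_lt_trans yr)//.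
  by rewrite ltr_pdivrMr// ltr_pMr// ltr1n.
have Lt : L t = chart_inv e y.
  apply: (limit_unique (@pwL t)).
  have := @cvg_comp _ _ _ (fun k => e (pw t k)) (chart_inv e) F _ _ ylim
    (chart_inv_continuous yimg).
  apply: cvg_trans; apply: near_eq_cvg.
  apply: filterS near1 => k [Dk kN] /=.
  by have [Dpw _ _] := est k Dk kN; rewrite chart_funK.
rewrite Lt chart_invK//; split; first exact: chart_invP.
apply/ler_addgt0Pr => kap kap0.
have k30 : 0 < kap / 3 by rewrite divr_gt0.
have k3t0 : 0 < kap / 3 / (t + 1) by rewrite divr_gt0// ltr_wpDl.
have /cvgrPdist_lt/(_ _ k30) yd := ylim.
have [k [[[Dk kN] kt] [yk pk]]] := filter_ex (filterI (filterI near1 (peta1 _ k3t0))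
  (filterI yd (p1 (nbhs_small k30)))).
have [Dpw _ e2] := est k Dk kN.
have /andP[i1 i2] := truncn_itv (mulr_ge0 (ler0n R k) t0).
set i := (Num.truncn _)%:R in i1 e2.
have {}i2 : k%:R * t < i + 1 by rewrite /i natr1.
rewrite [X in `|X|](_ : _ = (y - e (pw t k)) + (e (pw t k) - o - i *: (e (p k) - o))
  - ((k%:R * t - i) *: (e (p k) - o)) - t *: (eta - k%:R *: (e (p k) - o))); last by vec.
rewrite (le_trans (ler_normB _ _))// (le_trans (lerD (ler_normB _ _) (lexx _)))//.
rewrite (le_trans (lerD (lerD (ler_normD _ _) (lexx _)) (lexx _)))//.
rewrite !normrZ (ger0_norm t0) ger0_norm ?subr_ge0//.
have h1 : t * `|eta - k%:R *: (e (p k) - o)| <= kap / 3.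
  apply: (@le_trans _ _ (t * (kap / 3 / (t + 1)))); first by rewrite ler_wpM2l// ltW.
  rewrite mulrCA mulrC -[leRHS]mul1r ler_wpM2r ?(ltW k30)//.
  by rewrite ler_pdivrMr ?ltr_wpDl// mul1r lerDl.
have h2 : (k%:R * t - i) * `|e (p k) - o| <= kap / 3.
  apply: (@le_trans _ _ (1 * `|e (p k) - o|)).
    by rewrite ler_wpM2r// lerBlDl ltW.
  by rewrite mul1r; exact: ltW pk.2.
have h3 := ltW yk.
have -> : kap = kap / 3 + kap / 3 + kap / 3 by field.
by rewrite addrA addrA [eps * t * N + _]addrC lerD// lerD// lerD.
Qed.

Let gamma t := (L t * (L (- t))^-1)%g.

Let gamma_add s t : gamma (s + t) = (gamma s * gamma t)%g.
Proof.
(* The positive and negative parts of [s], [t] and [s + t] add up. *)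
have E : (L s * L t * L (- (s + t)) = L (s + t) * (L (- s) * L (- t)))%g.
  have [s0|/ltW s0] := leP 0 s; have [t0|/ltW t0] := leP 0 t.
  - by rewrite L_add// !(@L_le0 (- _)) ?oppr_le0 ?addr_ge0// !mulg1.
  - rewrite (L_le0 t0) (@L_le0 (- s)) ?oppr_le0// mulg1 mul1g.
    have [st|/ltW st] := leP 0 (s + t).
      rewrite (@L_le0 (- _)) ?oppr_le0// mulg1 -L_add ?oppr_ge0//.
      by rewrite addrK.
    by rewrite (L_le0 st) mul1g -L_add ?oppr_ge0// opprD addNKr.
  - rewrite (L_le0 s0) (@L_le0 (- t)) ?oppr_le0// mulg1 mul1g.
    have [st|/ltW st] := leP 0 (s + t).
      rewrite (@L_le0 (- _)) ?oppr_le0// mulg1 -L_add ?oppr_ge0//.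
      by rewrite addrAC subrr add0r.
    by rewrite (L_le0 st) mul1g -L_add ?oppr_ge0// opprD addrCA subrr addr0.
  - have st : s + t <= 0 by rewrite -oppr_ge0 opprD addr_ge0 ?oppr_ge0.
    by rewrite (L_le0 s0) (L_le0 t0) (L_le0 st) !mul1g opprD L_add ?oppr_ge0.
rewrite /gamma; have -> : L (s + t) = (L s * L t * L (- (s + t)) * (L (- s) * L (- t))^-1)%g.
  by rewrite E mulgK.
have cV a b : commute (L a) (L b)^-1%g by apply: commuteV; exact: L_comm.
have cP : commute (L (- (s + t))) (L (- s) * L (- t))^-1%g.
  by apply/commuteV/commuteM; exact: L_comm.
rewrite -[X in (X * _)%g]mulgA cP -!mulgA mulgV mulg1; congr (_ * _)%g.
by rewrite (L_comm (- s) (- t)) invgM mulgA (cV t (- s)) -mulgA.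
Qed.

Let gamma0 : gamma 0 = 1%g.
Proof. by rewrite /gamma oppr0 L_le0// mul1g invg1. Qed.

Let gamma_estimate eps : 0 < eps -> \forall t \near (0 : R),
  chart_dom e (gamma t) /\ `|e (gamma t) - o - t *: eta| <= eps * `|t|.
Proof.
move=> eps0; set N := `|eta| + 1.
have N0 : 0 < N by rewrite ltr_wpDl.
have eps'0 : 0 < Num.min 1 (eps / (3 * N)).
  by rewrite lt_min ltr01 divr_gt0// mulr_gt0.
have eps'1 : Num.min 1 (eps / (3 * N)) <= 1 by rewrite ge_min lexx.
have eps'E : Num.min 1 (eps / (3 * N)) * 3 * N <= eps.
  by rewrite -mulrA -ler_pdivlMr ?mulr_gt0// ge_min lexx orbT.
move: (Num.min _ _) eps'0 eps'1 eps'E => k k0 k1 kE.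
have [del1 del10 H1] := L_estimate k0 k1; have [del2 del20 H2] := inv_estimate k0.
apply/nbhs_ballP; exists (Num.min del1 del2 / (2 * N)).
  by rewrite /= divr_gt0 ?mulr_gt0// lt_min del10.
move=> t; rewrite -ball_normE /ball_/= sub0r normrN ltr_pdivlMr ?mulr_gt0//.
rewrite mulrA lt_min -/N => /andP[td1 td2].
have x0 : 0 <= `|t| by [].
have [t0|/ltW t0] := leP 0 t.
  rewrite /gamma (@L_le0 (- t)) ?oppr_le0// invg1 mulg1.
  rewrite (ger0_norm t0) in td1 td2 x0 *; have [Dt Et] := H1 t t0 td1.
  split=> //; apply: (le_trans Et); rewrite -/N; nra.
have Nt0 : 0 <= - t by rewrite oppr_ge0.
rewrite /gamma (L_le0 t0) mul1g; rewrite (ler0_norm t0) in td1 td2 x0 *.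
have [Dt Et] := H1 _ Nt0 td1.
have eta0 : 0 <= `|eta| by [].
have eN : `|e (L (- t)) - o| <= - t * 2 * N.
  rewrite -[X in `|X|](subrK (- t *: eta)) (le_trans (ler_normD _ _))//.
  rewrite (le_trans (lerD Et (lexx _)))// normrZ (ger0_norm Nt0) -/N.
  have : `|eta| <= N by rewrite lerDl.
  have h1 : 0 <= (1 - k) * (- t) * N by rewrite !mulr_ge0 ?subr_ge0// ltW.
  move=> h2; have h3 : 0 <= - t * (N - `|eta|) by rewrite mulr_ge0 ?subr_ge0.
  lra.
have [DV EV] := H2 _ (conj Dt (le_lt_trans eN td2)).
split=> //.
rewrite [X in `|X|](_ : _ = (e (L (- t))^-1%g - o + (e (L (- t)) - o)) -
  (e (L (- t)) - o - (- t) *: eta)); last by vec.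
rewrite (le_trans (ler_normB _ _))// (le_trans (lerD EV Et))// -/N.
rewrite (le_trans (lerD (ler_wpM2l (ltW k0) eN) (lexx _)))//.
have -> : k * (- t * 2 * N) + k * - t * N = k * 3 * N * - t by ring.
by rewrite ler_wpM2r.
Qed.

Lemma powers_one_parameter (K : set G) : is_subgroup K -> (forall t, K (L t)) ->
  lie_subalgebra e K eta.
Proof.
move=> [K1 KM KV] KL; exists gamma; split; last first.
  by move=> t; apply: KM => //; exact: KV.
have g1 : gamma @ (0 : R) --> (1%g : G).
  move=> W W1; have [del del0 sub] := small_basis W1.
  have H := gamma_estimate ltr01.
  suff : \forall t \near (0 : R), W (gamma t) by [].
  near=> t; apply: sub.
  have [Dt Et] : chart_dom e (gamma t) /\ `|e (gamma t) - o - t *: eta| <= 1 * `|t|.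
    by near: t.
  split=> //; rewrite -[X in `|X|](subrK (t *: eta)) (le_lt_trans (ler_normD _ _))//.
  rewrite (le_lt_trans (lerD Et (lexx _)))// normrZ mul1r -[X in X + _]mulr1 -mulrDr.
  rewrite -ltr_pdivlMr ?ltr_wpDr//; near: t.
  apply/nbhs_ballP; exists (del / (1 + `|eta|)); first by rewrite /= divr_gt0// ltr_wpDr.
  by move=> t; rewrite -ball_normE /ball_/= sub0r normrN.
split; last 2 first.
- exact: gamma_add.
- apply: is_derive_of_estimate => eps eps0; rewrite gamma0.
  by apply: filterS (gamma_estimate eps0) => t [].
move=> s; have -> : gamma = fun t => (gamma s * gamma (t - s))%g.
  by apply/funext => t; rewrite -gamma_add addrCA subrr addr0.
rewrite /continuous_at /= subrr gamma0 mulg1.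
rewrite -[X in _ --> X]mulg1.
apply: (@cvg_comp _ _ _ (fun t => (gamma s, gamma (t - s)))
  (fun q : G * G => (q.1 * q.2)%g) _ (nbhs (gamma s, 1%g : G))); last first.
  exact: (@mulg_continuous G (gamma s, 1%g)).
apply: cvg_pair; first exact: cvg_cst.
apply: (@cvg_comp _ _ _ (fun t => t - s) gamma _ (nbhs (0 : R))) => //.
have ts : (fun t : R => t - s) @ (s : R) --> s - s.
  by apply: cvgB; [exact: cvg_id|exact: cvg_cst].
by rewrite subrr in ts; exact: ts.
Unshelve. all: by end_near. Qed.

End Powers.

(** An ultrafilter limit turns the powers of elements [p k] converging to the
    identity, with [k *: (e (p k) - o)] converging to [eta], into the
    one-parameter subgroup of velocity [eta]: the homomorphism property is
    inherited from that of powers, and compactness provides the limits. *)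
Lemma one_parameter_limit (K : set G) (p : nat -> G) eta :
  compact [set: G] -> is_subgroup K -> closed K -> (forall k, K (p k)) ->
  p @ \oo --> (1%g : G) ->
  (fun k => k%:R *: (e (p k) - o)) @ \oo --> eta ->
  lie_subalgebra e K eta.
Proof.
move=> cG sK clK Kp p1 peta; have [K1 KM KV] := sK.
have [F [UF subF]] := ultraFilterLemma (eventually_filter : ProperFilter \oo).
pose pw (t : R) k := (p k ^+ Num.truncn (k%:R * t))%g.
have Kpw t k : K (pw t k).
  by rewrite /pw; elim: (Num.truncn _) => [|i IH]; rewrite ?expg0// expgS; exact: KM.
have cK : compact K by apply: subclosed_compact clK cG _.
have [L HL] := choice (fun t => @ultra_cvg _ _ (pw t) F UF cK
  (filterS (fun k _ => Kpw t k) filterT)).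
have pF : p @ F --> (1%g : G) by move=> A A1; apply: subF; exact: p1.
have etaF : (fun k => k%:R *: (e (p k) - o)) @ F --> eta.
  by move=> A A1; apply: subF; exact: peta.
exact: (powers_one_parameter UF pF etaF (fun t => (HL t).2) sK (fun t => (HL t).1)).
Qed.

End LieGroup.

Lemma estimate_of_is_derive {R : realType} {W : normedModType R} (f : R -> W) w eps :
  is_derive (0 : R) 1 f w -> 0 < eps ->
  \forall t \near (0 : R), `|f t - f 0 - t *: w| <= eps * `|t|.
Proof.
move=> [/derivable_nbhs/eqaddoP df <-] eps0; have := df _ eps0.
apply: filterS => t /=.
rewrite -[X in `|X| <= _ -> _]/(f (t *: (1 : R) + 0) - (f 0 + t *: 'D_1 f 0)).
by rewrite addr0 [t *: 1]mulr1 opprD addrA.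
Qed.

Lemma near0_div {R : realType} (P : R -> Prop) (t : R) :
  (\forall s \near (0 : R), P s) -> \forall N \near \oo, P (t / N.+1%:R).
Proof.
move=> /nbhs_ballP[del /= del0 H].
have e0 : 0 < del / (`|t| + 1) by rewrite divr_gt0// ltr_wpDl.
apply: filterS (near_infty_natSinv_lt (PosNum e0)) => N /= NN.
apply: H; rewrite -ball_normE /ball_/= sub0r normrN normrM (gtr0_norm (_ : 0 < _^-1))//.
rewrite ltr_pdivlMr ?ltr_wpDl// in NN; apply: le_lt_trans NN.
by rewrite mulrC ler_wpM2l// lerDl.
Qed.

Lemma cvg_mulg {G : topologicalGroupType} {T : Type} (F : set_system T) {FF : Filter F}
    (f g : T -> G) (a b : G) :
  f @ F --> a -> g @ F --> b -> (fun x => (f x * g x)%g) @ F --> (a * b)%g.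
Proof.
move=> fa gb; apply: (@cvg_comp _ _ _ (fun k => (f k, g k))
  (fun q : G * G => (q.1 * q.2)%g) _ (nbhs (a, b))); first exact: cvg_pair.
exact: (@mulg_continuous G (a, b)).
Qed.

(** The commutator with [x] is continuous, and points are closed. *)
Lemma closed_commute {G : topologicalGroupType} (x : G) : hausdorff_space G ->
  closed [set g : G | (g * x = x * g)%g].
Proof.
move=> hG.
rewrite (_ : mkset _ = (fun g : G => (g * x * g^-1 * x^-1)%g) @^-1` [set 1%g]).
  apply: closed_comp; last exact/accessible_closed_set1/hausdorff_accessible.
  move=> g _; apply: cvg_mulg; last exact: cvg_cst.
  apply: cvg_mulg; last exact: invg_continuous.
  by apply: cvg_mulg; [exact: cvg_id|exact: cvg_cst].
apply/seteqP; split=> g /= H.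
  by rewrite H mulgK mulgV.
have : (g * x * g^-1 = x)%g by apply/eqP; rewrite -[_ == _]divg_eq1 H.
by move=> {2}<-; rewrite mulgVK.
Qed.

Section Exponential.
Context {R : realType} {d : nat} {G : lieGroupType R d} (e : chart R d G).
Hypotheses (he : atlas e) (he1 : chart_dom e 1%g).
Local Notation o := (e 1%g).
Implicit Types (gamma : R -> G) (eta : 'cV[R]_d) (K : set G).

Lemma one_parameter0 eta gamma : one_parameter e eta gamma -> gamma 0 = 1%g.
Proof.
by move=> [_ gD _]; apply: (@mulgI _ (gamma 0)); rewrite -gD addr0 mulg1.
Qed.

Lemma one_parameter_inv eta gamma t :
  one_parameter e eta gamma -> gamma (- t) = (gamma t)^-1%g.
Proof.
move=> og; have [_ gD _] := og; symmetry; apply: mulg1_eq.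
by rewrite -gD subrr (one_parameter0 og).
Qed.

Lemma one_parameter_pow eta gamma t N :
  one_parameter e eta gamma -> gamma (N%:R * t) = (gamma t ^+ N)%g.
Proof.
move=> og; have [_ gD _] := og.
elim: N => [|N IH]; first by rewrite mul0r (one_parameter0 og).
by rewrite -natr1 mulrDl mul1r gD IH expgSr.
Qed.

Lemma one_parameter_estimate eta gamma eps : one_parameter e eta gamma -> 0 < eps ->
  \forall t \near (0 : R),
    chart_dom e (gamma t) /\ `|e (gamma t) - o - t *: eta| <= eps * `|t|.
Proof.
move=> og eps0; have [gc _ gd] := og; apply: filterI.
  apply: (gc 0); rewrite (one_parameter0 og); apply: open_nbhs_nbhs; split=> //.
  exact: chart_dom_open.
by have := estimate_of_is_derive gd eps0; rewrite /= (one_parameter0 og).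
Qed.

Lemma one_parameter_scale eta gamma c :
  one_parameter e eta gamma -> one_parameter e (c *: eta) (fun t => gamma (c * t)).
Proof.
move=> [gc gD gd]; split.
- move=> t; apply: continuous_comp; last exact: gc.
  exact: mulrl_continuous.
- by move=> s t; rewrite mulrDr gD.
- have : is_derive (0 : R) 1 (( *%R c) : R -> R) c.
    have := @is_derive_quadratic R 0 c 0; congr is_derive; apply/funext => t.
    by rewrite add0r mul0r addr0.
  move=> dc; have dg : differentiable (fun t => e (gamma t)) (c * 0).
    by rewrite mulr0; apply/derivable1_diffP; have [] := gd.
  have := is_derive_chain dc dg; rewrite mulr0.
  congr is_derive; rewrite -[X in 'D_X _ _]mulr1.
  rewrite deriveZ_dir; last by rewrite -(mulr0 c).
  by have [_ ->] := gd.
Qed.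

Lemma lie_subalgebra0 K : K 1%g -> lie_subalgebra e K 0.
Proof.
move=> K1; exists (fun=> 1%g); split=> //; split => [t|s t|]; first exact: cvg_cst.
  by rewrite mulg1.
exact: is_derive_cst.
Qed.

Lemma lie_subalgebraZ K c eta : lie_subalgebra e K eta -> lie_subalgebra e K (c *: eta).
Proof.
move=> [gamma [og gK]]; exists (fun t => gamma (c * t)); split=> //.
exact: one_parameter_scale.
Qed.

Lemma one_parameter_sequence eta gamma : one_parameter e eta gamma ->
  (fun k : nat => k%:R *: (e (gamma k%:R^-1) - o)) @ \oo --> eta.
Proof.
move=> og; apply/cvgrPdist_le => eps eps0.
have [N _ H] := near0_div 1 (one_parameter_estimate og eps0).
exists N.+1 => // -[//|k] /= Nk.
have [_] := H k Nk; rewrite mul1r => E.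
set x := _ - o in E *.
have -> : eta - k.+1%:R *: x = k.+1%:R *: (k.+1%:R^-1 *: eta - x).
  by rewrite [RHS]scalerBr scalerA mulfV// scale1r.
rewrite normrZ distrC normr_nat -ler_pdivlMl// mulrC (le_trans E)// gtr0_norm//.
Qed.

(** The products [g1 (1 / k) * g2 (1 / k)] are [1 / k *: (eta1 + eta2)] away from the
    identity at first order, so that [one_parameter_limit] applies to them. *)
Lemma lie_subalgebraD K eta1 eta2 : compact [set: G] -> is_subgroup K -> closed K ->
  lie_subalgebra e K eta1 -> lie_subalgebra e K eta2 ->
  lie_subalgebra e K (eta1 + eta2).
Proof.
move=> cG sK clK [g1 [og1 K1]] [g2 [og2 K2]].
have [c1 D1 d1] := og1; have [c2 D2 d2] := og2; have [K0 KM KV] := sK.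
have inv0 : (fun k : nat => k%:R^-1 : R) @ \oo --> (0 : R).
  apply/cvgrPdist_lt => eps eps0; have [N _ H] := near_infty_natSinv_lt (PosNum eps0).
  exists N.+1 => // -[//|k] /= Nk; rewrite sub0r normrN gtr0_norm ?invr_gt0//.
  exact: H.
have g10 : (fun k : nat => g1 k%:R^-1) @ \oo --> (1%g : G).
  by rewrite -(one_parameter0 og1); exact: cvg_comp inv0 (c1 0).
have g20 : (fun k : nat => g2 k%:R^-1) @ \oo --> (1%g : G).
  by rewrite -(one_parameter0 og2); exact: cvg_comp inv0 (c2 0).
apply: (@one_parameter_limit _ _ _ e he he1 K (fun k => (g1 (k%:R^-1)%R * g2 (k%:R^-1)%R)%g)
  (eta1 + eta2) cG sK clK).
- by move=> k; apply: KM.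
- by rewrite -(mulg1 1%g); exact: cvg_mulg.
apply/cvgrPdist_le => eps eps0.
have N0 : 0 < `|eta2| + 1 by rewrite ltr_wpDl.
have e20 : 0 < eps / 3 / (`|eta2| + 1) by rewrite !divr_gt0.
have e30 : 0 < eps / 3 by rewrite divr_gt0.
have [del del0 H] := mul_estimate he he1 e20.
have /cvgrPdist_le/(_ _ e30) s1 := one_parameter_sequence og1.
have /cvgrPdist_le/(_ _ e30) s2 := one_parameter_sequence og2.
have /cvgrPdist_le/(_ _ ltr01) s3 := one_parameter_sequence og2.
near=> k.
have sm1 : small e del (g1 k%:R^-1) by near: k; apply: g10; exact: nbhs_small.
have sm2 : small e del (g2 k%:R^-1) by near: k; apply: g20; exact: nbhs_small.
have [_ E] := H _ _ sm1 sm2.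
have h1 : `|eta1 - k%:R *: (e (g1 k%:R^-1) - o)| <= eps / 3 by near: k.
have h2 : `|eta2 - k%:R *: (e (g2 k%:R^-1) - o)| <= eps / 3 by near: k.
have h3 : `|eta2 - k%:R *: (e (g2 k%:R^-1) - o)| <= 1 by near: k.
set a := e (g1 _) - o in E h1; set b := e (g2 _) - o in E h2 h3.
set m := e (_ * _)%g in E *.
rewrite [X in `|X|](_ : _ = (eta1 - k%:R *: a) + (eta2 - k%:R *: b) -
  k%:R *: (m - o - (a + b))); last by vec.
rewrite (le_trans (ler_normB _ _))// (le_trans (lerD (ler_normD _ _) (lexx _)))//.
have -> : eps = eps / 3 + eps / 3 + eps / 3 by field.
rewrite lerD ?lerD// normrZ normr_nat (le_trans (ler_wpM2l _ E))//.
have kb : k%:R * `|b| <= `|eta2| + 1.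
  rewrite -[k%:R]normr_nat -normrZ -[X in `|X|](subrK eta2) addrC.
  by rewrite (le_trans (ler_normD _ _))// lerD2l distrC.
rewrite [leLHS](_ : _ = k%:R * `|b| / (`|eta2| + 1) * (eps / 3)); last by ring.
apply: ler_piMl; first exact: ltW.
by rewrite ler_pdivrMr// mul1r.
Unshelve. all: by end_near. Qed.

(** Powers of the points of coordinates [o + eta / k]. *)
Lemma one_parameter_exists eta : compact [set: G] ->
  exists gamma, one_parameter e eta gamma.
Proof.
move=> cG; suff [gamma [og _]] : lie_subalgebra e setT eta by exists gamma.
pose q (k : nat) := o + k%:R^-1 *: eta.
have qo : q @ \oo --> o.
  apply/cvgrPdist_lt => eps eps0.
  have e0 : 0 < eps / (`|eta| + 1) by rewrite divr_gt0// ltr_wpDl.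
  have [N _ H] := near_infty_natSinv_lt (PosNum e0).
  exists N.+1 => // -[//|k] /= Nk; rewrite /q opprD addNKr normrN normrZ.
  rewrite gtr0_norm ?invr_gt0//.
  have := H k Nk; rewrite /= ltr_pdivlMr ?ltr_wpDl//.
  by apply: le_lt_trans; rewrite ler_wpM2l// lerDl.
have imgo := chart_funP he1.
have cinv : chart_inv e @ o --> (1%g : G).
  by have := chart_inv_continuous imgo; rewrite /prop_for /continuous_at (chart_funK he1).
apply: (@one_parameter_limit _ _ _ e he he1 setT (fun k => chart_inv e (q k))) => //.
- exact: cvg_comp qo cinv.
have qimg : \forall k \near \oo, chart_img e (q k).
  exact: (qo _ (near_img he1)).
apply/cvgrPdist_lt => eps eps0; near=> k.
rewrite chart_invK; last by near: k.
rewrite /q addrAC subrr add0r scalerA mulfV ?scale1r ?subrr ?normr0//.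
by rewrite pnatr_eq0 -lt0n; near: k; exact: nbhs_infty_gt.
Unshelve. all: by end_near. Qed.

(** The [N]-th powers of two elements close to the identity are at most [4 * N]
    times further apart than the elements: replace the factors one at a time. *)
Lemma power_dist : exists2 del, 0 < del & forall a b N,
  chart_dom e a -> chart_dom e b ->
  N%:R * 2 * `|e a - o| < del -> N%:R * 2 * `|e b - o| < del ->
  [/\ chart_dom e (a ^+ N)%g, chart_dom e (b ^+ N)%g &
    `|e (a ^+ N)%g - e (b ^+ N)%g| <= 4 * N%:R * `|e a - e b|].
Proof.
have [d1 d10 H1] := mul_strict he he1 ltr01.
have [d2 d20 H2] := power_estimate he he1 ltr01 (lexx 1).
have [d3 d30 H3] := mul_estimate he he1 ltr01.
pose del := Num.min d1 (Num.min d2 d3) / 4.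
have m0 : 0 < Num.min d1 (Num.min d2 d3) by rewrite !lt_min d10 d20.
have del0 : 0 < del by rewrite divr_gt0.
have delE : 4 * del = Num.min d1 (Num.min d2 d3) by rewrite /del; field.
have [dd1 dd2 dd3] : [/\ 4 * del <= d1, 4 * del <= d2 & 4 * del <= d3].
  by rewrite delE; split; rewrite !ge_min lexx ?orbT.
have del1 : del < d1 by apply: lt_le_trans dd1; lra.
have del2 : del < d2 by apply: lt_le_trans dd2; lra.
have del3 : del < d3 by apply: lt_le_trans dd3; lra.
exists del => // a b N Da Db aN bN.
have mulL x y z : small e d1 x -> small e d1 y -> small e d1 z ->
    `|e (x * z)%g - e (y * z)%g| <= 2 * `|e x - e y|.
  move=> sx sy sz; have [_ _] := H1 x z y z sx sz sy sz.
  rewrite subrr addr0 normr0 max_l// mul1r => E.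
  rewrite -[X in `|X|](subrK (e x - e y)) (le_trans (ler_normD _ _))//.
  by rewrite (le_trans (lerD E (lexx _)))// mulr_natl mulr2n.
have mulR x y z : small e d1 x -> small e d1 y -> small e d1 z ->
    `|e (z * x)%g - e (z * y)%g| <= 2 * `|e x - e y|.
  move=> sx sy sz; have [_ _] := H1 z x z y sz sx sz sy.
  rewrite subrr add0r normr0 max_r// mul1r => E.
  rewrite -[X in `|X|](subrK (e x - e y)) (le_trans (ler_normD _ _))//.
  by rewrite (le_trans (lerD E (lexx _)))// mulr_natl mulr2n.
have pw x i : chart_dom e x -> N%:R * 2 * `|e x - o| < del -> (i <= N)%N ->
    chart_dom e (x ^+ i)%g /\ `|e (x ^+ i)%g - o| < del.
  move=> Dx xN iN; have ix : i%:R * 2 * `|e x - o| < del.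
    by apply: le_lt_trans xN; rewrite ler_wpM2r// ler_wpM2r// ler_nat.
  have [Dxi xi _] := H2 x i Dx (lt_trans ix del2).
  by split=> //; exact: le_lt_trans ix.
have smW x : chart_dom e x /\ `|e x - o| < del -> small e d1 x.
  by move=> [Dx xd]; split=> //; exact: lt_trans del1.
have [DaN _] := pw a N Da aN (leqnn _); have [DbN _] := pw b N Db bN (leqnn _).
split=> //.
have claim i : forall j, (i + j <= N)%N ->
    `|e (a ^+ i * b ^+ j)%g - e (b ^+ (i + j))%g| <= 4 * i%:R * `|e a - e b|.
  elim: i => [|i IH] j ijN.
    by rewrite expg0 mul1g add0n subrr normr0 mulr0 mul0r.
  have N1 : (1 <= N)%N by apply: leq_trans ijN.
  have Sa := pw a 1%N Da aN N1; have Sb := pw b 1%N Db bN N1.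
  rewrite !expg1 in Sa Sb.
  have Sai : chart_dom e (a ^+ i)%g /\ `|e (a ^+ i)%g - o| < del.
    by apply: pw => //; rewrite (leq_trans _ ijN)// addSn leqW// leq_addr.
  have Sbj : chart_dom e (b ^+ j)%g /\ `|e (b ^+ j)%g - o| < del.
    by apply: pw => //; rewrite (leq_trans _ ijN)// leq_addl.
  have Sbj1 : chart_dom e (b ^+ j.+1)%g /\ `|e (b ^+ j.+1)%g - o| < del.
    by apply: pw => //; rewrite (leq_trans _ ijN)// addSnnS leq_addl.
  have [Dab Eab] := H3 a (b ^+ j)%g (conj Sa.1 (lt_trans Sa.2 del3))
    (conj Sbj.1 (lt_trans Sbj.2 del3)).
  have Sab : small e d1 (a * b ^+ j)%g.
    split=> //; apply: lt_le_trans dd1.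
    rewrite -[X in `|X|](subrK (e a - o + (e (b ^+ j)%g - o))).
    rewrite (le_lt_trans (ler_normD _ _))//.
    rewrite (le_lt_trans (lerD Eab (ler_normD _ _)))// mul1r.
    have := Sa.2; have := Sbj.2; lra.
  rewrite expgSr -mulgA addSnnS.
  rewrite -[X in `|X|](subrKA (e (a ^+ i * b ^+ j.+1)%g)) (le_trans (ler_normD _ _))//.
  have -> : 4 * i.+1%:R * `|e a - e b| = 4 * `|e a - e b| + 4 * i%:R * `|e a - e b|.
    by rewrite -natr1; ring.
  rewrite lerD//; last by apply: IH; rewrite -addSnnS.
  rewrite [(b ^+ j.+1)%g]expgS in Sbj1 *.
  rewrite (le_trans (mulR _ _ _ Sab (smW _ Sbj1) (smW _ Sai)))//.
  rewrite (_ : 4 * _ = 2 * (2 * `|e a - e b|)); last by ring.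
  by rewrite ler_wpM2l// mulL//; exact: smW.
by have := claim N 0%N; rewrite addn0 expg0 mulg1; exact.
Qed.

(** [gamma t] and [gamma' t] are the [N]-th powers of [gamma (t / N)] and
    [gamma' (t / N)], which differ by [o(1 / N)] when the velocities agree. *)
Lemma one_parameter_unique eta gamma gamma' :
  one_parameter e eta gamma -> one_parameter e eta gamma' -> gamma = gamma'.
Proof.
move=> og og'; have [del del0 H] := power_dist.
pose M := 2 * (`|eta| + 1).
have M0 : 0 < M by rewrite mulr_gt0// ltr_wpDl.
have near_eq t : `|t| * M < del -> gamma t = gamma' t.
  move=> tdel.
  have E eps : 0 < eps -> eps <= 1 -> [/\ chart_dom e (gamma t), chart_dom e (gamma' t) &
      `|e (gamma t) - e (gamma' t)| <= eps].
    move=> eps0 eps1.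
    have k0 : 0 < Num.min 1 (eps / (8 * (`|t| + 1))).
      by rewrite lt_min ltr01 divr_gt0// mulr_gt0// ltr_wpDl.
    have [N [[Dg g] [Dg' g']]] := @filter_ex _ _ _ _ (filterI
      (near0_div t (one_parameter_estimate og k0))
      (near0_div t (one_parameter_estimate og' k0))).
    set k := Num.min _ _ in k0 g g'.
    have k1 : k <= 1 by rewrite ge_min lexx.
    have kE : k * (8 * (`|t| + 1)) <= eps.
      by rewrite -ler_pdivlMr ?mulr_gt0 ?ltr_wpDl// ge_min lexx orbT.
    set T := t / N.+1%:R in Dg g Dg' g'.
    have NT : N.+1%:R * `|T| = `|t|.
      by rewrite -[N.+1%:R]normr_nat -normrM /T mulrC divfK.
    have bnd x : `|x - o - T *: eta| <= k * `|T| -> N.+1%:R * 2 * `|x - o| < del.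
      move=> xT; apply: le_lt_trans tdel; rewrite -NT /M.
      rewrite -!mulrA ler_wpM2l// mulrCA ler_wpM2l//.
      rewrite -[X in `|X|](subrK (T *: eta)) (le_trans (ler_normD _ _))//.
      apply: (le_trans (lerD xT (lexx _))); rewrite (normrZ T eta).
      have := ler_wpM2r (normr_ge0 T) k1; lra.
    have [DaN DbN abN] := H _ _ N.+1 Dg Dg' (bnd _ g) (bnd _ g').
    have Tt : N.+1%:R * T = t by rewrite /T mulrC divfK.
    rewrite -(one_parameter_pow T N.+1 og) -(one_parameter_pow T N.+1 og') Tt in DaN DbN abN.
    split=> //; apply: (le_trans abN).
    have gg' : `|e (gamma T) - e (gamma' T)| <= 2 * (k * `|T|).
      rewrite [X in `|X|](_ : _ = (e (gamma T) - o - T *: eta) -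
        (e (gamma' T) - o - T *: eta)); last by vec.
      by rewrite (le_trans (ler_normB _ _))// (le_trans (lerD g g'))// mulr_natl mulr2n.
    rewrite (le_trans (ler_wpM2l _ gg')) ?mulr_ge0//; apply: le_trans kE.
    rewrite (_ : 4 * _ * _ = k * (8 * (N.+1%:R * `|T|))); last by ring.
    by rewrite NT ler_wpM2l ?(ltW k0)// ler_wpM2l// lerDl.
  have [Dg Dg' _] := E 1 ltr01 (lexx 1).
  apply: (chart_fun_inj Dg Dg'); apply/eqP; rewrite -subr_eq0 -normr_le0.
  apply/ler_addgt0Pr => eps eps0; rewrite add0r.
  have m0 : 0 < Num.min eps 1 by rewrite lt_min eps0 ltr01.
  have m1 : Num.min eps 1 <= 1 by rewrite ge_min lexx orbT.
  have [_ _ h] := E _ m0 m1; apply: (le_trans h).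
  by rewrite ge_min lexx.
apply/funext => t.
have near_t : \forall s \near (0 : R), gamma s = gamma' s.
  apply/nbhs_ballP; exists (del / M); first by rewrite /= divr_gt0.
  move=> s; rewrite -ball_normE /ball_/= sub0r normrN ltr_pdivlMr//.
  exact: near_eq.
have [N Nt] := filter_ex (near0_div t near_t).
have Tt : t = N.+1%:R * (t / N.+1%:R) by rewrite mulrC divfK.
by rewrite Tt (one_parameter_pow _ _ og) (one_parameter_pow _ _ og') Nt.
Qed.

(** Conjugation by [g] is differentiable in coordinates because, in charts around
    [g], [1] and [g^-1], it is composed of two multiplications. *)
Lemma one_parameter_conj g eta gamma : one_parameter e eta gamma ->
  one_parameter e (Ad e g eta) (fun t => g * gamma t * g^-1)%g.
Proof.
move=> og; have [gc gD gd] := og.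
have gconj : continuous (fun t => g * gamma t * g^-1)%g.
  move=> t; apply: cvg_mulg; last exact: cvg_cst.
  by apply: cvg_mulg; [exact: cvg_cst|exact: gc].
split=> //.
  by move=> s t; rewrite gD -!mulgA (mulgA g^-1%g) mulVg mul1g.
have [c ac cg] := atlas_cover g; have [c' ac' cg'] := atlas_cover (g^-1)%g.
have dmul (c1 c2 c3 : chart R d G) x y : atlas c1 -> atlas c2 -> atlas c3 ->
    chart_img c1 x -> chart_img c2 y -> chart_dom c3 (chart_inv c1 x * chart_inv c2 y)%g ->
    differentiable (fun p : 'cV[R]_d * 'cV[R]_d =>
      c3 (chart_inv c1 p.1 * chart_inv c2 p.2)%g) (x, y).
  by move=> a1 a2 a3 x1 y2 xy3; apply: (mulg_smooth _ _ _ a1 a2 a3 1%N).1.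
pose P y := c (g * chart_inv e y)%g; pose Q x := e (chart_inv c x * g^-1)%g.
have imgo := chart_funP he1.
have Po : P o = c g by rewrite /P chart_funK// mulg1.
have dP : differentiable P o.
  have -> : P = (fun p => c (chart_inv c p.1 * chart_inv e p.2)%g) \o (fun y => (c g, y)).
    by apply/funext => y; rewrite /P /= (chart_funK cg).
  apply: differentiable_comp; first exact: differentiable_pair.
  by apply: dmul => //; [exact: chart_funP|rewrite !chart_funK// mulg1].
have dQ : differentiable Q (P o).
  have -> : Q = (fun p => e (chart_inv c p.1 * chart_inv c' p.2)%g) \o
      (fun x => (x, c' (g^-1)%g)).
    by apply/funext => y; rewrite /Q /= (chart_funK cg').
  apply: differentiable_comp; first exact: differentiable_pair.
  rewrite Po; apply: dmul => //; try exact: chart_funP.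
  by rewrite !chart_funK// mulgV.
have dQP : differentiable (Q \o P) o by exact: differentiable_comp.
have cgn : nbhs g (chart_dom c) by apply: open_nbhs_nbhs; split=> //; exact: chart_dom_open.
have near1 : \forall y \near o, (Q \o P) y = e (g * chart_inv e y * g^-1)%g.
  have : (fun y => g * chart_inv e y)%g @ o --> (g * 1)%g.
    apply: (@cvg_mulg _ _ (nbhs o)); first exact: cvg_cst.
    by have := chart_inv_continuous imgo; rewrite /prop_for /continuous_at (chart_funK he1).
  move=> cc; have n1 : \forall y \near o, chart_dom c (g * chart_inv e y)%g.
    by apply: cc; rewrite mulg1.
  by near=> y; rewrite /Q /P /= chart_funK//; near: y.
have near2 : \forall t \near (0 : R),
    ((Q \o P) \o (fun t => e (gamma t))) t = e (g * gamma t * g^-1)%g.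
  have : (fun t => g * gamma t)%g @ (0 : R) --> (g * gamma 0)%g.
    by apply: cvg_mulg; [exact: cvg_cst|exact: gc].
  rewrite (one_parameter0 og) mulg1 => /(_ _ cgn) n1.
  near=> t; rewrite /Q /P /= (chart_funK (_ : chart_dom e (gamma t))).
    by rewrite chart_funK//; near: t.
  near: t; apply: filterS (one_parameter_estimate og ltr01); by move=> t [].
apply: (near_eq_is_derive near2).
rewrite /Ad -(near_eq_derive _ near1) -[in X in is_derive _ _ _ ('D__ _ X)](one_parameter0 og).
by apply: is_derive_chain => //; rewrite (one_parameter0 og).
Unshelve. all: by end_near. Qed.

(** By uniqueness, [Ad g xi = xi] means that conjugation by [g] preserves the
    one-parameter subgroup of [xi].  In this form the stabilizer is seen to be a
    closed subgroup, which is not apparent from the definition of [Ad]. *)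
Lemma Ad_stabilizerP xi gamma g : one_parameter e xi gamma ->
  Ad_stabilizer e xi g <-> forall t, (g * gamma t = gamma t * g)%g.
Proof.
move=> og; have oc := one_parameter_conj g og; split=> [gxi t|gc].
  rewrite gxi in oc; have Et := congr1 (@^~ t) (one_parameter_unique oc og).
  by rewrite -[in RHS]Et mulgVK.
rewrite /Ad_stabilizer /=; have [_ _ d1] := og; have [_ _ d2] := oc.
apply: (is_derive_unique d2); move: d1; congr is_derive.
by apply/funext => t; rewrite gc mulgK.
Qed.

Lemma Ad_stabilizer_closed_subgroup xi : compact [set: G] ->
  is_subgroup (Ad_stabilizer e xi) /\ closed (Ad_stabilizer e xi).
Proof.
move=> cG; have [gamma og] := one_parameter_exists xi cG; split.
  split; first by apply/(Ad_stabilizerP _ og) => t; rewrite mulg1 mul1g.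
    move=> x y /(Ad_stabilizerP _ og) xc /(Ad_stabilizerP _ og) yc.
    by apply/(Ad_stabilizerP _ og) => t; rewrite -mulgA yc mulgA xc mulgA.
  move=> x /(Ad_stabilizerP _ og) xc; apply/(Ad_stabilizerP _ og) => t.
  by apply: (@mulgI _ x); rewrite mulgA mulgV mul1g mulgA xc mulgK.
rewrite (_ : Ad_stabilizer e xi =
    \bigcap_(t in [set: R]) [set g : G | (g * gamma t = gamma t * g)%g]).
  by apply: closed_bigI => t _; apply: closed_commute; exact: (@lie_hausdorff _ _ G).
apply/seteqP; split=> g; first by move=> /(Ad_stabilizerP _ og) H t _; exact: H.
by move=> H; apply/(Ad_stabilizerP _ og) => t; exact: H.
Qed.

End Exponential.

(** * Representations and momentum maps *)

Lemma matrix_linear_continuous {R : realType} {m n p q : nat}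
  (f : {linear 'M[R]_(m, n) -> 'M[R]_(p, q)}) : continuous f.
Proof.
move=> M; rewrite (_ : (f : 'M[R]_(m, n) -> 'M[R]_(p, q)) =
    \sum_i \sum_j (fun N : 'M[R]_(m, n) => N i j *: f (delta_mx i j))); last first.
  apply/funext => N; rewrite fct_sumE {1}[N]matrix_sum_delta linear_sum.
  apply: eq_bigr => i _; rewrite fct_sumE linear_sum; apply: eq_bigr => j _.
  by rewrite linearZ.
elim/big_ind: _ => [|f1 f2 c1 c2|i _]; 
  [exact: (@cvg_cst _ (0 : 'M[R]_(p, q)) _ (nbhs M))|exact: (@cvgD _ _ _ (nbhs M) _ f1 f2)|].
elim/big_ind: _ => [|f1 f2 c1 c2|j _]; 
  [exact: (@cvg_cst _ (0 : 'M[R]_(p, q)) _ (nbhs M))|exact: (@cvgD _ _ _ (nbhs M) _ f1 f2)|].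
exact/differentiable_continuous/differentiableZl/differentiable_coord.
Qed.

Lemma is_derive_linear {R : realType} {V : normedModType R} {m n p q : nat}
    (f : {linear 'M[R]_(m, n) -> 'M[R]_(p, q)}) (F : V -> 'M[R]_(m, n)) x v D :
  is_derive x v F D -> is_derive x v (fun y => f (F y)) (f D).
Proof.
move=> [dF <-].
have c : (fun k : R => k^-1 *: (((fun y => f (F y)) \o shift x) (k *: v) - f (F x)))
    @ 0^' --> f ('D_v F x).
  rewrite (_ : (fun k => _) = (f : 'M[R]_(m, n) -> 'M[R]_(p, q)) \o
      (fun k : R => k^-1 *: ((F \o shift x) (k *: v) - F x))); last first.
    by apply/funext => k; rewrite /= linearZ_LR (raddfB f).
  apply: cvg_comp; last exact: matrix_linear_continuous.
  exact: dF.
by apply: DeriveDef; [apply/cvg_ex; exists (f ('D_v F x))|apply: cvg_lim].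
Qed.

Lemma derive_mulmx_arg {R : realType} {n : nat} {W : normedModType R}
    (f : 'cV[R]_n -> W) (P : 'M[R]_n) x w :
  'D_w (fun y => f (P *m y)) x = 'D_(P *m w) f (P *m x).
Proof.
rewrite /derive (_ : (fun k : R => k^-1 *: _) = (fun k : R => k^-1 *:
  ((f \o shift (P *m x)) (k *: (P *m w)) - f (P *m x)))) //.
by apply/funext => k /=; rewrite mulmxDr scalemxAr.
Qed.

Section Representation.
Context {R : realType} {d n : nat} {G : lieGroupType R d}.
Variables (e : chart R d G) (rho : G -> 'M[R]_n).
Hypotheses (he : atlas e) (he1 : chart_dom e 1%g) (hrho : is_representation rho).
Local Notation o := (e 1%g).

Definition inf_mx (eta : 'cV[R]_d) : 'M[R]_n :=
  'D_eta (fun y => rho (chart_inv e y)) o.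

Let rho1 : rho 1%g = 1%:M. Proof. by case: hrho. Qed.

Let rhoM g g' : rho (g * g')%g = rho g *m rho g'. Proof. by case: hrho. Qed.

Lemma rhoVK g (v : 'cV[R]_n) : rho g *m (rho (g^-1)%g *m v) = v.
Proof. by rewrite mulmxA -rhoM mulgV rho1 mul1mx. Qed.

Lemma rho_continuous : continuous rho.
Proof.
move=> g; have [c ac cg] := atlas_cover g.
have [_ _ /(_ c ac 0%N) rc] := hrho.
have cc : (fun x => rho (chart_inv c (c x))) @ g --> rho (chart_inv c (c g)).
  apply: (@cvg_comp _ _ _ c (fun y => rho (chart_inv c y)) _ (nbhs (c g))).
    exact: chart_fun_continuous.
  exact: (rc (c g) (chart_funP cg)).
rewrite /continuous_at -{2}(chart_funK cg).
apply: cvg_trans cc; apply: near_eq_cvg.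
have : nbhs g (chart_dom c) by apply: open_nbhs_nbhs; split=> //; exact: chart_dom_open.
by apply: filterS => x Dx; rewrite /= chart_funK.
Qed.

Lemma rho_chart_differentiable : differentiable (fun y => rho (chart_inv e y)) o.
Proof. by have [_ _ /(_ e he 1%N) [rd _]] := hrho; exact/rd/chart_funP. Qed.

Lemma inf_actionE eta v : inf_action e rho eta v = inf_mx eta *m v.
Proof.
rewrite /inf_action.
have := is_derive_linear (mulmxr v : {linear 'M[R]_n -> 'cV[R]_n})
  (derivableP (@diff_derivable _ _ _ _ _ eta rho_chart_differentiable)).
by move=> [_ E]; rewrite [LHS]E.
Qed.

Lemma inf_mxD eta eta' : inf_mx (eta + eta') = inf_mx eta + inf_mx eta'.
Proof. exact/deriveD_dir/rho_chart_differentiable. Qed.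

Lemma inf_mxZ c eta : inf_mx (c *: eta) = c *: inf_mx eta.
Proof. exact/deriveZ_dir/rho_chart_differentiable. Qed.

Section OneParameterAction.
Variables (eta : 'cV[R]_d) (gamma : R -> G).
Hypothesis og : one_parameter e eta gamma.

Lemma is_derive_rho : is_derive (0 : R) 1 (fun t => rho (gamma t)) (inf_mx eta).
Proof.
have [_ _ gd] := og.
have := is_derive_chain (f := fun y => rho (chart_inv e y)) gd.
rewrite (one_parameter0 og) => /(_ rho_chart_differentiable).
apply: near_eq_is_derive.
apply: filterS (one_parameter_estimate he1 og ltr01) => t [Dt _] /=.
by rewrite chart_funK.
Qed.

Lemma is_derive_orbit (v : 'cV[R]_n) (t : R) :
  is_derive t 1 (fun t => rho (gamma t) *m v) (rho (gamma t) *m (inf_mx eta *m v)).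
Proof.
have [_ gD _] := og.
have [d1 d2] := is_derive_linear (mulmxr v : {linear 'M[R]_n -> 'cV[R]_n})
  (is_derive_linear (mulmx (rho (gamma t)) : {linear 'M[R]_n -> 'M[R]_n}) is_derive_rho).
have E : (fun k : R => k^-1 *: (((fun s : R => rho (gamma s) *m v) \o shift t)
      (k *: (1 : R)) - rho (gamma t) *m v)) =
    (fun k : R => k^-1 *: (((fun s : R => rho (gamma t) *m rho (gamma s) *m v)
      \o shift (0 : R)) (k *: (1 : R)) - rho (gamma t) *m rho (gamma 0) *m v)).
  apply/funext => k /=; rewrite addr0 [k *: _ + t]addrC gD rhoM.
  by rewrite (one_parameter0 og) rho1 mulmx1.
apply: DeriveDef; first by rewrite /derivable E; exact: d1.
by rewrite /derive E mulmxA; exact: d2.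
Qed.

(** Differentiate the invariance of [M] in the form
    [(rho (gamma t))^T *m M = M *m rho (gamma (- t))], linear on each side. *)
Lemma inf_mx_skew M : (forall t, (rho (gamma t))^T *m M *m rho (gamma t) = M) ->
  (inf_mx eta)^T *m M = - (M *m inf_mx eta).
Proof.
move=> inv.
have d1 := is_derive_linear (mulmxr M : {linear 'M[R]_n -> 'M[R]_n})
  (is_derive_linear (@trmx R n n : {linear 'M[R]_n -> 'M[R]_n}) is_derive_rho).
have og' := one_parameter_scale (-1) og.
have d2 : is_derive (0 : R) 1 (fun t => M *m rho (gamma (- t))) (M *m - inf_mx eta).
  have : is_derive (0 : R) 1 (fun t => rho (gamma (- t))) (- inf_mx eta).
    have := is_derive_chain (f := fun y => rho (chart_inv e y)) (let: And3 _ _ a := og' in a).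
    rewrite mulr0 (one_parameter0 og) => /(_ rho_chart_differentiable).
    rewrite -/(inf_mx _) inf_mxZ scaleN1r.
    apply: near_eq_is_derive.
    apply: filterS (one_parameter_estimate he1 og' ltr01) => t [Dt _] /=.
    by rewrite chart_funK// mulN1r.
  exact: (is_derive_linear (mulmx M : {linear 'M[R]_n -> 'M[R]_n})).
rewrite -mulmxN; apply: is_derive_unique d1 _; move: d2; congr is_derive.
apply/funext => t /=; rewrite (one_parameter_inv t og) -{1}(inv t).
by rewrite -[LHS]mulmxA -rhoM mulgV rho1 mulmx1.
Qed.

Lemma inf_mx_commute g : (forall t, (g * gamma t = gamma t * g)%g) ->
  rho g *m inf_mx eta = inf_mx eta *m rho g.
Proof.
move=> gc.
have d1 := is_derive_linear (mulmx (rho g) : {linear 'M[R]_n -> 'M[R]_n}) is_derive_rho.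
have d2 := is_derive_linear (mulmxr (rho g) : {linear 'M[R]_n -> 'M[R]_n}) is_derive_rho.
apply: is_derive_unique d1 _; move: d2; congr is_derive.
by apply/funext => t /=; rewrite -!rhoM gc.
Qed.

Lemma derive_orbit_invariant (h : 'cV[R]_n -> R) v :
  (forall t, h (rho (gamma t) *m v) = h v) -> differentiable h v ->
  'D_(inf_mx eta *m v) h v = 0.
Proof.
move=> hi dh; have := is_derive_orbit v 0.
rewrite (one_parameter0 og) rho1 mul1mx => d1.
have := is_derive_chain (f := h) d1.
rewrite (one_parameter0 og) rho1 mul1mx => /(_ dh) d2.
apply: is_derive_unique d2 _.
rewrite (_ : _ \o _ = cst (h v)); first exact: is_derive_cst.
exact/funext.
Qed.

End OneParameterAction.

Section Momentum.
Variables (Omega : 'M[R]_n).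
Hypotheses (hOmega : symplectic Omega).
Hypothesis hcan : forall g u v, sform Omega (rho g *m u) (rho g *m v) = sform Omega u v.

Lemma invariant_form M g :
  (forall u v, sform M (rho g *m u) (rho g *m v) = sform M u v) ->
  (rho g)^T *m M *m rho g = M.
Proof. by move=> H; apply: sform_eqP => u v; rewrite -sform_mulr -sform_mull. Qed.

(** The matrix of the quadratic form [2 * J^eta]. *)
Definition momentum_mx eta : 'M[R]_n := (inf_mx eta)^T *m Omega.

Lemma momentumE eta v : momentum Omega e rho eta v = 2^-1 * sform (momentum_mx eta) v v.
Proof. by rewrite /momentum inf_actionE sform_mull. Qed.

Lemma momentum_mx_form eta u v :
  sform (momentum_mx eta) u v = sform Omega (inf_mx eta *m u) v.
Proof. by rewrite sform_mull. Qed.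

Lemma momentum_mx_skew eta gamma : one_parameter e eta gamma ->
  momentum_mx eta = - (Omega *m inf_mx eta).
Proof.
move=> og; apply: (inf_mx_skew og) => t; apply: invariant_form; exact: hcan.
Qed.

Lemma momentum_mx_sym eta gamma : one_parameter e eta gamma ->
  (momentum_mx eta)^T = momentum_mx eta.
Proof.
move=> og; rewrite {1}(momentum_mx_skew og) /momentum_mx linearN /= trmx_mul.
by rewrite (proj1 hOmega) mulmxN opprK.
Qed.

Lemma is_derive_momentum eta gamma v w : one_parameter e eta gamma ->
  is_derive v w (momentum Omega e rho eta) (sform (momentum_mx eta) v w).
Proof.
move=> og; rewrite (_ : momentum _ _ _ _ =
    2^-1 \*: (fun x => sform (momentum_mx eta) x x)); last first.
  by apply/funext => x; rewrite momentumE.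
have := is_deriveZ 2^-1 (is_derive_sform (momentum_mx eta) v w).
rewrite (sform_sym w v (momentum_mx_sym og)).
by rewrite (_ : 2^-1 *: _ = sform (momentum_mx eta) v w) // /GRing.scale /=; field.
Qed.

Lemma d2_momentum eta gamma x u v : one_parameter e eta gamma ->
  d2 (momentum Omega e rho eta) x u v = sform (momentum_mx eta) u v.
Proof.
move=> og; rewrite /d2.
rewrite (_ : (fun y => _) = fun y => sform (momentum_mx eta) v y); last first.
  apply/funext => y; have [_ ->] := is_derive_momentum y v og.
  by rewrite sform_sym// (momentum_mx_sym og).
have [_ ->] := is_derive_sformr (momentum_mx eta) v x u.
by rewrite sform_sym// (momentum_mx_sym og).
Qed.

Lemma hessian_augmented (h : 'cV[R]_n -> R) eta gamma : Ck_on 2 setT h ->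
  one_parameter e eta gamma ->
  hessian (h \- momentum Omega e rho eta) 0 = hessian h 0 - momentum_mx eta.
Proof.
move=> ch og; have [dh dch] := ch; apply/matrixP => i j.
rewrite mxE [RHS]mxE [X in _ + X]mxE [hessian h 0 i j]mxE.
rewrite -[momentum_mx eta i j]sform_delta -(d2_momentum 0 _ _ og) /d2.
rewrite (_ : (fun y => 'D_(delta_mx j 0) (h \- momentum Omega e rho eta) y) =
   'D_(delta_mx j 0) h - 'D_(delta_mx j 0) (momentum Omega e rho eta)); last first.
  apply/funext => y; apply: deriveB; first exact/diff_derivable/dh.
  by have [] := is_derive_momentum y (delta_mx j 0) og.
rewrite deriveB//; first exact/diff_derivable/(dch _).1.
rewrite (_ : 'D_(delta_mx j 0) (momentum Omega e rho eta) =
   fun y => sform (momentum_mx eta) (delta_mx j 0) y); last first.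
  apply/funext => y; have [_ ->] := is_derive_momentum y (delta_mx j 0) og.
  by rewrite sform_sym// (momentum_mx_sym og).
by have [] := is_derive_sformr (momentum_mx eta) (delta_mx j 0) 0 (delta_mx i 0).
Qed.

Lemma momentum_mx_invariant g eta gamma : one_parameter e eta gamma ->
  (forall t, (g * gamma t = gamma t * g)%g) ->
  forall u v, sform (momentum_mx eta) (rho g *m u) (rho g *m v) =
    sform (momentum_mx eta) u v.
Proof.
move=> og gc u v; rewrite !momentum_mx_form mulmxA -(inf_mx_commute og gc) -mulmxA.
exact: hcan.
Qed.

Lemma hessian_invariant (h : 'cV[R]_n -> R) g : Ck_on 2 setT h ->
  (forall g v, h (rho g *m v) = h v) ->
  forall u v, sform (hessian h 0) (rho g *m u) (rho g *m v) = sform (hessian h 0) u v.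
Proof.
move=> ch hi u v; rewrite -(d2_sform 0 (rho g *m u) (rho g *m v) ch) -(d2_sform 0 u v ch) /d2.
rewrite -{1}(mulmx0 _ (rho g)) -derive_mulmx_arg.
rewrite (_ : (fun y => _) = fun y => 'D_v h y) //.
apply/funext => y; rewrite -derive_mulmx_arg.
by rewrite (_ : (fun y => h _) = h)//; apply/funext.
Qed.

Lemma sform_nondegenerate a b : (forall w, sform Omega a w = sform Omega b w) -> a = b.
Proof.
move=> ab; have [_ uO] := hOmega; apply/eqP; rewrite -subr_eq0; apply/eqP.
have : (a - b)^T *m Omega = 0.
  apply/trmx_inj; rewrite trmx0; apply: sform1_eq0 => w.
  rewrite sform_tr trmx1 /sform trmxK mulmx1.
  have := ab w; move/eqP; rewrite -subr_eq0 -sformBl => /eqP; exact.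
move/(congr1 (fun M => M *m invmx Omega)); rewrite mulmxK// mul0mx => /(congr1 trmx).
by rewrite trmxK trmx0.
Qed.

(** Both [h] and [J^eta] being invariant along [gamma], criticality of
    [h - J^eta] at [v] propagates along the orbit of [v]; there it says,
    the symplectic form being nondegenerate, that the orbit is tangent to [X_h]. *)
Lemma critical_relative_equilibrium (h : 'cV[R]_n -> R) Xh eta gamma v :
  is_hamiltonian_vf Omega h Xh -> (forall g v, h (rho g *m v) = h v) ->
  one_parameter e eta gamma ->
  (forall w, 'D_w h v = sform (momentum_mx eta) v w) ->
  relative_equilibrium e rho Xh eta v.
Proof.
move=> hX hi og crit; exists gamma => // t; have := is_derive_orbit og v t.
congr is_derive; apply: sform_nondegenerate => w.
rewrite hX -(rhoVK (gamma t) w) -derive_mulmx_arg hcan.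
rewrite (_ : (fun y => _) = h); last exact/funext.
by rewrite crit momentum_mx_form.
Qed.

End Momentum.

End Representation.

(** * Constrained critical points by Newton's method *)

Lemma kernel_unitmx {F : fieldType} {m : nat} (L : 'M[F]_m) :
  (forall p : 'cV[F]_m, L *m p = 0 -> p = 0) -> L \in unitmx.
Proof.
move=> H; rewrite -unitmx_tr -row_free_unit; apply: inj_row_free => v vL.
by apply/trmx_inj; rewrite trmx0; apply: H; apply/trmx_inj; rewrite trmx_mul trmxK vL trmx0.
Qed.

HB.instance Definition _ (R : realType) m n := Complete.on 'M[R]_(m, n).

(** Newton's method with a frozen derivative: [x |-> x - L^-1 (F x)] is a
    contraction of the ball of radius [del], with constant [1 / 2]. *)
Lemma newton_solve {R : realType} {m : nat} (L : 'M[R]_m) : L \in unitmx ->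
  exists2 c, 0 < c & forall (F : 'cV[R]_m -> 'cV[R]_m) del, 0 < del ->
    (forall x y, `|x| <= del -> `|y| <= del ->
       `|F x - F y - L *m (x - y)| <= c * `|x - y|) ->
    `|F 0| <= c * del -> exists2 x, `|x| <= del & F x = 0.
Proof.
move=> uL; have [K K0 HK] := mulmx_bounded (invmx L).
exists (2 * K)^-1; first by rewrite invr_gt0 mulr_gt0.
set c := _^-1 => F del del0 HF F0.
have Kc : K * c = 2^-1 by rewrite /c invfM mulrCA divff ?mulr1// gt_eqF.
pose T x := x - invmx L *m F x.
have TL x y : `|x| <= del -> `|y| <= del -> `|T x - T y| <= 2^-1 * `|x - y|.
  move=> xd yd; have -> : T x - T y = - (invmx L *m (F x - F y - L *m (x - y))).
    rewrite mulmxBr mulKmx// mulmxBr /T; vec.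
  rewrite normrN (le_trans (HK _))// -Kc -mulrA; apply: (ler_wpM2l (ltW K0)).
  exact: HF.
pose U := [set x : 'cV[R]_m | `|x| <= del].
have U0 : U 0 by rewrite /U /= normr0 ltW.
have TU : {homo T : x / U x >-> U x}.
  move=> x Ux; rewrite /U /= -[T x](subrK (T 0)) (le_trans (ler_normD _ _))//.
  have -> : del = 2^-1 * del + K * (c * del) by rewrite mulrA Kc; field.
  rewrite lerD//; first by rewrite (le_trans (TL _ _ Ux U0))// subr0 ler_wpM2l.
  rewrite /T sub0r normrN (le_trans (HK _))//; exact: (ler_wpM2l (ltW K0)).
have clU : closed U.
  rewrite (_ : U = closed_ball_ Num.norm 0 del); first exact: closed_closed_ball_.
  by apply/funext => x; rewrite /closed_ball_ /= sub0r normrN.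
have [|||x Ux /= xT] := @banach_fixed_point R _ U (mkfun_fun TU).
- exists (2^-1)%:nng; split => /=; first by rewrite invf_lt1 ?ltr1n.
  by move=> [x y] [/= Ux Uy]; exact: TL.
- exact: clU.
- by exists 0.
exists x => //; have : invmx L *m F x = 0.
  by move: xT; rewrite /T => /eqP; rewrite eq_sym subr_eq addrC -subr_eq subrr => /eqP.
by move/(congr1 (mulmx L)); rewrite mulKVmx// mulmx0.
Qed.

Section ConstrainedCriticalPoint.
Context {R : realType} {n : nat}.

Lemma col_mx_norm_le (a : 'cV[R]_n) (b : 'cV[R]_1) k :
  `|a| <= k -> `|b| <= k -> `|col_mx a b : 'cV_(n + 1)| <= k.
Proof.
move=> ak bk; apply: cV_norm_le => [|i]; first exact: le_trans ak.
rewrite mxE; case: fintype.split => j.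
  exact: le_trans (cV_coord_le _ _) ak.
exact: le_trans (cV_coord_le _ _) bk.
Qed.

Lemma usubmx_norm_le (p : 'cV[R]_(n + 1)) : `|usubmx p| <= `|p|.
Proof. by apply: cV_norm_le => // i; rewrite mxE cV_coord_le. Qed.

Lemma dsubmx_norm_le (p : 'cV[R]_(n + 1)) : `|dsubmx p 0 0| <= `|p|.
Proof. by rewrite mxE cV_coord_le. Qed.

Lemma scalar_norm (a : R) : `|a%:M : 'cV[R]_1| = `|a|.
Proof.
apply/eqP; rewrite eq_le; apply/andP; split.
  by apply: cV_norm_le => // i; rewrite mxE ord1 eqxx.
by have := cV_coord_le (a%:M : 'cV[R]_1) 0; rewrite mxE eqxx.
Qed.

(** A Lyapunov-Schmidt reduction in one step.  The form [M] penalizes the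
    directions of the kernel of [A - B] other than [z], so that the linearization
    [L] of the rescaled system [F], bordered by the energy constraint and the
    Lagrange multiplier [mu], is invertible.  After division by [rho], the system
    is close to [L] in the Lipschitz sense, uniformly for small [rho]. *)
Lemma constrained_critical_point (h : 'cV[R]_n -> R) (B M : 'M[R]_n) z s :
  let A := hessian h 0 in
  Ck_on 2 setT h -> h 0 = 0 -> (forall v, 'D_v h 0 = 0) ->
  B^T = B -> M^T = M -> A *m z = B *m z -> M *m z = 0 ->
  sform A z z = s -> s != 0 ->
  (forall x, (A - B + M) *m x = 0 -> exists c, x = c *: z) ->
  forall eta, 0 < eta -> exists2 rho0, 0 < rho0 & forall rho, 0 < rho -> rho < rho0 ->
  exists x mu, [/\ `|x| <= eta, `|mu| <= eta, h (rho *: (z + x)) = s / 2 * rho ^+ 2 &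
    forall w, 'D_w h (rho *: (z + x)) =
      (1 + mu) * sform B (rho *: (z + x)) w - sform M (rho *: (z + x)) w].
Proof.
move=> A ch h0 dh0 symB symM ABz Mz Azz s0 ker eta eta0.
have symA : A^T = A by exact: hessian_sym.
pose L : 'M[R]_(n + 1) := block_mx (A - B + M) (- (B *m z)) (2 *: (z^T *m A)) 0.
have LE x (b : 'cV[R]_1) : L *m col_mx x b =
    col_mx ((A - B + M) *m x - b 0 0 *: (B *m z)) ((2 * sform A z x)%:M).
  rewrite mul_block_col mul0mx addr0; congr col_mx.
    rewrite mulNmx; congr (_ - _); rewrite [b]mx11_scalar mul_mx_scalar.
    by rewrite !mxE eqxx.
  by rewrite -scalemxAl [LHS]mx11_scalar mxE.
have uL : L \in unitmx.
  apply: kernel_unitmx => p; rewrite -[p]vsubmxK LE.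
  set x := usubmx p; set b := dsubmx p => E.
  have := congr1 usubmx E; rewrite col_mxKu => E1.
  have := congr1 dsubmx E; rewrite col_mxKd => E2.
  have b0 : b 0 0 = 0.
    have : sform 1%:M z (((A - B + M) *m x - b 0 0 *: (B *m z))) = 0.
      by rewrite E1 -[usubmx 0]/(usubmx (0 : 'cV[R]_(n + 1))) linear0 sform0r.
    rewrite sformBr sformZr -!sform_mulmx.
    rewrite (_ : sform (A - B + M) z x = 0); last first.
      rewrite sform_tr 2!linearD /= linearN /= symA symB symM sform_mulmx.
      by rewrite mulmxDl mulmxBl ABz subrr Mz addr0 sform0r.
    rewrite (_ : sform B z z = s) ?sub0r; last by rewrite sform_mulmx -ABz -sform_mulmx.
    by move/eqP; rewrite oppr_eq0 mulf_eq0 (negbTE s0) orbF => /eqP.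
  have [c xc] : exists c, x = c *: z.
    by apply: ker; move: E1; rewrite b0 scale0r subr0 => ->; rewrite linear0.
  have c0 : c = 0.
    move: E2 => /(congr1 (fun M : 'M[R]_1 => M 0 0)).
    rewrite xc sformZr Azz !mxE eqxx mulr1n => /eqP.
    by rewrite !mulf_eq0 (negbTE s0) orbF pnatr_eq0 /= => /eqP.
  rewrite xc c0 scale0r [b]mx11_scalar b0; apply/colP => i.
  by rewrite !mxE; case: fintype.split => j; rewrite !mxE ?mul0rn.
have [c c0 newton] := newton_solve uL.
have [CA CA0 HA] := sform_bounded A.
have [CB CB0 HB] := mulmx_bounded B.
pose N := `|z| + 1.
have z0 : 0 <= `|z| by [].
have N1 : 1 <= N by rewrite lerDr.
pose del := Num.min (Num.min eta 1) (Num.min (c / (4 * CA)) (c / (4 * CB))).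
have del0 : 0 < del by rewrite !lt_min eta0 ltr01 !divr_gt0// mulr_gt0.
have [de d1 dA dB] : [/\ del <= eta, del <= 1, 2 * CA * del <= c / 2 & 2 * CB * del <= c / 2].
  split; try by rewrite !ge_min lexx ?orbT.
    have : del <= c / (4 * CA) by rewrite !ge_min lexx ?orbT.
    by rewrite ler_pdivlMr ?mulr_gt0//; lra.
  have : del <= c / (4 * CB) by rewrite !ge_min lexx ?orbT.
  by rewrite ler_pdivlMr ?mulr_gt0//; lra.
(* [del] bounds the quadratic terms of [F - L], [kap] the remainders of [h] *)
pose kap := c * del / (4 * N * N).
have N0 : 0 < N by exact: lt_le_trans ltr01 N1.
have kap0 : 0 < kap by rewrite divr_gt0 ?mulr_gt0.
have kapE : kap * (4 * N * N) = c * del by rewrite /kap divfK// gt_eqF ?mulr_gt0.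
have kapN : 4 * (kap * N) <= c * del.
  have := ler_wpM2l (ltW (mulr_gt0 kap0 N0)) N1; lra.
have kap4 : 4 * kap <= c * del.
  have := ler_wpM2l (ltW kap0) N1; lra.
have cd : c * del <= c by rewrite ler_piMr// ltW.
have [del1 del10 H1] := gradient_expansion ch kap0.
have [del2 del20 H2] := energy_expansion ch dh0 kap0.
exists (Num.min del1 del2 / N) => [|rho rho0]; first by rewrite divr_gt0// lt_min del10.
rewrite ltr_pdivlMr// lt_min => /andP[rN1 rN2].
have zx x : `|x| <= 1 -> `|rho *: (z + x)| <= rho * N.
  move=> x1; rewrite normrZ (gtr0_norm rho0) ler_wpM2l ?(ltW rho0)//.
  by rewrite (le_trans (ler_normD _ _))// lerD2l.
(* the two equations, divided by [rho] and by [rho ^+ 2 / 2] *)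
pose F1 (x : 'cV[R]_n) (mu : R) : 'cV[R]_n :=
  rho^-1 *: gradient h (rho *: (z + x)) - (1 + mu) *: (B *m (z + x)) + M *m (z + x).
pose F2 (x : 'cV[R]_n) : R := 2 / rho ^+ 2 * h (rho *: (z + x)) - s.
pose F (p : 'cV[R]_(n + 1)) : 'cV[R]_(n + 1) :=
  col_mx (F1 (usubmx p) (dsubmx p 0 0)) ((F2 (usubmx p))%:M).
have rn0 : rho != 0 by rewrite gt_eqF.
have g0 : gradient h 0 = 0 by apply/colP => i; rewrite !mxE dh0.
pose Gr x y := gradient h (rho *: (z + x)) - gradient h (rho *: (z + y)) -
  A *m (rho *: (z + x) - rho *: (z + y)).
pose En x y := h (rho *: (z + x)) - h (rho *: (z + y)) - 2^-1 *
  (sform A (rho *: (z + x)) (rho *: (z + x)) - sform A (rho *: (z + y)) (rho *: (z + y))).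
have xyE x y : `|rho *: (z + x) - rho *: (z + y)| = rho * `|x - y|.
  by rewrite -scalerBr normrZ (gtr0_norm rho0) opprD addrACA subrr add0r.
have GrE x y : `|x| <= 1 -> `|y| <= 1 -> `|rho^-1 *: Gr x y| <= kap * `|x - y|.
  move=> x1 y1; rewrite normrZ normfV (gtr0_norm rho0) mulrC ler_pdivrMr//.
  rewrite -mulrA [`|_| * rho]mulrC -xyE; apply: H1.
    exact: le_lt_trans (zx _ x1) rN1.
  exact: le_lt_trans (zx _ y1) rN1.
have EnE x y : `|x| <= 1 -> `|y| <= 1 -> `|2 / rho ^+ 2 * En x y| <= 2 * kap * N * `|x - y|.
  move=> x1 y1; rewrite normrM (gtr0_norm (_ : 0 < 2 / rho ^+ 2)); last first.
    by rewrite divr_gt0// exprn_gt0.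
  have := H2 _ _ _ rN2 (zx _ x1) (zx _ y1); rewrite xyE => /(ler_wpM2l (_ : 0 <= 2 / rho ^+ 2)).
  rewrite divr_ge0 ?exprn_ge0 ?(ltW rho0)// => /(_ isT) /le_trans; apply.
  by rewrite le_eqVlt; apply/orP; left; apply/eqP; field.
have e1 x y mu nu : F1 x mu - F1 y nu - ((A - B + M) *m (x - y) - (mu - nu) *: (B *m z)) =
    rho^-1 *: Gr x y - (mu *: (B *m (x - y)) + (mu - nu) *: (B *m y)).
  rewrite /F1 /Gr !mulmxDl !mulmxDr !mulNmx !mulmxN -!scalemxAr !mulmxDr.
  by apply/colP => i; rewrite !mxE; field.
have e2 x y : F2 x - F2 y - 2 * sform A z (x - y) =
    2 / rho ^+ 2 * En x y + (sform A (x - y) x + sform A y (x - y)).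
  rewrite /F2 /En !(sformZl, sformZr, sformDl, sformDr, sformNl, sformNr).
  by rewrite (sform_sym x z symA) (sform_sym y z symA) (sform_sym y x symA); field.
have FL p q : `|p| <= del -> `|q| <= del -> `|F p - F q - L *m (p - q)| <= c * `|p - q|.
  move=> pd qd.
  have pqx : usubmx (p - q) = usubmx p - usubmx q by rewrite linearB.
  have pqm : dsubmx (p - q) 0 0 = dsubmx p 0 0 - dsubmx q 0 0.
    by rewrite linearB /= [LHS]mxE [X in _ + X]mxE.
  rewrite -[X in L *m X](vsubmxK (p - q)) LE pqx pqm /F.
  set x := usubmx p in pqx *; set y := usubmx q in pqx *.
  set mu := dsubmx p 0 0 in pqm *; set nu := dsubmx q 0 0 in pqm *.
  have sc (a b c' : R) : a%:M - b%:M - c'%:M = (a - b - c')%:M :> 'M[R]_1 by rewrite !raddfB.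
  rewrite !(opp_col_mx, add_col_mx) sc e1 e2.
  have xd : `|x| <= del by exact: le_trans (usubmx_norm_le _) pd.
  have yd : `|y| <= del by exact: le_trans (usubmx_norm_le _) qd.
  have x1 := le_trans xd d1; have y1 := le_trans yd d1.
  have mud : `|mu| <= del by exact: le_trans (dsubmx_norm_le _) pd.
  have xyp : `|x - y| <= `|p - q| by rewrite -pqx usubmx_norm_le.
  have mnp : `|mu - nu| <= `|p - q|.
    by rewrite -pqm dsubmx_norm_le.
  have P0 : 0 <= `|p - q| by [].
  move: (`|p - q|) xyp mnp P0 => P xyp mnp P0.
  apply: col_mx_norm_le; last rewrite scalar_norm.
    rewrite (le_trans (ler_normB _ _))// (le_trans (lerD (GrE _ _ x1 y1) (ler_normD _ _)))//.
    rewrite !normrZ.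
    have a1 : `|mu| * `|B *m (x - y)| <= del * (CB * P).
      by rewrite ler_pM// (le_trans (HB _))// ler_wpM2l// ltW.
    have a2 : `|mu - nu| * `|B *m y| <= P * (CB * del).
      by rewrite ler_pM// (le_trans (HB _))// ler_wpM2l// ltW.
    have a3 : kap * `|x - y| <= kap * P by rewrite ler_wpM2l// ltW.
    have a4 : 4 * kap * P <= c * P by rewrite ler_wpM2r// (le_trans kap4).
    have a5 : 2 * CB * del * P <= c / 2 * P by rewrite ler_wpM2r.
    have := mulr_ge0 (ltW c0) P0; lra.
  rewrite (le_trans (ler_normD _ _))// (le_trans (lerD (EnE _ _ x1 y1) (ler_normD _ _)))//.
  have a1 : `|sform A (x - y) x| <= CA * P * del.
    by rewrite (le_trans (HA _ _))// ler_pM ?mulr_ge0 ?(ltW CA0)// ler_wpM2l// ltW.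
  have a2 : `|sform A y (x - y)| <= CA * del * P.
    by rewrite (le_trans (HA _ _))// ler_pM ?mulr_ge0 ?(ltW CA0)// ler_wpM2l// ltW.
  have a3 : kap * N * `|x - y| <= kap * N * P by rewrite ler_wpM2l// mulr_ge0// ltW.
  have a4 : 4 * (kap * N) * P <= c * P by rewrite ler_wpM2r// (le_trans kapN).
  have a5 : 2 * CA * del * P <= c / 2 * P by rewrite ler_wpM2r.
  lra.
have F0 : `|F 0| <= c * del.
  have u0 : usubmx (0 : 'cV[R]_(n + 1)) = 0 by rewrite linear0.
  have d0 : dsubmx (0 : 'cV[R]_(n + 1)) 0 0 = 0 by rewrite linear0 mxE.
  rewrite /F u0 d0; have zz1 : `|- z| <= `|z| by rewrite normrN.
  have r0z : rho *: (z + - z) = 0 by rewrite subrr scaler0.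
  have rz : `|rho *: z| = rho * `|z| by rewrite normrZ (gtr0_norm rho0).
  have zN : `|z| <= N by rewrite lerDl.
  have rzN : `|rho *: z| <= rho * N by rewrite rz ler_wpM2l// ltW.
  apply: col_mx_norm_le; last rewrite scalar_norm.
    have -> : F1 0 0 = rho^-1 *: (gradient h (rho *: z) - gradient h 0 - A *m (rho *: z - 0)).
      rewrite /F1 g0 !addr0 !subr0 Mz addr0 scale1r -ABz -scalemxAr.
      by rewrite scalerBr scalerA mulVf// scale1r.
    have := H1 _ _ (le_lt_trans rzN rN1) (_ : `|0| < del1); rewrite normr0 => /(_ del10).
    rewrite subr0 [X in _ <= _ * X]rz => E; rewrite normrZ normfV (gtr0_norm rho0).
    rewrite mulrC ler_pdivrMr// (le_trans E)// mulrCA mulrC ler_wpM2r ?(ltW rho0)//.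
    by have := ler_wpM2l (ltW kap0) zN; have := mulr_ge0 (ltW kap0) (ltW N0); lra.
  have -> : F2 0 = 2 / rho ^+ 2 * (h (rho *: z) - h 0 - 2^-1 *
      (sform A (rho *: z) (rho *: z) - sform A 0 0)).
    by rewrite /F2 addr0 h0 sform0l sformZl sformZr Azz; field.
  rewrite normrM (gtr0_norm (_ : 0 < 2 / rho ^+ 2)); last by rewrite divr_gt0// exprn_gt0.
  have := H2 _ (rho *: z) 0 rN2 rzN; rewrite normr0 mulr_ge0 ?(ltW rho0) ?(ltW N0)// => /(_ isT).
  rewrite subr0 rz => /(ler_wpM2l (_ : 0 <= 2 / rho ^+ 2)).
  rewrite divr_ge0 ?exprn_ge0 ?(ltW rho0)// => /(_ isT) /le_trans; apply.
  rewrite [leLHS](_ : _ = 2 * (kap * N) * `|z|); last by field.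
  have := ler_wpM2l (ltW (mulr_gt0 kap0 N0)) zN.
  have := mulr_ge0 (ltW kap0) (mulr_ge0 (ltW N0) (ltW N0)); lra.
have [p pd Fp] := newton F del del0 FL F0.
exists (usubmx p), (dsubmx p 0 0).
have := congr1 usubmx Fp; rewrite /F col_mxKu linear0 => E1.
have := congr1 dsubmx Fp; rewrite /F col_mxKd linear0 => E2.
split.
- exact: le_trans (usubmx_norm_le p) (le_trans pd de).
- exact: le_trans (dsubmx_norm_le p) (le_trans pd de).
- have : F2 (usubmx p) = 0.
    by have := congr1 (fun M : 'M[R]_1 => M 0 0) E2; rewrite !mxE eqxx.
  rewrite /F2 => /eqP; rewrite subr_eq0 => /eqP <-; field.
  by rewrite rn0.
move=> w; rewrite derive_gradient; last exact: ch.1.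
rewrite /F1 in E1; move: (z + usubmx p) (dsubmx p 0 0) E1 => v mu E1.
have -> : gradient h (rho *: v) = (1 + mu) *: (B *m (rho *: v)) - M *m (rho *: v).
  have := congr1 ( *:%R rho) E1; rewrite scaler0 2!scalerDr scalerN scalerA divff// scale1r.
  rewrite -!scalemxAr => /eqP; rewrite -addrA addr_eq0 => /eqP ->.
  by rewrite opprD opprK; congr (_ - _); rewrite !scalerA mulrC.
rewrite sformBr sformZr -!sform_mulmx.
by rewrite (sform_sym w _ symB) (sform_sym w _ symM).
Qed.

End ConstrainedCriticalPoint.

(** * Smooth functions and the parametrization of a sphere *)

Section SmoothMaps.
Context {R : realType}.

Lemma Ck_onW (U W : normedModType R) k (f : U -> W) : Ck_on k.+1 setT f -> Ck_on k setT f.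
Proof.
elim: k f => [|k IH] f [df cf]; first by move=> x _; exact/differentiable_continuous/df.
by split=> // v; apply: IH; exact: cf.
Qed.

Lemma Ck_on_cst (U W : normedModType R) k (w : W) : Ck_on k setT (fun _ : U => w).
Proof.
elim: k w => [|k IH] w; first by move=> x _; exact: cvg_cst.
split=> [x _|v]; first exact: differentiable_cst.
have -> : 'D_v (fun _ : U => w) = fun=> 0 by apply/funext => x; exact: derive_cst.
exact: IH.
Qed.

Lemma Ck_onD (U W : normedModType R) k (f g : U -> W) :
  Ck_on k setT f -> Ck_on k setT g -> Ck_on k setT (fun x => f x + g x).
Proof.
elim: k f g => [|k IH] f g; first by move=> cf cg x _; apply: cvgD; [exact: cf|exact: cg].
move=> [df cf] [dg cg]; split=> [x _|v].
  by apply: differentiableD; [exact: df|exact: dg].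
have -> : 'D_v (fun x : U => f x + g x) = fun x => 'D_v f x + 'D_v g x.
  by apply/funext => x; apply: deriveD; apply: diff_derivable; [exact: df|exact: dg].
by apply: IH; [exact: cf|exact: cg].
Qed.

Lemma Ck_onM (U : normedModType R) k (f g : U -> R) :
  Ck_on k setT f -> Ck_on k setT g -> Ck_on k setT (fun x => f x * g x).
Proof.
elim: k f g => [|k IH] f g; first by move=> cf cg x _; apply: cvgM; [exact: cf|exact: cg].
move=> cf' cg'; have [df cf] := cf'; have [dg cg] := cg'; split=> [x _|v].
  by apply: differentiableM; [exact: df|exact: dg].
have -> : 'D_v (fun x : U => f x * g x) = fun x => f x * 'D_v g x + g x * 'D_v f x.
  by apply/funext => x; apply: deriveM; apply: diff_derivable; [exact: df|exact: dg].
by apply: Ck_onD; apply: IH; [exact: (Ck_onW cf')|exact: cg|exact: (Ck_onW cg')|exact: cf].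
Qed.

Lemma Ck_onV (U : normedModType R) k (f : U -> R) : (forall x, f x != 0) ->
  Ck_on k setT f -> Ck_on k setT (fun x => (f x)^-1).
Proof.
move=> f0; elim: k => [|k IH]; first by move=> cf x _; apply: cvgV => //; exact: cf.
move=> cf'; have [df cf] := cf'; split=> [x _|v]; first exact/differentiableV/f0/df.
have cV := IH (Ck_onW cf').
have -> : 'D_v (fun x : U => (f x)^-1) =
    fun x => (-1 * ((f x)^-1 * (f x)^-1)) * 'D_v f x.
  apply/funext => x; rewrite deriveV//; last exact/diff_derivable/df.
  by rewrite /GRing.scale/= -exprVn expr2; ring.
apply: (Ck_onM (f := fun x => -1 * ((f x)^-1 * (f x)^-1))); last exact: cf.
apply: (Ck_onM (f := fun=> -1)); first exact: Ck_on_cst.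
exact: (Ck_onM (f := fun x => (f x)^-1)).
Qed.

Lemma Ck_onZ (U W : normedModType R) k (f : U -> R) (w : W) :
  Ck_on k setT f -> Ck_on k setT (fun x => f x *: w).
Proof.
elim: k f => [|k IH] f.
  by move=> cf x _; apply: cvgZr_tmp; exact: cf.
move=> [df cf]; split=> [x _|v]; first exact/differentiableZl/df.
have -> : 'D_v (fun x : U => f x *: w) = fun x => 'D_v f x *: w; last exact/IH/cf.
apply/funext => x; rewrite !deriveE; [|exact: df|exact/differentiableZl/df].
by rewrite diffZl//; exact: df.
Qed.

Lemma Ck_on_sum (U W : normedModType R) k N (f : 'I_N -> U -> W) :
  (forall i, Ck_on k setT (f i)) -> Ck_on k setT (fun x => \sum_i f i x).
Proof.
move=> cf; have -> : (fun x => \sum_i f i x) = \sum_i f i.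
  by apply/funext => x; rewrite fct_sumE.
elim/big_ind: _ => [|g1 g2 c1 c2|i _]; [exact: Ck_on_cst|exact: Ck_onD|exact: cf].
Qed.

Lemma Ck_on_coord m k (i : 'I_m) : Ck_on k setT (fun x : 'cV[R]_m => x i 0).
Proof.
case: k => [|k]; first by move=> x _; exact: coord_continuous.
split=> [x _|v]; first exact: differentiable_coord.
have -> : 'D_v (fun x : 'cV[R]_m => x i 0) = fun=> v i 0; last exact: Ck_on_cst.
apply/funext => x; rewrite (derive_cV_coord i (f := id)); last exact: derivable_id.
by rewrite derive_id.
Qed.

Lemma Ck_on_sform m k (M : 'M[R]_m) : Ck_on k setT (fun x : 'cV[R]_m => sform M x x).
Proof.
have -> : (fun x : 'cV[R]_m => sform M x x) =
    fun x => \sum_j (\sum_i x i 0 * M i j) * x j 0.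
  apply/funext => x; rewrite /sform mxE; apply: eq_bigr => j _; rewrite mxE.
  by congr (_ * _); apply: eq_bigr => i _; rewrite mxE.
apply: Ck_on_sum => j.
apply: (@Ck_onM _ k (fun x : 'cV[R]_m => \sum_i x i 0 * M i j) (fun x => x j 0));
  last exact: Ck_on_coord.
by apply: Ck_on_sum => i; apply: Ck_onM; [exact: Ck_on_coord|exact: Ck_on_cst].
Qed.

End SmoothMaps.

Lemma mulmx_continuous {R : realType} p m (M : 'M[R]_(p, m)) :
  continuous (fun v : 'cV[R]_m => M *m v).
Proof.
move=> v.
have cM := @matrix_linear_continuous R m 1 p 1 (mulmx M : {linear 'cV[R]_m -> 'cV[R]_p}) v.
exact: cM.
Qed.

Section Sphere.
Context {R : realType} {n : nat}.
Variables (A K : 'M[R]_n) (s : R).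
Hypotheses (symA : A^T = A) (s1 : s * s = 1).
Hypothesis pos : forall v, K *m v = 0 -> v != 0 -> 0 < s * sform A v v.

(** The columns of [b] are to be a basis of the tangent space at [z] of the unit
    sphere of the kernel of [K].  The left inverse [c] of [b] makes the inverse of
    the parametrization of the sphere explicit. *)
Lemma tangent_basis (z : 'cV[R]_n) :
  exists k (b : 'M[R]_(n, k)) (c : 'M[R]_(k, n)),
    [/\ c *m b = 1%:M, forall y, K *m (b *m y) = 0 /\ sform A z (b *m y) = 0 &
      forall u, K *m u = 0 -> sform A z u = 0 -> exists y, u = b *m y].
Proof.
pose Kz : 'M[R]_(n + 1, n) := col_mx K (z^T *m A).
have KzP u : Kz *m u = 0 <-> K *m u = 0 /\ sform A z u = 0.
  rewrite mul_col_mx; split=> [E|[-> zu]].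
    have := congr1 usubmx E; rewrite col_mxKu linear0 => ->; split=> //.
    have := congr1 dsubmx E; rewrite col_mxKd linear0 => E2.
    by rewrite /sform E2 mxE.
  by rewrite [X in col_mx _ X]mx11_scalar -/(sform A z u) zu raddf0 col_mx0.
pose rb := row_base (kermx Kz^T).
have rbK : rb *m Kz^T = 0 by apply/sub_kermxP; rewrite eq_row_base.
exists _, rb^T, (pinvmx rb)^T; split.
- by rewrite -trmx_mul mulmxVp ?trmx1// row_base_free.
- have Kzrb : Kz *m rb^T = 0 by apply: trmx_inj; rewrite trmx_mul trmxK rbK trmx0.
  by move=> y; apply/KzP; rewrite mulmxA Kzrb mul0mx.
move=> u Ku zu; have : Kz *m u = 0 by apply/KzP.
move=> /(congr1 trmx); rewrite trmx_mul trmx0 => /sub_kermxP.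
move=> uK; have /submxP[w uw] : (u^T <= rb)%MS by rewrite eq_row_base.
by exists w^T; rewrite -trmx_mul -uw trmxK.
Qed.

Variables (z : 'cV[R]_n) (k : nat) (b : 'M[R]_(n, k)) (c : 'M[R]_(k, n)).
Hypotheses (Kz : K *m z = 0) (Az : s * sform A z z = 1).
Hypothesis cb : c *m b = 1%:M.
Hypothesis bz : forall y, K *m (b *m y) = 0 /\ sform A z (b *m y) = 0.
Hypothesis bspan : forall u, K *m u = 0 -> sform A z u = 0 -> exists y, u = b *m y.

Let q (x : 'cV[R]_k) := s * sform A (b *m x) (b *m x).
Let r (x : 'cV[R]_k) := (1 + q x)^-1.

(** The inverse of the stereographic projection of the unit sphere from [- z],
    written with [r x = 1 / (1 + |x|^2)]. *)
Definition stereographic (x : 'cV[R]_k) : 'cV[R]_n :=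
  (2 * r x - 1) *: z + (2 * r x) *: (b *m x).

Let q0 x : 0 <= q x.
Proof.
rewrite /q; have [->|/(pos (bz x).1)/ltW//] := eqVneq (b *m x) 0.
by rewrite sform0l mulr0.
Qed.

Let r0 x : 0 < r x.
Proof. by rewrite invr_gt0 ltr_wpDr. Qed.

Let rq x : r x * q x = 1 - r x.
Proof. by rewrite /r; have := q0 x => h; field; rewrite gt_eqF// ltr_wpDr. Qed.

Let q_sform x : q x = sform (s *: (b^T *m A *m b)) x x.
Proof. rewrite /q /sform trmx_mul -scalemxAr -scalemxAl [RHS]mxE; congr (_ * _).
by rewrite !mulmxA. Qed.

Let r_smooth m : Ck_on m setT r.
Proof.
apply: Ck_onV => [x|]; first by rewrite gt_eqF// ltr_wpDr.
apply: Ck_onD; first exact: Ck_on_cst.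
by rewrite (_ : q = fun x => sform (s *: (b^T *m A *m b)) x x);
  [exact: Ck_on_sform|apply/funext => x; exact: q_sform].
Qed.

Lemma stereographicE x : stereographic x =
  (2 * r x - 1) *: z + \sum_j (2 * r x * x j 0) *: (b *m delta_mx j 0).
Proof.
rewrite /stereographic {3}(cV_sum_delta x) mulmx_sumr scaler_sumr.
by congr (_ + _); apply: eq_bigr => j _; rewrite -scalemxAr scalerA.
Qed.

Lemma stereographic_smooth m : Ck_on m setT stereographic.
Proof.
rewrite (_ : stereographic = fun x =>
  (2 * r x + -1) *: z + \sum_j (2 * r x * x j 0) *: (b *m delta_mx j 0)); last first.
  by apply/funext => x; rewrite stereographicE.
have c2r : Ck_on m setT (fun x => 2 * r x) by apply: Ck_onM => //; exact: Ck_on_cst.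
apply: Ck_onD; first by apply/Ck_onZ/Ck_onD => //; exact: Ck_on_cst.
by apply: Ck_on_sum => j; apply/Ck_onZ/Ck_onM => //; exact: Ck_on_coord.
Qed.

Lemma derive_stereographic x a : 'D_a stereographic x =
  (2 * 'D_a r x) *: z + b *m (2 *: ('D_a r x *: x + r x *: a)).
Proof.
have dr : is_derive x a r ('D_a r x).
  exact/derivableP/diff_derivable/(r_smooth 1).1.
have dphi : derivable stereographic x a.
  exact/diff_derivable/(stereographic_smooth 1).1.
apply/colP => i; rewrite -derive_cV_coord//.
have db : is_derive x a (fun y : 'cV[R]_k => (b *m y) i 0) ((b *m a) i 0).
  have [d1 d2] := is_derive_linear (mulmx b : {linear 'cV[R]_k -> 'cV[R]_n}) (is_derive_id x a).
  by apply: DeriveDef; [exact: (derivable_mxP _ _ _).1 d1 i 0|rewrite derive_cV_coord// d2].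
have [_] := is_deriveD (is_deriveD (is_deriveZ (2 * z i 0) dr) (is_derive_cst (- z i 0) x a))
  (is_deriveZ 2 (is_deriveM dr db)).
have -> : 2 * z i 0 *: r + cst (- z i 0) + 2 *: (r * (fun y : 'cV[R]_k => (b *m y) i 0))
   = fun y => stereographic y i 0.
  apply/funext => y; rewrite /stereographic !fctE !mxE /GRing.scale/=.
  ring.
move=> ->.
rewrite -!scalemxAr mulmxDr -!scalemxAr.
move: (b *m x) (b *m a) => bx ba; rewrite !mxE /GRing.scale/=; ring.
Qed.

Let ell (u : 'cV[R]_n) := s * sform A z u.

Let ell_stereographic x : ell (stereographic x) = 2 * r x - 1.
Proof.
rewrite /ell /stereographic sformDr !sformZr (bz x).2 mulr0 addr0 mulrCA Az.
by rewrite mulr1.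
Qed.

Lemma stereographic_sphere x :
  K *m stereographic x = 0 /\ s * sform A (stereographic x) (stereographic x) = 1.
Proof.
split; first by rewrite mulmxDr -!scalemxAr Kz (bz x).1 !scaler0 addr0.
have zb := (bz x).2; have bz' : sform A (b *m x) z = 0 by rewrite sform_sym.
rewrite /stereographic !(sformDl, sformDr, sformZl, sformZr) zb bz'.
have h1 := rq x; rewrite /q in h1.
transitivity ((2 * r x - 1) * (2 * r x - 1) * (s * sform A z z) +
  4 * r x * (r x * (s * sform A (b *m x) (b *m x)))); first by ring.
by rewrite Az h1; ring.
Qed.

(* The stereographic projection from [- z], in the coordinates given by [b]. *)
Let proj (u : 'cV[R]_n) : 'cV[R]_k := (1 + ell u)^-1 *: (c *m (u - ell u *: z)).

Let stereographicK x : proj (stereographic x) = x.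
Proof.
have rx := r0 x.
rewrite /proj ell_stereographic /stereographic addrAC subrr add0r -scalemxAr.
rewrite mulmxA cb mul1mx scalerA (_ : _ * _ = 1) ?scale1r//.
by rewrite addrC subrK mulVf// mulf_neq0// gt_eqF.
Qed.

Let projK u : K *m u = 0 -> s * sform A u u = 1 -> 1 + ell u != 0 ->
  stereographic (proj u) = u.
Proof.
move=> Ku Su lu; set l := ell u in lu *.
have Ku' : K *m (u - l *: z) = 0 by rewrite mulmxBr -scalemxAr Kz Ku scaler0 subr0.
have zu' : sform A z (u - l *: z) = 0.
  rewrite sformBr sformZr /l /ell [s * _]mulrC -mulrA Az.
  by rewrite mulr1 subrr.
have [y uy] := bspan Ku' zu'.
have pu : proj u = (1 + l)^-1 *: y.
  by rewrite /proj -/l uy mulmxA cb mul1mx.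
have bp : b *m proj u = (1 + l)^-1 *: (u - l *: z) by rewrite pu -scalemxAr uy.
have uz : sform A u z = sform A z u by rewrite sform_sym.
have qp : q (proj u) = (1 - l) / (1 + l).
  rewrite /q bp sformZl sformZr !(sformBl, sformBr, sformZl, sformZr) uz.
  transitivity ((1 + l)^-1 * (1 + l)^-1 * (s * sform A u u - l * ell u - l * ell u
    + l * l * (s * sform A z z))); first by rewrite /ell; ring.
  by rewrite Su Az -/l; field.
have rp : r (proj u) = (1 + l) / 2.
  by rewrite /r qp (_ : 1 + _ = 2 / (1 + l)) ?invf_div//; field.
rewrite /stereographic rp bp scalerA (_ : 2 * _ - 1 = l); last by field.
by rewrite (_ : _ * _ = 1) ?scale1r ?subrKC//; field.
Qed.

Let ell_continuous : continuous ell.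
Proof.
move=> u; rewrite /ell.
have -> : (fun u : 'cV[R]_n => s * sform A z u) = fun u => ((s *: (z^T *m A)) *m u) 0 0.
  by apply/funext => w; rewrite -scalemxAl mxE.
apply: (@continuous_comp _ _ _ (mulmx (s *: (z^T *m A))) (fun w => w 0 0)).
  by have cM := @mulmx_continuous _ _ _ (s *: (z^T *m A)) u; exact: cM.
exact: coord_continuous.
Qed.

(** The image of an open set is cut out of the sphere by its inverse image under
    the stereographic projection, which is continuous where [ell u <> -1].  The
    differential is injective because its component along [z] is [2 'D_a r x] and
    the other one, once ['D_a r x] vanishes, is [2 r x (b a)]. *)
Lemma stereographic_parametrization :
  is_parametrization [set u | K *m u = 0 /\ s * sform A u u = 1] setT stereographic.
Proof.
split.
- exact: openT.
- by move=> m; exact: stereographic_smooth.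
- by move=> x y _ _ /(congr1 proj); rewrite !stereographicK.
- move=> x a _; rewrite derive_stereographic => E.
  have Dr : 'D_a r x = 0.
    have := congr1 ell E; rewrite /ell sformDr sformZr (bz _).2 addr0 sform0r mulr0.
    by rewrite mulrCA Az mulr1 => /eqP; rewrite mulf_eq0 pnatr_eq0 => /eqP.
  move: E; rewrite Dr mulr0 !scale0r !add0r => /(congr1 (mulmx c)).
  rewrite mulmxA cb mul1mx mulmx0 => /eqP; rewrite !scaler_eq0 pnatr_eq0/=.
  by rewrite gt_eqF// => /eqP.
move=> D' oD _; exists [set u | 1 + ell u != 0 /\ D' (proj u)].
  rewrite openE => u [lu Du]; rewrite /interior/=.
  have cl : (fun v => 1 + ell v) @ u --> 1 + ell u.
    exact: (cvgD (cvg_cst (1 : R)) (@ell_continuous u)).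
  apply: filterI.
    by apply: (cl [set x | x != 0]); exact: open_nbhs_nbhs (conj (@open_neq _ 0) lu).
  have cp : proj @ u --> proj u.
    pose P := c *m (1%:M - s *: (z *m (z^T *m A))).
    have PE v : P *m v = c *m (v - ell v *: z).
      rewrite /P -mulmxA mulmxBl mul1mx -scalemxAl -[z *m _ *m v]mulmxA.
      by rewrite [z^T *m A *m v]mx11_scalar mul_mx_scalar scalerA.
    have c2 : (fun v => c *m (v - ell v *: z)) @ u --> c *m (u - ell u *: z).
      rewrite -PE (_ : (fun v => _) = mulmx P); last by apply/funext => v; rewrite -PE.
      exact: (@mulmx_continuous _ _ _ P u).
    exact: cvgZ (cvgV lu cl) c2.
  by apply: cp; exact: open_nbhs_nbhs.
apply/seteqP; split=> [_ [x Dx <-]|u [[Ku Su] [lu Du]]].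
  split; first exact: stereographic_sphere.
  by rewrite /= stereographicK ell_stereographic addrC subrK mulf_neq0 ?gt_eqF.
by exists (proj u); rewrite // projK.
Qed.

Lemma stereographic0 : stereographic 0 = z.
Proof.
by rewrite /stereographic /r /q mulmx0 sform0l mulr0 addr0 invr1 mulr1 scaler0 addr0
  -[2]/(1 + 1) addrK scale1r.
Qed.

Lemma derive_stereographic0 a : 'D_a stereographic 0 = 2 *: (b *m a).
Proof.
have r00 : r 0 = 1 by rewrite /r /q mulmx0 sform0l mulr0 addr0 invr1.
have Dq : is_derive (0 : 'cV[R]_k) a q 0.
  have -> : q = fun x => sform (s *: (b^T *m A *m b)) x x by apply/funext => x.
  by apply: is_derive_eq; first exact: is_derive_sform; rewrite sform0l sform0r addr0.
have Dr : 'D_a r 0 = 0.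
  have q1 : (cst 1 + q) 0 != 0 by rewrite /= fctE gt_eqF// ltr_wpDr.
  have [d1 d2] := is_deriveD (is_derive_cst (1 : R) (0 : 'cV[R]_k) a) Dq.
  have -> : r = (fun x => ((cst 1 + q) x)^-1) by [].
  by rewrite deriveV// d2 addr0 scaler0.
by rewrite derive_stereographic Dr r00 mulr0 !scale0r !add0r scale1r scalemxAr.
Qed.

End Sphere.

(** * Transitivity on the unit sphere of the kernel *)

Lemma sform_differentiable {R : realType} {n : nat} (M : 'M[R]_n) u x :
  differentiable (fun v : 'cV[R]_n => sform M u v) x.
Proof.
have [+ _] := Ck_on_sum (k := 1) (f := fun (j : 'I_n) (v : 'cV[R]_n) =>
  (\sum_i u i 0 * M i j) * v j 0)
  (fun j => Ck_onM (Ck_on_cst _ 1 (\sum_i u i 0 * M i j)) (Ck_on_coord _ j)).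
move=> /(_ x I) dS.
rewrite (_ : (fun v => _) = fun v : 'cV[R]_n => \sum_j (\sum_i u i 0 * M i j) * v j 0)//.
by apply/funext => v; rewrite sform_sum.
Qed.

Section ResonantSphere.
Context {R : realType} {d n : nat} {G : lieGroupType R d}.
Variables (e : chart R d G) (rho : G -> 'M[R]_n).
Hypotheses (cG : compact [set: G]) (he : atlas e) (he1 : chart_dom e 1%g).
Hypothesis (hrho : is_representation rho).
Variables (A B : 'M[R]_n) (s : R) (xi : 'cV[R]_d).
Hypotheses (symA : A^T = A) (s1 : s * s = 1).
Local Notation K := (A - B).
Local Notation Gxi := (Ad_stabilizer e xi).
Local Notation X := (inf_mx e rho).
Hypothesis pos : forall v, K *m v = 0 -> v != 0 -> 0 < s * sform A v v.
Hypothesis invA : forall g u v, sform A (rho g *m u) (rho g *m v) = sform A u v.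
Hypothesis invB : forall g, Gxi g ->
  forall u v, sform B (rho g *m u) (rho g *m v) = sform B u v.
Hypothesis Bxi : forall v, X xi *m v = 0 -> sform B v v = 0.

Let invK g : Gxi g -> forall u v, sform K (rho g *m u) (rho g *m v) = sform K u v.
Proof. by move=> Gg u v; rewrite !sform_mxB invA invB. Qed.

Let sK v : K *m v = 0 -> forall u, sform A u v = sform B u v.
Proof.
move=> Kv u; apply/eqP; rewrite -subr_eq0 -sform_mxB.
by rewrite /sform -mulmxA Kv mulmx0 mxE.
Qed.

Lemma resonant_stable g (v : 'cV[R]_n) : Gxi g -> K *m v = 0 -> K *m (rho g *m v) = 0.
Proof.
move=> Gg Kv; apply: sform1_eq0 => u; rewrite -sform_mulmx.
rewrite -(rhoVK hrho g u) invK// sform_mulmx Kv sform0r//.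
Qed.

Lemma resonant_inf_stable eta (v : 'cV[R]_n) : lie_subalgebra e Gxi eta -> K *m v = 0 ->
  K *m (X eta *m v) = 0.
Proof.
move=> [gamma [og Gg]] Kv.
have /(congr1 (mulmx^~ v)) : (X eta)^T *m K = - (K *m X eta).
  by apply: (inf_mx_skew he he1 hrho og) => t; apply: invariant_form; exact: invK.
rewrite mulNmx -!mulmxA Kv mulmx0 => /esym/eqP.
by rewrite oppr_eq0 => /eqP.
Qed.

Lemma inf_skew_form eta gamma u v : one_parameter e eta gamma ->
  sform A (X eta *m u) v = - sform A u (X eta *m v).
Proof.
move=> og; rewrite sform_mull sform_mulr.
have -> : (X eta)^T *m A = - (A *m X eta).
  by apply: (inf_mx_skew he he1 hrho og) => t; apply: invariant_form; exact: invA.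
by rewrite /sform mulmxN mulNmx mxE.
Qed.

Hypothesis mb : morse_bott e rho Gxi [set u | K *m u = 0 /\ s * sform A u u = 1]
  (fun u => 2^-1 * sform B u u).

(** On the sphere the function [J^xi] is constant, since the forms [A] and [B]
    agree on the kernel of [A - B]: all points are critical, the Hessian vanishes
    and the Morse-Bott condition makes every orbit open in the sphere. *)
Lemma sphere_tangent z u : K *m z = 0 -> s * sform A z z = 1 ->
  K *m u = 0 -> sform A z u = 0 ->
  exists2 eta, lie_subalgebra e Gxi eta & u = X eta *m z.
Proof.
move=> Kz Az Ku zu.
have [k [b [c [cb bz bspan]]]] := tangent_basis A K z.
have [y uy] := bspan u Ku zu.
have par := stereographic_parametrization symA pos Kz Az cb bz bspan.
set phi := stereographic A s z b in par *.
have cst_f : (fun u => 2^-1 * sform B u u) \o phi = cst (2^-1 * s).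
  apply/funext => x; rewrite /=.
  have [Kp Sp] := stereographic_sphere symA pos Kz Az bz x.
  by rewrite -(sK Kp) -[sform A _ _]mul1r -s1 -mulrA Sp mulr1.
have D0 (a : 'cV[R]_k) x : 'D_a (cst (2^-1 * s) : 'cV[R]_k -> R) x = 0 by exact: derive_cst.
have := mb par (x := 0) I; rewrite cst_f => /(_ (fun a => D0 a 0)).
rewrite /phi stereographic0 => E.
have : orbit_tangent e rho Gxi z u.
  rewrite -E; exists (2^-1 *: y).
    rewrite /hess_ker /= (_ : hessian _ _ = 0) ?mul0mx//.
    apply/matrixP => i j; rewrite !mxE /d2.
    rewrite (_ : (fun y => _) = cst 0); first exact: derive_cst.
    by apply/funext => w; exact: D0.
  rewrite (derive_stereographic0 pos bz).
  by rewrite -scalemxAr scalerA divff ?scale1r.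
by move=> [eta leta <-]; exists eta => //; rewrite (inf_actionE he he1 hrho).
Qed.

Lemma resonant_tangent v u : K *m v = 0 -> v != 0 -> K *m u = 0 -> sform A v u = 0 ->
  exists2 eta, lie_subalgebra e Gxi eta & u = X eta *m v.
Proof.
move=> Kv v0 Ku vu; have p := pos Kv v0.
set q := s * sform A v v in p.
have sq0 : 0 < Num.sqrt q by rewrite sqrtr_gt0.
pose a := (Num.sqrt q)^-1.
have Kz : K *m (a *: v) = 0 by rewrite -scalemxAr Kv scaler0.
have Az : s * sform A (a *: v) (a *: v) = 1.
  rewrite sformZl sformZr (_ : _ * _ = a ^+ 2 * q); last by rewrite /q; ring.
  by rewrite /a exprVn sqr_sqrtr ?ltW// mulVf// gt_eqF.
have [|eta leta ->] := sphere_tangent Kz Az Ku; first by rewrite sformZl vu mulr0.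
exists (a *: eta); first exact: lie_subalgebraZ.
by rewrite (inf_mxZ he he1 hrho) -scalemxAr -scalemxAl.
Qed.

(** A point [w] of the orbit of [z1] closest to [z2] cannot be improved along the
    orbit, so that [z2] is orthogonal to the tangent space of the sphere at [w] and
    is [w] or [- w].  In the second case the whole orbit is as far from [z2] as
    [- z2], hence reduced to [w], although [xi] does not fix [w]: this is where
    the sphere with two points is excluded. *)
Lemma sphere_transitive z1 z2 : K *m z1 = 0 -> s * sform A z1 z1 = 1 ->
  K *m z2 = 0 -> s * sform A z2 z2 = 1 -> exists2 g, Gxi g & z2 = rho g *m z1.
Proof.
move=> Kz1 Az1 Kz2 Az2.
have [sG clG] := Ad_stabilizer_closed_subgroup he he1 xi cG.
have [G1 GM _] := sG.
pose f g := s * sform A z2 (rho g *m z1).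
have fc : continuous f.
  move=> g; rewrite /continuous_at /f.
  have fE : (fun g => s * sform A z2 (rho g *m z1)) =
     (fun M : 'M[R]_n => s * sform A z2 (M *m z1)) \o rho by [].
  have cc : continuous (fun M : 'M[R]_n => s * sform A z2 (M *m z1)).
    move=> M.
    pose L := (fun N : 'M[R]_1 => s * N 0 0) \o (mulmx (z2^T *m A) \o mulmxr z1).
    rewrite (_ : (fun M => _) = L); last by apply/funext => N; rewrite /sform /L.
    apply: continuous_comp.
      apply: (@continuous_comp _ _ _ (mulmxr z1) (mulmx (z2^T *m A))).
        by have := @matrix_linear_continuous R n n n 1 (mulmxr z1 : {linear 'M[R]_n -> 'cV[R]_n}) M.
      by have := @mulmx_continuous R 1 n (z2^T *m A) (M *m z1).
    apply: continuous_comp; first exact: coord_continuous.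
    exact: mulrl_continuous.
  rewrite fE.
  by apply: (@continuous_comp _ _ _ rho); [exact: rho_continuous|exact: cc].
have cGx : compact Gxi by apply: subclosed_compact clG cG _.
have [g0 /set_mem Gg0 g0max] : exists2 c, c \in Gxi & forall t, t \in Gxi -> f t <= f c.
  apply: compact_EVT_max => //; first by exists 1%g.
  exact: continuous_subspaceT.
set w := rho g0 *m z1 in g0max.
have Kw : K *m w = 0 by exact: resonant_stable.
have Aw : s * sform A w w = 1 by rewrite invA.
have rM g : rho (g * g0)%g *m z1 = rho g *m w.
  by have [_ rM _] := hrho; rewrite rM -mulmxA.
have wmax g : Gxi g -> s * sform A z2 (rho g *m w) <= s * sform A z2 w.
  by move=> Gg; rewrite -rM; apply: (g0max (g * g0)%g); rewrite inE; exact: GM.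
pose c := s * sform A z2 w.
have zw : sform A w z2 = sform A z2 w by rewrite sform_sym.
pose u := z2 - c *: w.
have Ku : K *m u = 0 by rewrite mulmxBr -scalemxAr Kz2 Kw scaler0 subr0.
have wu : sform A w u = 0.
  rewrite sformBr sformZr zw /c [s * _]mulrC -mulrA Aw mulr1 subrr//.
have [eta [gamma [og Gg]] uX] := sphere_tangent Kw Aw Ku wu.
have d0 : 'D_(u) (fun v => sform A z2 v) w = 0.
  have := is_derive_orbit he he1 hrho og w 0.
  have [rho1 _ _] := hrho.
  rewrite (one_parameter0 og) rho1 mul1mx -uX => d1.
  have := is_derive_chain (f := fun v => sform A z2 v) d1 (sform_differentiable _ _ _).
  rewrite (one_parameter0 og) rho1 mul1mx => d2.
  have d3 := is_deriveZ s d2.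
  have s0 : s != 0 by apply: contra_eq_neq s1 => ->; rewrite mul0r eq_sym oner_eq0.
  apply: (mulfI s0); rewrite mulr0.
  apply: is_derive_unique d3 _.
  apply: (@derive1_at_max R _ (-1) 1).
  - by apply: (@le_trans _ _ 0); rewrite ?oppr_le0 ?ler01.
  - move=> t _; apply: derivableZ.
    have := is_derive_orbit he he1 hrho og w t => dt.
    by have [] := is_derive_chain (f := fun v => sform A z2 v) dt (sform_differentiable _ _ _).
  - by rewrite in_itv/= ltr01 oppr_lt0 ltr01.
  - move=> t _; rewrite !fctE /= (one_parameter0 og) rho1 mul1mx.
    exact: wmax.
have u0 : u = 0.
  apply/eqP/negPn/negP => /(pos Ku).
  have [_ d0'] := is_derive_sformr A z2 w u.
  rewrite -[X in sform A X u]/u /u sformBl sformZl -/u wu mulr0 subr0.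
  by rewrite -d0' d0 mulr0 ltxx.
have z2w : z2 = c *: w by apply/eqP; rewrite -subr_eq0 -/u u0.
have c2 : c * c = 1.
  move: Az2; rewrite {1 2}z2w sformZl sformZr => <-.
  by rewrite -[c * c]mulr1 -Aw; ring.
have : (c == 1) || (c == -1) by rewrite -sqrf_eq1 expr2 c2.
move=> /orP[/eqP c1|/eqP c1].
  by exists g0 => //; rewrite z2w c1 scale1r.
exfalso; move: z2w; rewrite c1 scaleN1r => z2w.
have [gx ogx] := one_parameter_exists he he1 xi cG.
have Ggx t : Gxi (gx t).
  apply/(Ad_stabilizerP he he1 _ ogx) => t'; have [_ gD _] := ogx.
  by rewrite -!gD addrC.
(* equality in the Cauchy-Schwarz inequality *)
have fixw t : rho (gx t) *m w = w.
  set w' := rho _ *m w; apply/eqP; rewrite -subr_eq0.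
  apply/negPn/negP => n0.
  have Kw' : K *m w' = 0 by exact: resonant_stable.
  have /pos/(_ n0) : K *m (w' - w) = 0 by rewrite mulmxBr Kw Kw' subrr.
  have Aw' : s * sform A w' w' = 1 by rewrite invA.
  have := wmax _ (Ggx t); rewrite -/w' z2w !sformNl !mulrN Aw lerN2.
  rewrite !sformBl !sformBr (sform_sym w' w)// !mulrBr Aw Aw' => le1.
  by rewrite opprB ltNge; move/negP; apply; lra.
have Xw : X xi *m w = 0.
  have d1 := is_derive_orbit he he1 hrho ogx w 0.
  have [rho1 _ _] := hrho.
  move: d1; rewrite (one_parameter0 ogx) rho1 mul1mx => d1.
  apply: is_derive_unique d1 _.
  rewrite (_ : (fun t => _) = cst w); first exact: is_derive_cst.
  by apply/funext => t; rewrite fixw.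
have := Aw; rewrite (sK Kw) (Bxi Xw) mulr0 => /eqP.
by rewrite eq_sym oner_eq0.
Qed.

End ResonantSphere.

(** * Existence of a relative equilibrium on each energy level *)

Section RelativeEquilibria.
Context {R : realType} {d n : nat} {G : lieGroupType R d}.
Variables (e : chart R d G) (rho : G -> 'M[R]_n).
Hypotheses (cG : compact [set: G]) (he : atlas e) (he1 : chart_dom e 1%g).
Hypothesis (hrho : is_representation rho).
Variables (Omega : 'M[R]_n) (h : 'cV[R]_n -> R) (Xh : 'cV[R]_n -> 'cV[R]_n).
Hypotheses (hOmega : symplectic Omega)
  (hcan : forall g u v, sform Omega (rho g *m u) (rho g *m v) = sform Omega u v).
Hypotheses (ch : Ck_on 2 setT h) (hinv : forall g v, h (rho g *m v) = h v)
  (hXh : is_hamiltonian_vf Omega h Xh) (h0 : h 0 = 0) (dh0 : forall v, 'D_v h 0 = 0).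
Variables (s : R) (xi : 'cV[R]_d).
Hypothesis s1 : s * s = 1.
Local Notation A := (hessian h 0).
Local Notation B := (momentum_mx e rho Omega xi).
Local Notation K := (A - B).
Local Notation Gxi := (Ad_stabilizer e xi).
Local Notation X := (inf_mx e rho).
Hypothesis pos : forall v, K *m v = 0 -> v != 0 -> 0 < s * sform A v v.
Hypothesis mb : morse_bott e rho Gxi [set u | K *m u = 0 /\ s * sform A u u = 1]
  (fun u => 2^-1 * sform B u u).

Let symA : A^T = A. Proof. exact: hessian_sym. Qed.

Let invA g u v : sform A (rho g *m u) (rho g *m v) = sform A u v.
Proof. exact: hessian_invariant. Qed.

Lemma momentum_mx_stabilizer g : Gxi g ->
  forall u v, sform B (rho g *m u) (rho g *m v) = sform B u v.
Proof.
have [gx ogx] := one_parameter_exists he he1 xi cG.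
move=> /(Ad_stabilizerP he he1 _ ogx) gc.
exact: (momentum_mx_invariant he he1 hrho hcan ogx gc).
Qed.

Lemma momentum_mx_fixed v : X xi *m v = 0 -> sform B v v = 0.
Proof. by move=> Xv; rewrite momentum_mx_form Xv sform0l. Qed.

Let tangent := resonant_tangent he he1 hrho symA s1 pos mb.

Lemma momentum_mx_symmetric eta : (momentum_mx e rho Omega eta)^T = momentum_mx e rho Omega eta.
Proof.
have [gx ogx] := one_parameter_exists he he1 eta cG.
exact: (momentum_mx_sym he he1 hrho hOmega hcan ogx).
Qed.

Lemma resonant_definite v : K *m v = 0 -> sform A v v = 0 -> v = 0.
Proof.
move=> Kv Av; apply/eqP/negPn/negP => /(pos Kv).
by rewrite Av mulr0 ltxx.
Qed.

Section Penalty.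
Variables (z : 'cV[R]_n) (k : nat) (b : 'M[R]_(n, k)) (c : 'M[R]_(k, n)).
Hypotheses (Kz : K *m z = 0) (Az : s * sform A z z = 1).
Hypothesis cb : c *m b = 1%:M.
Hypothesis bz : forall y, K *m (b *m y) = 0 /\ sform A z (b *m y) = 0.
Hypothesis bspan : forall u, K *m u = 0 -> sform A z u = 0 -> exists y, u = b *m y.

Let M : 'M[R]_n := A *m b *m (A *m b)^T.
Let p (v : 'cV[R]_n) : 'cV[R]_k := (A *m b)^T *m v.

Let Azz : sform A z z = s.
Proof. by rewrite -[LHS]mul1r -s1 -mulrA Az mulr1. Qed.

Let b0 (y : 'cV[R]_k) : b *m y = 0 -> y = 0.
Proof. by move=> /(congr1 (mulmx c)); rewrite mulmxA cb mul1mx mulmx0. Qed.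

Let pE v y : sform A (b *m y) v = sform 1%:M y (p v).
Proof. by rewrite /sform /p !trmx_mul symA !mulmxA mulmx1. Qed.

Let ME v w : sform M v w = sform 1%:M (p v) (p w).
Proof. by rewrite /sform /p /M [(_ *m v)^T]trmx_mul trmxK mulmx1 !mulmxA. Qed.

Let p0 v : (forall y, sform A (b *m y) v = 0) -> p v = 0.
Proof. by move=> H; apply: sform1_eq0 => y; rewrite -pE. Qed.

Let gram_inj y : p (b *m y) = 0 -> y = 0.
Proof.
move=> E; apply: b0; apply: (resonant_definite (bz y).1).
by rewrite pE E sform0r.
Qed.

Let gram : (A *m b)^T *m b \in unitmx.
Proof. by apply: kernel_unitmx => y E; apply: gram_inj; rewrite /p mulmxA. Qed.

Let spanned u : K *m u = 0 -> exists y, u = (s * sform A z u) *: z + b *m y.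
Proof.
move=> Ku; have [||y E] := bspan (u := u - (s * sform A z u) *: z).
- by rewrite mulmxBr -scalemxAr Ku Kz scaler0 subr0.
- by rewrite sformBr sformZr Azz mulrAC s1 mul1r subrr.
by exists y; rewrite -E addrC subrK.
Qed.

Let symM : M^T = M. Proof. by rewrite /M trmx_mul trmxK. Qed.

Let pz : p z = 0.
Proof. by apply: p0 => y; rewrite sform_sym// (bz y).2. Qed.

Let Mp v : p v = 0 -> M *m v = 0.
Proof. by move=> pv; rewrite /M -mulmxA -/(p v) pv mulmx0. Qed.

Let symK : K^T = K.
Proof. by rewrite linearB /= symA momentum_mx_symmetric. Qed.

(* Pairing the equation with the columns of [b], which are in the kernel of [K],
   leaves the Gram matrix of [b] applied to [p x]. *)
Let penalty_kernel x : (K + M) *m x = 0 -> exists a, x = a *: z.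
Proof.
move=> E.
have px : p x = 0.
  apply: gram_inj; apply: p0 => y.
  have : sform (K + M) (b *m y) x = 0 by rewrite sform_mulmx E sform0r.
  have -> : sform (K + M) (b *m y) x = sform K (b *m y) x + sform M (b *m y) x.
    by rewrite /sform mulmxDr mulmxDl mxE.
  rewrite (sform_sym _ _ symK) [sform K x _]sform_mulmx (bz y).1 sform0r add0r ME.
  rewrite (sform_sym _ _ (trmx1 _ _)) -pE (sform_sym _ _ symA); exact.
have Kx : K *m x = 0 by move: E; rewrite mulmxDl (Mp px) addr0.
have [y xE] := spanned Kx; exists (s * sform A z x).
rewrite {1}xE (gram_inj (y := y)) ?mulmx0 ?addr0//.
by move: px; rewrite {1}xE /p mulmxDr -scalemxAr -/(p z) pz scaler0 add0r.
Qed.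

(** A solution of the penalized equation has no component along the penalized
    directions.  Invariance of [h] and [J^xi] gives [M v (eta . v) = 0] for [eta]
    in the Lie algebra of [Gxi], hence [A (b (p v)) (eta . v0) = 0] for the
    projection [v0] of [v]; these vectors fill the orthogonal of [v0], so that
    [b (p v)] is a multiple of [v0], and of zero since it is orthogonal to [z]. *)
Let penalty_vanishes mu v : sform A z v != 0 ->
  (forall w, 'D_w h v = (1 + mu) * sform B v w - sform M v w) -> M *m v = 0.
Proof.
move=> zv crit; apply: Mp.
pose y0 := invmx ((A *m b)^T *m b) *m p v.
pose a := s * sform A z v.
pose v0 := a *: z + b *m y0.
have Kv0 : K *m v0 = 0 by rewrite mulmxDr -scalemxAr Kz (bz y0).1 scaler0 addr0.
have zv0 : sform A z v0 = sform A z v.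
  by rewrite sformDr sformZr (bz y0).2 Azz addr0 /a mulrAC s1 mul1r.
have pv0 : p v0 = p v.
  rewrite /p mulmxDr -scalemxAr -/(p z) pz scaler0 add0r /y0 mulmxA.
  by rewrite (mulKVmx gram).
have proj u : K *m u = 0 -> sform A u v = sform A u v0.
  move=> /spanned[y ->]; rewrite !sformDl !sformZl zv0 !pE pv0//.
have v00 : v0 != 0.
  by apply: contra_neq zv => v0E; rewrite -zv0 v0E sform0r.
have orth u : K *m u = 0 -> sform A v0 u = 0 -> sform A (b *m p v) u = 0.
  move=> Ku v0u; have [eta leta ->] := tangent Kv0 v00 Ku v0u.
  have KX := resonant_inf_stable he he1 hrho invA momentum_mx_stabilizer leta (bz (p v)).1.
  have [gamma [og Gg]] := leta.
  have Mv : sform M v (X eta *m v) = 0.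
    have Dh : 'D_(X eta *m v) h v = 0.
      by apply: (derive_orbit_invariant he he1 hrho og); [move=> t; exact: hinv|exact: ch.1].
    have Bv : sform B v (X eta *m v) = 0.
      have E : (X eta)^T *m B = - (B *m X eta).
        apply: (inf_mx_skew he he1 hrho og) => t; apply: invariant_form.
        exact: momentum_mx_stabilizer.
      have := congr1 (fun N => sform N v v) E.
      rewrite -sform_mull /= [sform (- _) _ _]/sform mulmxN mulNmx mxE -/(sform _ v v).
      rewrite -sform_mulr (sform_sym _ _ (momentum_mx_symmetric xi)) => E2; lra.
    by move: (crit (X eta *m v)); rewrite Dh Bv mulr0 sub0r => /esym/eqP; rewrite oppr_eq0 => /eqP.
  have skew := inf_skew_form he he1 hrho invA.
  apply/eqP; rewrite -oppr_eq0 -(skew _ _ _ _ og) -(proj _ KX).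
  by rewrite (skew _ _ _ _ og) pE -ME Mv oppr0.
have Av0 : sform A v0 v0 != 0.
  by apply: contra_neq v00; exact: resonant_definite.
pose la := sform A v0 (b *m p v) / sform A v0 v0.
have Ku : K *m (b *m p v - la *: v0) = 0.
  by rewrite mulmxBr -scalemxAr Kv0 scaler0 subr0; exact: (bz _).1.
have v0u : sform A v0 (b *m p v - la *: v0) = 0.
  by rewrite sformBr sformZr /la mulfVK// subrr.
have : b *m p v - la *: v0 = 0.
  apply: (resonant_definite Ku).
  by rewrite sformBl sformZl v0u (orth _ Ku v0u) mulr0 subrr.
move/eqP; rewrite subr_eq0 => /eqP bE.
apply: b0; have := congr1 (sform A z) bE.
rewrite (bz _).2 sformZr zv0 => /esym/eqP; rewrite mulf_eq0 (negPf zv) orbF => /eqP la0.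
by rewrite bE la0 scale0r.
Qed.

Lemma penalized_relative_equilibrium (N : set 'cV[R]_d) : nbhs xi N ->
  forall eta, 0 < eta -> exists2 r0, 0 < r0 & forall r, 0 < r -> r < r0 ->
  exists x zeta, [/\ `|x| <= eta, N zeta, h (r *: (z + x)) = s / 2 * r ^+ 2 &
    relative_equilibrium e rho Xh zeta (r *: (z + x))].
Proof.
move=> /nbhs_ballP[del /= del0 ballN] eta eta0.
have [gx ogx] := one_parameter_exists he he1 xi cG.
have ABz : A *m z = B *m z by apply/eqP; rewrite -subr_eq0 -mulmxBl Kz.
have s0 : s != 0 by apply: contra_eq_neq s1 => ->; rewrite mul0r eq_sym oner_eq0.
have [C C0 AC] := sform_bounded A.
(* [m1] keeps [z + x] away from the orthogonal of [z], [m2] keeps the velocity in [N] *)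
pose m1 := (2 * (C * `|z| + 1))^-1.
have Cz0 : 0 < C * `|z| + 1 by rewrite ltr_wpDl// mulr_ge0// ltW.
have m10 : 0 < m1 by rewrite invr_gt0 mulr_gt0.
pose m2 := del / (2 * (`|xi| + 1)).
have x0 : 0 < `|xi| + 1 by rewrite ltr_wpDl.
have m20 : 0 < m2 by rewrite divr_gt0// mulr_gt0.
pose m := Num.min eta (Num.min m1 m2).
have m0 : 0 < m by rewrite !lt_min eta0 m10 m20.
have [r0 r00 H] := constrained_critical_point ch h0 dh0 (momentum_mx_symmetric xi)
  symM ABz (Mp pz) Azz s0 penalty_kernel m0.
exists r0 => // r rp rr0; have [x [mu [xm mum hr crit]]] := H r rp rr0.
have [xe xm1] : `|x| <= eta /\ `|x| <= m1.
  by move: xm; rewrite !le_min => /andP[-> /andP[-> _]].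
have mum2 : `|mu| <= m2 by move: mum; rewrite !le_min => /andP[_ /andP[]].
exists x, ((1 + mu) *: xi); split=> //.
  apply: ballN; rewrite -ball_normE /ball_/= scalerDl scale1r opprD addrA subrr sub0r.
  rewrite normrN normrZ (le_lt_trans (ler_wpM2r (normr_ge0 _) mum2))//.
  rewrite /m2 mulrAC ltr_pdivrMr ?mulr_gt0// ltr_pM2l//.
  have := normr_ge0 xi; lra.
apply: (critical_relative_equilibrium he he1 hrho hOmega hcan hXh hinv
  (one_parameter_scale (1 + mu) ogx)) => w.
have -> : momentum_mx e rho Omega ((1 + mu) *: xi) = (1 + mu) *: B.
  by rewrite /momentum_mx (inf_mxZ he he1 hrho) linearZ /= scalemxAl.
have -> : sform ((1 + mu) *: B) (r *: (z + x)) w = (1 + mu) * sform B (r *: (z + x)) w.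
  by rewrite /sform -scalemxAr -scalemxAl mxE.
have zx : sform A z (r *: (z + x)) != 0.
  rewrite sformZr mulf_neq0 ?(gt_eqF rp)// sformDr Azz.
  apply/eqP => E.
  have : `|sform A z x| < 1.
    apply: (le_lt_trans (AC _ _)).
    apply: (le_lt_trans (ler_wpM2l (mulr_ge0 (ltW C0) (normr_ge0 _)) xm1)).
    rewrite /m1 ltr_pdivrMr ?mulr_gt0// mul1r.
    have := normr_ge0 z; have : 0 <= C * `|z| by rewrite mulr_ge0// ltW.
    lra.
  have -> : sform A z x = - s by lra.
  rewrite normrN; have : `|s| * `|s| = 1 by rewrite -normrM s1 normr1.
  have := normr_ge0 s; nra.
have Mv := penalty_vanishes zx crit.
rewrite crit (sform_sym _ _ symM) [sform M w _]sform_mulmx Mv sform0r.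
by rewrite subr0.
Qed.

End Penalty.

Lemma resonant_relative_equilibrium z (N : set 'cV[R]_d) :
  K *m z = 0 -> s * sform A z z = 1 -> nbhs xi N ->
  forall eta, 0 < eta -> exists2 r0, 0 < r0 & forall r, 0 < r -> r < r0 ->
  exists x zeta, [/\ `|x| <= eta, N zeta, h (r *: (z + x)) = s / 2 * r ^+ 2 &
    relative_equilibrium e rho Xh zeta (r *: (z + x))].
Proof.
move=> Kz Az; have [k [b [c [cb bz bspan]]]] := tangent_basis A K z.
exact: (penalized_relative_equilibrium Kz Az cb bz bspan).
Qed.

End RelativeEquilibria.

(** * Dimension of the kernel and of the torus *)

Lemma subspace_dimE {R : realType} {E : vectType R} (U : {vspace E}) (S : set E) :
  (forall x, S x <-> x \in U) -> subspace_dim S = \dim U.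
Proof.
move=> SU; apply: xget_unique => [|k [Xk [fX XU]]].
  exists (vbasis U); split; first exact/basis_free/vbasisP.
  by move=> x; rewrite (span_basis (vbasisP U)).
have -> : U = <<Xk>>%VS.
  by apply/vspaceP => x; apply/idP/idP => [/SU/XU|/XU/SU].
by rewrite (eqP fX) size_tuple.
Qed.

(** Enlarge a subspace contained in [S] by one vector of [S] at a time. *)
Lemma linear_set_vspace {R : realType} {E : vectType R} (S : set E) :
  S 0 -> (forall a u v, S u -> S v -> S (a *: u + v)) ->
  exists U : {vspace E}, forall x, S x <-> x \in U.
Proof.
move=> S0 SD.
suff H k (U : {vspace E}) : (forall x, x \in U -> S x) ->
    (\dim {:E} - \dim U <= k)%N -> exists U : {vspace E}, forall x, S x <-> x \in U.
  by apply: (H _ 0%VS _ (leqnn _)) => x; rewrite memv0 => /eqP->.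
elim: k U => [|k IH] U US dU.
  exists U => x; split=> [_|]; last exact: US.
  have -> : U = fullv; last exact: memvf.
  by apply/eqP; rewrite -(geq_leqif (dimv_leqif_eq (subvf U))) -subn_eq0 -leqn0.
have [SU|/existsNP[x /not_implyP[Sx xU]]] := pselect (forall x, S x -> x \in U).
  by exists U => x; split; [exact: SU|exact: US].
apply: (IH (<[x]> + U)%VS).
  by move=> y /memv_addP[_ /vlineP[a ->] [v Uv ->]]; apply: SD => //; exact: US.
have UU : (U <= <[x]> + U)%VS by exact: addvSr.
have : (\dim U < \dim (<[x]> + U))%N.
  rewrite (ltn_leqif (dimv_leqif_sup UU)); apply/negP => /subvP/(_ x) sx.
  by apply: xU; apply: sx; apply: (subvP (addvSl _ _)); exact: memv_line.
move: dU; lia.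
Qed.

Section TorusDimension.
Context {R : realType} {d n : nat} {G : lieGroupType R d}.
Variables (e : chart R d G) (rho : G -> 'M[R]_n).
Hypotheses (cG : compact [set: G]) (he : atlas e) (he1 : chart_dom e 1%g).
Hypothesis (hrho : is_representation rho).
Variables (Omega : 'M[R]_n).
Hypotheses (hOmega : symplectic Omega)
  (hcan : forall g u v, sform Omega (rho g *m u) (rho g *m v) = sform Omega u v).
Variables (A : 'M[R]_n) (s : R) (xi : 'cV[R]_d) (T : set G).
Local Notation B := (momentum_mx e rho Omega xi).
Local Notation K := (A - B).
Local Notation Gxi := (Ad_stabilizer e xi).
Local Notation X := (inf_mx e rho).
Hypothesis pos : forall v, K *m v = 0 -> v != 0 -> 0 < s * sform A v v.
Hypothesis tangent : forall v u, K *m v = 0 -> v != 0 -> K *m u = 0 ->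
  sform A v u = 0 -> exists2 eta, lie_subalgebra e Gxi eta & u = X eta *m v.
Hypothesis stable : forall eta (v : 'cV[R]_n), lie_subalgebra e Gxi eta -> K *m v = 0 ->
  K *m (X eta *m v) = 0.
Hypotheses (sT : is_subgroup T) (clT : closed T) (TG : T `<=` Gxi).
Hypothesis comT : forall x y, T x -> T y -> (x * y = y * x)%g.

(** The momentum of one element of the Lie algebra of an abelian group is
    invariant under the others. *)
Lemma torus_isotropic eta zeta v : lie_subalgebra e T eta -> lie_subalgebra e T zeta ->
  sform Omega (X eta *m v) (X zeta *m v) = 0.
Proof.
move=> [g1 [og1 T1]] [g2 [og2 T2]].
have d1 w := is_derive_momentum he he1 hrho hOmega hcan v w og1.
rewrite -momentum_mx_form; have [_ <-] := d1 (X zeta *m v).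
apply: (derive_orbit_invariant he he1 hrho og2).
  move=> t; rewrite !(momentumE he he1 hrho).
  rewrite (momentum_mx_invariant he he1 hrho hcan og1)// => t'.
  by apply: comT.
have [c _ _] := hrho.
rewrite (_ : momentum _ _ _ _ = (fun x => 2^-1 * sform (momentum_mx e rho Omega eta) x x)).
  have [+ _] := Ck_onM (Ck_on_cst 'cV[R]_n 1 (2^-1 : R)) (Ck_on_sform 1 (momentum_mx e rho Omega eta)).
  exact.
by apply/funext => x; rewrite (momentumE he he1 hrho).
Qed.

Definition orbit_map (v : 'cV[R]_n) (eta : 'cV[R]_d) : 'cV[R]_n := X eta *m v.

Let orbit_map_linear v : linear (orbit_map v).
Proof.
move=> a eta zeta; rewrite /orbit_map (inf_mxD he he1 hrho) (inf_mxZ he he1 hrho).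
by rewrite mulmxDl scalemxAl.
Qed.

HB.instance Definition _ v := GRing.isLinear.Build R _ _ _ (orbit_map v) (orbit_map_linear v).

(** With [l = dim V0], the orbit map [eta |-> eta . z] sends the Lie algebra of
    [Gxi] onto a hyperplane of [V0], and that of [T] onto an isotropic subspace
    [I], of dimension at most [l / 2] because [xi] maps it injectively onto a
    subspace of [V0] independent of it. *)
Lemma resonant_dimension (z : 'cV[R]_n) : K *m z = 0 -> z != 0 ->
  (subspace_dim [set v : 'cV[R]_n | K *m v = 0%R] + 2 * lie_dim e T <= 2 * (1 + lie_dim e Gxi))%N.
Proof.
move=> Kz z0.
have [sG clG] := Ad_stabilizer_closed_subgroup he he1 xi cG.
have lin S : is_subgroup S -> closed S ->
    exists U : {vspace 'cV[R]_d}, forall x, lie_subalgebra e S x <-> x \in U.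
  move=> sS clS; apply: linear_set_vspace.
    by apply: lie_subalgebra0; case: sS.
  move=> a u v Su Sv; apply: (lie_subalgebraD he he1 cG sS clS) => //.
  exact: lie_subalgebraZ.
have [UG GE] := lin _ sG clG; have [UT TE] := lin _ sT clT.
have [UV VE] : exists U : {vspace 'cV[R]_n}, forall x, [set v : 'cV[R]_n | K *m v = 0] x <-> x \in U.
  apply: linear_set_vspace; first by rewrite /= mulmx0.
  by move=> a u v /= Ku Kv; rewrite mulmxDr -scalemxAr Ku Kv scaler0 addr0.
rewrite /lie_dim (subspace_dimE GE) (subspace_dimE TE) (subspace_dimE VE).
pose f := linfun (orbit_map z).
have fE eta : f eta = X eta *m z by rewrite lfunE.
have UTG : (UT <= UG)%VS.
  apply/subvP => eta /TE[gamma [og Tg]]; apply/GE; exists gamma; split=> // t.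
  exact/TG/Tg.
pose I := (f @: UT)%VS.
have IV : (I <= UV)%VS.
  apply/subvP => _ /memv_imgP[eta Ueta ->]; apply/VE; rewrite fE; apply: stable => //.
  exact/GE/(subvP UTG).
have VG : (UV <= f @: UG + <[z]>)%VS.
  apply/subvP => u /VE /= Ku.
  have Az0 : sform A z z != 0.
    by have := pos Kz z0; apply: contraTneq => ->; rewrite mulr0 ltxx.
  pose a := sform A z u / sform A z z.
  have [||eta Geta uE] := tangent (u := u - a *: z) Kz z0.
  - by rewrite mulmxBr -scalemxAr Ku Kz scaler0 subr0.
  - by rewrite sformBr sformZr /a mulfVK// subrr.
  rewrite -(subrK (a *: z) u) memv_add ?memvZ ?memv_line// uE -fE memv_img//.
  exact/GE.
pose fx := linfun (mulmx (X xi) : {linear 'cV[R]_n -> 'cV[R]_n}).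
have fxE v : fx v = X xi *m v by rewrite lfunE.
have [gx ogx] := one_parameter_exists he he1 xi cG.
have Gxixi : lie_subalgebra e Gxi xi.
  exists gx; split=> // t; apply/(Ad_stabilizerP he he1 _ ogx) => t'.
  by have [_ gD _] := ogx; rewrite -!gD addrC.
have AB v : K *m v = 0 -> sform A v v = sform Omega (X xi *m v) v.
  move=> Kv; rewrite -momentum_mx_form; apply/eqP; rewrite -subr_eq0 -sform_mxB.
  by rewrite sform_mulmx Kv sform0r.
have def v : K *m v = 0 -> sform Omega (X xi *m v) v = 0 -> v = 0.
  move=> Kv; rewrite -AB// => Av; apply/eqP/negPn/negP => /(pos Kv).
  by rewrite Av mulr0 ltxx.
have inj : (I :&: lker fx = 0)%VS.
  apply/eqP; rewrite -subv0; apply/subvP => v; rewrite memv_cap memv_ker fxE memv0.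
  move=> /andP[Iv /eqP Xv]; apply/eqP/def; first exact/VE/(subvP IV).
  by rewrite Xv sform0l.
have disj : (I :&: fx @: I = 0)%VS.
  apply/eqP; rewrite -subv0; apply/subvP => v; rewrite memv_cap memv0.
  move=> /andP[/memv_imgP[eta Teta vE] /memv_imgP[w Iw vX]].
  have Kw : K *m w = 0 by exact/VE/(subvP IV).
  have -> : v = fx w by [].
  rewrite (def w Kw) ?linear0// -fxE -vX vE.
  have /memv_imgP[zeta Tzeta ->] := Iw.
  by rewrite !fE; apply: torus_isotropic; apply/TE.
have IX : (I + fx @: I <= UV)%VS.
  apply/subvP => _ /memv_addP[u Iu [_ /memv_imgP[w Iw ->] ->]].
  rewrite memvD ?(subvP IV u)//; apply/VE; rewrite fxE; apply: stable => //.
  exact/VE/(subvP IV).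
have := dimvS IX; rewrite (dimv_disjoint_sum disj) (limg_dim_eq inj).
have := leq_trans (dimvS VG) (dimv_add_leqif _ _).
rewrite dim_vline z0.
have := limg_ker_dim f UT; have := limg_ker_dim f UG.
have := dimvS (capvS UTG (subvv (lker f))).
rewrite -/I.
move: (\dim I) (\dim UV) (\dim (f @: UG)) (\dim UG) (\dim UT)
  (\dim (UG :&: lker f)) (\dim (UT :&: lker f)) => a1 a2 a3 a4 a5 a6 a7; lia.
Qed.

End TorusDimension.

(** * Level sets as orbits *)

Lemma category_point {R : realType} (X : topologicalType) (x0 : X) :
  (forall x : X, x = x0) -> Cat R X = 1%E.
Proof.
move=> X1; apply/eqP; rewrite eq_le; apply/andP; split.
  apply: ereal_inf_lbound; exists 1%N => //; exists (fun=> setT); split.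
  - by move=> _; exact: closedT.
  - move=> _; exists fst; split=> //.
      by apply: continuous_subspaceT => x; exact: cvg_fst.
    by exists x0 => a _; exact: X1.
  by apply/seteqP; split=> // x _; exists ord0.
apply: le_ereal_inf_tmp => _ [[|k] [F [_ _ FT]] <-]; last by rewrite lee_fin ler1n.
have : setT x0 by [].
by rewrite -FT => -[[]].
Qed.

Local Open Scope quotient_scope.

Section Orbits.
Context {R : realType} {d n : nat} {G : lieGroupType R d}.
Variables (rho : G -> 'M[R]_n) (K : set G).

Lemma orbit_space_category (S : set 'cV[R]_n) : S !=set0 ->
  (forall u v, S u -> S v -> orbit_of rho K u = orbit_of rho K v) ->
  Cat R (orbit_space rho K S) = 1%E.
Proof.
move=> [u Su] SS.
have H (x y : {eq_quot (orbit_equiv rho K S)}) : x = y.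
  elim/quotW: x => x; elim/quotW: y => y; apply/eqmodP.
  by apply/asboolP; apply: SS; exact: set_valP.
pose x0 : orbit_space rho K S := \pi_({eq_quot (orbit_equiv rho K S)})
  (exist (fun x => x \in S) u (mem_set Su)).
by apply: (@category_point R (orbit_space rho K S) x0) => x; exact: H.
Qed.

Lemma at_least_orbits1 (x : \bar R) (P : set 'cV[R]_n) v :
  P v -> (x <= 1)%E -> at_least_orbits rho x K P.
Proof.
move=> Pv x1 [|c] cx; last first.
  by have := lt_le_trans cx x1; rewrite lte_fin ltrn1.
by exists (fun=> v); split=> // i j; rewrite (ord1 i) (ord1 j).
Qed.

Hypotheses (hrho : is_representation rho) (sK : is_subgroup K).

Lemma orbit_of_translate g v : K g -> orbit_of rho K v = orbit_of rho K (rho g *m v).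
Proof.
have [_ rM _] := hrho; have [_ KM KV] := sK => Kg.
apply/seteqP; split=> [_ [g' Kg' <-]|_ [g' Kg' <-]].
  exists (g' * g^-1)%g; first exact/KM/KV.
  by rewrite mulmxA -rM mulgVK.
by exists (g' * g)%g; [exact: KM|rewrite rM mulmxA].
Qed.

Hypothesis cG : compact [set: G].

Lemma representation_bounded :
  exists2 C, 1 <= C & forall g (v : 'cV[R]_n), `|rho g *m v| <= C * `|v|.
Proof.
have /compact_bounded : compact (rho @` [set: G]).
  apply: continuous_compact => //; apply: continuous_subspaceT.
  exact: (rho_continuous hrho).
move=> [M [Mr HM]].
pose C0 := Num.max M 0 + 1.
have C00 : 0 < C0 by rewrite ltr_wpDl// le_max lexx orbT.
have MC : M < C0 by rewrite (@le_lt_trans _ _ (Num.max M 0)) ?le_max ?lexx// ltrDl.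
have rC g : `|rho g| <= C0 by apply: (HM _ MC); exists g.
exists (1 + n%:R * C0) => [|g v]; first by rewrite lerDl mulr_ge0// ltW.
apply: cV_norm_le => [|i]; first by rewrite mulr_ge0// addr_ge0// mulr_ge0// ltW.
rewrite mxE (le_trans (ler_norm_sum _ _ _))// mulrDl mul1r -[leLHS]add0r lerD//.
rewrite -mulrA mulr_natl -[X in _ *+ X]card_ord -sumr_const.
apply: ler_sum => j _; rewrite normrM ler_pM ?cV_coord_le//.
apply: le_trans (rC g); rewrite [leRHS]/Num.Def.normr /= mx_normrE.
exact: (@le_bigmax _ _ _ _ (fun ij : 'I_n * 'I_n => `|rho g ij.1 ij.2|) (i, j)).
Qed.

(** The saturation of a ball, which is bounded because the representation is. *)
Lemma invariant_neighborhood del : 0 < del ->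
  exists2 del', 0 < del' & exists U : set 'cV[R]_n,
    [/\ open U, forall g v, U v -> U (rho g *m v),
      forall v, `|v| < del' -> U v & forall v, U v -> `|v| < del].
Proof.
move=> del0; have [C C1 HC] := representation_bounded.
have C0 : 0 < C by exact: lt_le_trans C1.
have [rho1 rM _] := hrho.
exists (del / C); first exact: divr_gt0.
exists [set v | exists g, `|rho g *m v| < del / C]; split.
- rewrite (_ : mkset _ = \bigcup_g [set v | `|rho g *m v| < del / C]); last first.
    by apply/seteqP; split=> [v [g gv]|v [g _ gv]]; exists g.
  apply: bigcup_open => g _.
  rewrite (_ : mkset _ = (mulmx (rho g) : 'cV[R]_n -> 'cV[R]_n) @^-1` ball 0 (del / C)); last first.
    by apply/seteqP; split=> v; rewrite /= -ball_normE /ball_/= sub0r normrN.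
  apply: open_comp; last exact: ball_open.
  by move=> v _; exact: mulmx_continuous.
- move=> g v [g' g'v]; exists (g' * g^-1)%g.
  by rewrite mulmxA -rM mulgVK.
- by move=> v vd; exists 1%g; rewrite rho1 mul1mx.
move=> v [g gv].
rewrite -[v]mul1mx -rho1 -(mulVg g) rM -mulmxA.
apply: le_lt_trans (HC _ _) _.
by rewrite mulrC -ltr_pdivlMr.
Qed.

End Orbits.

Section Levels.
Context {R : realType} {d n : nat} {G : lieGroupType R d}.
Variables (rho : G -> 'M[R]_n) (Gxi : set G) (h : 'cV[R]_n -> R).
Hypotheses (cG : compact [set: G]) (hrho : is_representation rho).
Hypotheses (ch : Ck_on 2 setT h) (hinv : forall g v, h (rho g *m v) = h v)
  (h0 : h 0 = 0) (dh0 : forall v, 'D_v h 0 = 0).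
Variables (K : 'M[R]_n) (s : R).
Hypothesis s1 : s * s = 1.
Local Notation A := (hessian h 0).
Hypothesis pos : forall v, K *m v = 0 -> v != 0 -> 0 < s * sform A v v.

Lemma polar v : K *m v = 0 -> v != 0 ->
  exists a z, [/\ 0 < a, K *m z = 0, s * sform A z z = 1 & v = a *: z].
Proof.
move=> Kv v0; have p := pos Kv v0.
set q := s * sform A v v in p.
have sq0 : 0 < Num.sqrt q by rewrite sqrtr_gt0.
exists (Num.sqrt q), ((Num.sqrt q)^-1 *: v); split=> //.
- by rewrite -scalemxAr Kv scaler0.
- rewrite sformZl sformZr (_ : _ * _ = (Num.sqrt q)^-1 ^+ 2 * q); last by rewrite /q; ring.
  by rewrite exprVn sqr_sqrtr ?ltW// mulVf// gt_eqF.
by rewrite scalerA divff ?scale1r// gt_eqF.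
Qed.

(** Along a ray [s * h] is [b ^+ 2 / 2] up to an error of at most half of its
    increments; [C] stands for a bound on the unit sphere of the kernel. *)
Lemma energy_estimate C : 0 < C -> exists2 del, 0 < del &
  forall z a b, s * sform A z z = 1 -> `|z| <= C -> 0 <= a -> a <= b -> b * C < del ->
    `|s * (h (b *: z) - h (a *: z)) - 2^-1 * (b ^+ 2 - a ^+ 2)| <= b * (b - a) / 4.
Proof.
move=> C0.
have k0 : 0 < (4 * C ^+ 2)^-1 by rewrite invr_gt0 mulr_gt0// exprn_gt0.
have [del del0 H] := energy_expansion ch dh0 k0.
exists del => // z a b Az zC a0 ab bC.
have b0 : 0 <= b by exact: le_trans ab.
have nb : `|b *: z| <= b * C by rewrite normrZ ger0_norm// ler_wpM2l.
have na : `|a *: z| <= b * C by rewrite normrZ ger0_norm// ler_pM.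
have := H _ _ _ bC nb na.
rewrite -scalerBl !sformZl !sformZr normrZ (ger0_norm (_ : 0 <= b - a)) ?subr_ge0//.
set x := _ - _ - _ => Hx.
have s2 : `|s| = 1.
  by apply/eqP; rewrite -sqrp_eq1// -normrX expr2 s1 normr1.
have -> : s * (h (b *: z) - h (a *: z)) - 2^-1 * (b ^+ 2 - a ^+ 2) = s * x.
  rewrite /x -[2^-1 * (b ^+ 2 - a ^+ 2)]mulr1 -Az; ring.
rewrite normrM s2 mul1r (le_trans Hx)//.
have -> : b * (b - a) / 4 = (4 * C ^+ 2)^-1 * (b * C) * ((b - a) * C).
  by field; rewrite gt_eqF.
rewrite ler_wpM2l ?mulr_ge0 ?(ltW k0) ?(ltW C0)//.
by rewrite ler_wpM2l// subr_ge0.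
Qed.

(** By the intermediate value theorem, since [s * h (m *: z)] is at least
    [m ^+ 2 / 4]. *)
Lemma energy_attained z : s * sform A z z = 1 -> exists2 m0, 0 < m0 &
  forall m, 0 < m -> m < m0 -> forall c, 0 <= c -> c <= m ^+ 2 / 4 ->
  exists a, [/\ 0 <= a, a <= m & h (a *: z) = s * c].
Proof.
move=> Az; have C0 : 0 < `|z| + 1 by rewrite ltr_wpDl.
have [del del0 H] := energy_estimate C0.
exists (del / (`|z| + 1)); first exact: divr_gt0.
move=> m m0; rewrite ltr_pdivlMr// => md c c0 cm.
have zz : `|z| <= `|z| + 1 by rewrite lerDl.
have := H z 0 m Az zz (lexx _) (ltW m0) md.
rewrite scale0r h0 !subr0 expr0n subr0 => /ler_normlP[Hl _].
pose g a := s * h (a *: z).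
have gc : continuous g.
  move=> a.
  apply: (@continuous_comp _ _ _ (fun a : R => h (a *: z)) ( *%R s)); last exact: mulrl_continuous.
  apply: (@continuous_comp _ _ _ (fun a : R => a *: z) h).
    by apply: cvgZr_tmp; exact: cvg_id.
  by apply: differentiable_continuous; exact: ch.1.
have [||a] := @IVT R g 0 m c (ltW m0).
- exact: continuous_subspaceT.
- rewrite /g scale0r h0 mulr0 ge_min c0 le_max/=.
  by apply/orP; right; rewrite -expr2 in Hl; lra.
rewrite in_itv/= => /andP[a0 am] ga; exists a; split=> //.
by rewrite -ga /g mulrA s1 mul1r.
Qed.

Hypothesis trans : forall z1 z2, K *m z1 = 0 -> s * sform A z1 z1 = 1 ->
  K *m z2 = 0 -> s * sform A z2 z2 = 1 -> exists2 g, Gxi g & z2 = rho g *m z1.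

(** Near the origin [s * h] is strictly increasing along the rays of the kernel,
    so that on a level set the radius determines the point up to the action. *)
Lemma energy_level_orbit : exists2 del, 0 < del & forall v1 v2,
  `|v1| < del -> `|v2| < del -> K *m v1 = 0 -> K *m v2 = 0 ->
  h v1 != 0 -> h v1 = h v2 -> exists2 g, Gxi g & v2 = rho g *m v1.
Proof.
have [C C1 HC] := representation_bounded hrho cG.
have C0 : 0 < C by exact: lt_le_trans C1.
have [[z0 [Kz0 z00]]|none] := pselect (exists z : 'cV[R]_n, K *m z = 0 /\ z != 0); last first.
  exists 1 => // v1 v2 _ _ Kv1 _ hv1; exfalso; apply: none; exists v1; split=> //.
  by apply: contra_neq hv1 => ->.
have [_ [z [_ Kz Az _]]] := polar Kz0 z00.
pose C' := C * (`|z| + 1).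
have C'0 : 0 < C' by rewrite mulr_gt0// ltr_wpDl.
have [del del0 H] := energy_estimate C'0.
(* by transitivity, and the representation being bounded *)
have unit_le w : K *m w = 0 -> s * sform A w w = 1 -> `|w| <= C' /\ `|z| <= C * `|w|.
  move=> Kw Aw; split.
    have [g _ ->] := trans Kz Az Kw Aw.
    by rewrite (le_trans (HC _ _))// ler_wpM2l ?ltW// ltrDl.
  by have [g _ ->] := trans Kw Aw Kz Az; exact: HC.
have znz : 0 < `|z|.
  rewrite normr_gt0; apply: contra_eq_neq Az => ->.
  by rewrite sform0r mulr0 eq_sym oner_eq0.
pose c := C * C' / `|z|.
have c0 : 0 < c by rewrite divr_gt0// mulr_gt0.
exists (del / c); first exact: divr_gt0.
have radius a w : 0 < a -> K *m w = 0 -> s * sform A w w = 1 ->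
    `|a *: w| < del / c -> a * C' < del.
  move=> a0 Kw Aw; rewrite ltr_pdivlMr// normrZ gtr0_norm// => L.
  apply: le_lt_trans L; rewrite -mulrA ler_pM2l// /c mulrA ler_pdivlMr//.
  have := ler_wpM2l (ltW C'0) (unit_le w Kw Aw).2.
  by rewrite (_ : `|w| * (C * C') = C' * (C * `|w|)); last by ring.
have mono w a b : K *m w = 0 -> s * sform A w w = 1 -> 0 < a -> a < b -> b * C' < del ->
    h (a *: w) <> h (b *: w).
  move=> Kw Aw a0 ab bd hab.
  have := H w a b Aw (unit_le w Kw Aw).1 (ltW a0) (ltW ab) bd.
  rewrite hab subrr mulr0 sub0r normrN => /ler_normlP[_].
  have : 0 < (b - a) * (b + 2 * a) by rewrite mulr_gt0 ?subr_gt0//; lra.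
  move=> h1; apply/negP; rewrite -ltNge; lra.
move=> v1 v2 v1d v2d Kv1 Kv2 hv1 hv12.
have v10 : v1 != 0 by apply: contra_neq hv1 => ->.
have v20 : v2 != 0 by apply: contra_neq hv1 => E; rewrite hv12 E.
have [a1 [z1 [a10 Kz1 Az1 E1]]] := polar Kv1 v10.
have [a2 [z2 [a20 Kz2 Az2 E2]]] := polar Kv2 v20.
have [g Gg zE] := trans Kz1 Az1 Kz2 Az2.
exists g => //; rewrite E2 E1 zE -scalemxAr; congr (_ *: _).
have h2 : h (a1 *: z1) = h (a2 *: z1) by rewrite -E1 hv12 E2 zE scalemxAr hinv.
have d1 : a1 * C' < del by apply: (radius a1 z1); rewrite -?E1.
have d2 : a2 * C' < del by apply: (radius a2 z2); rewrite -?E2.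
have [lt|lt|//] := ltgtP a2 a1; exfalso.
- by apply: (mono z1 a2 a1).
- by apply: (mono z1 a1 a2).
Qed.

Lemma quadratic_level_orbit v1 v2 : K *m v1 = 0 -> K *m v2 = 0 ->
  sform A v1 v1 != 0 -> sform A v1 v1 = sform A v2 v2 ->
  exists2 g, Gxi g & v2 = rho g *m v1.
Proof.
move=> Kv1 Kv2 Av1 Av12.
have v10 : v1 != 0 by apply: contra_neq Av1 => ->; rewrite sform0r.
have v20 : v2 != 0 by apply: contra_neq Av1 => E; rewrite Av12 E sform0r.
have [a1 [z1 [a10 Kz1 Az1 E1]]] := polar Kv1 v10.
have [a2 [z2 [a20 Kz2 Az2 E2]]] := polar Kv2 v20.
have [g Gg zE] := trans Kz1 Az1 Kz2 Az2.
exists g => //; rewrite E2 E1 zE -scalemxAr; congr (_ *: _).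
have : a1 * a1 * (s * sform A z1 z1) = a2 * a2 * (s * sform A z2 z2).
  move: Av12; rewrite E1 E2 !sformZl !sformZr => E; move: (congr1 ( *%R s) E) => E'; lra.
rewrite Az1 Az2 !mulr1 => E; nra.
Qed.

End Levels.
Theorem theorem4p1 (R : realType) (n d : nat)
    (Omega : 'M[R]_n) (hOmega : symplectic Omega)
    (G : lieGroupType R d) (hG : compact [set: G])
    (e : chart R d G) (he : atlas e) (he1 : chart_dom e 1%g)
    (rho : G -> 'M[R]_n) (hrho : is_representation rho)
    (hcan : forall g u v, sform Omega (rho g *m u) (rho g *m v) = sform Omega u v)
    (h : 'cV[R]_n -> R) (hsmooth : smooth_on setT h)
    (hinv : forall g v, h (rho g *m v) = h v)
    (Xh : 'cV[R]_n -> 'cV[R]_n) (hXh : is_hamiltonian_vf Omega h Xh)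
    (h0 : h 0 = 0) (dh0 : forall v, 'D_v h 0 = 0)
    (xi : 'cV[R]_d) :
  let J := momentum Omega e rho in
  let Gxi := Ad_stabilizer e xi in
  let V0 := hess_ker (h \- J xi) 0 in
  let Q := fun v => d2 h 0 v v in
  \det (hessian (h \- J xi) 0) = 0 ->
  (* s is the sign of the definite form Q *)
  forall s : R, s = 1 \/ s = -1 ->
  (forall v, V0 v -> v != 0 -> 0 < s * Q v) ->
  morse_bott e rho Gxi
    [set u | V0 u /\ Num.sqrt (s * Q u) = 1]
    (fun u => 2^-1 * d2 (J xi) 0 u u) ->
  forall N : set 'cV[R]_d, nbhs xi N ->
  exists (U : set 'cV[R]_n) (eps0 : R),
    [/\ open U, U 0, (forall g v, U v -> U (rho g *m v)), 0 < eps0 &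
    forall eps : R, eps != 0 -> `|eps| < eps0 -> 0 < s * eps ->
      let RE := [set v | [/\ U v, h v = eps &
                  exists2 eta, N eta & relative_equilibrium e rho Xh eta v]] in
      let hlevel := [set v | [/\ U v, V0 v & h v = eps]] in
      let Qlevel := [set v | [/\ U v, V0 v & Q v = eps]] in
      [/\ Cat R (orbit_space rho Gxi hlevel) = Cat R (orbit_space rho Gxi Qlevel),
          at_least_orbits rho (Cat R (orbit_space rho Gxi hlevel)) Gxi RE &
          forall T : set G, is_maximal_torus T Gxi ->
            V0 `&` fixed_by rho T = [set 0] ->
            at_least_orbits rho
              ((subspace_dim V0)%:R /
               (2 * (1 + (lie_dim e Gxi)%:R - (lie_dim e T)%:R)))%:E Gxi RE]].
Proof.
move=> J Gxi V0 Q det0 s sE Qpos mb N nN.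
have s1 : s * s = 1 by case: sE => ->; rewrite ?mulrNN mulr1.
have ch : Ck_on 2 setT h by exact: hsmooth.
set A := hessian h 0; set B := momentum_mx e rho Omega xi.
have [gx ogx] := one_parameter_exists he he1 xi hG.
have hessE : hessian (h \- J xi) 0 = A - B.
  exact: (hessian_augmented he he1 hrho hOmega hcan ch ogx).
have V0E v : V0 v <-> (A - B) *m v = 0 by rewrite /V0 /hess_ker /= hessE.
have QE v : Q v = sform A v v by exact: d2_sform.
have pos v : (A - B) *m v = 0 -> v != 0 -> 0 < s * sform A v v.
  by move=> Kv v0; rewrite -QE; apply: Qpos => //; exact/V0E.
have {}mb : morse_bott e rho Gxi [set u | (A - B) *m u = 0 /\ s * sform A u u = 1]
    (fun u => 2^-1 * sform B u u).
  rewrite (_ : [set u | _] = [set u | V0 u /\ Num.sqrt (s * Q u) = 1]).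
    rewrite (_ : (fun u => _) = (fun u => 2^-1 * d2 (J xi) 0 u u))//.
    apply/funext => u.
    by rewrite (d2_momentum he he1 hrho hOmega hcan _ _ _ ogx).
  apply/seteqP; split=> u /=; rewrite QE => -[Ku Au].
    by split; [exact/V0E|rewrite Au sqrtr1].
  split; first exact/V0E.
  have A0 : 0 <= s * sform A u u.
    rewrite leNgt; apply/negP => Alt; move: Au.
    by rewrite ler0_sqrtr ?ltW// => /eqP; rewrite eq_sym oner_eq0.
  by rewrite -(sqr_sqrtr A0) Au expr1n.
have [sG clG] := Ad_stabilizer_closed_subgroup he he1 xi hG.
have symA : A^T = A by exact: hessian_sym.
have invA := @hessian_invariant _ _ _ _ rho h _ ch hinv.
have invB g : Gxi g -> forall u v, sform B (rho g *m u) (rho g *m v) = sform B u v.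
  exact: momentum_mx_stabilizer.
have Bxi v : inf_mx e rho xi *m v = 0 -> sform B v v = 0 by exact: momentum_mx_fixed.
have trans := sphere_transitive hG he he1 hrho symA s1 pos invA invB Bxi mb.
have [z [Kz Az]] : exists z, (A - B) *m z = 0 /\ s * sform A z z = 1.
  have /eqP/det0P[v v0 vK] : \det (A - B)^T = 0 by rewrite det_tr -hessE.
  have Kv : (A - B) *m v^T = 0 by apply: trmx_inj; rewrite trmx_mul trmxK vK trmx0.
  have v0' : v^T != 0 by apply: contra_neq v0 => E; apply: trmx_inj; rewrite E trmx0.
  by have [_ [z [_ Kz Az _]]] := polar pos Kv v0'; exists z.
have z0 : z != 0.
  by apply: contra_eq_neq Az => ->; rewrite sform0r mulr0 eq_sym oner_eq0.
have [del del0 hlev] := energy_level_orbit hG hrho ch hinv h0 dh0 s1 pos trans.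
have [dU dU0 [U [oU Uinv Usmall Udel]]] := invariant_neighborhood hrho hG del0.
have [m1 m10 hatt] := energy_attained ch h0 dh0 s1 Az.
have [r0 r00 hRE] := resonant_relative_equilibrium hG he he1 hrho hOmega hcan ch hinv
  hXh h0 dh0 s1 pos mb Kz Az nN ltr01.
have z10 : 0 < `|z| + 1 by rewrite ltr_wpDl.
pose m2 := dU / (`|z| + 1).
have m20 : 0 < m2 by rewrite divr_gt0.
pose m := Num.min (Num.min m1 m2) r0 / 2.
have m0 : 0 < m by rewrite divr_gt0// !lt_min m10 m20 r00.
have [mm1 [mm2 mr0]] : m < m1 /\ m < m2 /\ m < r0.
  have : m < Num.min (Num.min m1 m2) r0 by move: m0; rewrite /m; lra.
  by rewrite !lt_min => /andP[/andP[-> ->] ->].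
have smallU a x : 0 <= a -> a <= m -> `|x| <= 1 -> U (a *: (z + x)).
  move=> a0 am x1; apply: Usmall; rewrite normrZ ger0_norm//.
  apply: (@le_lt_trans _ _ (m * (`|z| + 1))); last by rewrite -ltr_pdivlMr.
  rewrite ler_pM// (le_trans (ler_normD _ _))// lerD2l//.
(* the points used on the levels below [m ^+ 2 / 4] have a radius at most [m] *)
exists U, (m ^+ 2 / 4); split=> //.
- by apply: Usmall; rewrite normr0.
- by rewrite divr_gt0// exprn_gt0.
move=> eps eps0 epsm seps RE hlevel Qlevel.
have epsE : eps = s * `|eps|.
  have sn : `|s| = 1 by apply/eqP; rewrite -sqrp_eq1// -normrX expr2 s1 normr1.
  rewrite -[`|eps|]mul1r -sn -normrM gtr0_norm// mulrA s1 mul1r//.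
have ne : 0 < `|eps| by rewrite normr_gt0.
have sqle c : 0 <= c -> c <= 2 -> Num.sqrt (c * `|eps|) <= m.
  move=> c0 c2; apply: (@le_trans _ _ (Num.sqrt (m ^+ 2))); last first.
    by rewrite sqrtr_sqr (ger0_norm (ltW m0)).
  apply: ler_wsqrtr; have := ler_wpM2r (ltW ne) c2; lra.
have cat_h : Cat R (orbit_space rho Gxi hlevel) = 1%E.
  apply: orbit_space_category.
    have [||a [a0 am ha]] := hatt m m0 mm1 `|eps|; [exact: ltW|exact: ltW|].
    exists (a *: z); split.
    - by rewrite -[z]addr0; apply: smallU => //; rewrite normr0.
    - by apply/V0E; rewrite -scalemxAr Kz scaler0.
    - by rewrite ha -epsE.
  move=> u v [Uu /V0E Ku hu] [Uv /V0E Kv hv].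
  have [||||||g Gg ->] := hlev u v; [exact: Udel|exact: Udel|by []|by []| | |].
  - by rewrite hu.
  - by rewrite hu hv.
  exact: orbit_of_translate.
have cat_Q : Cat R (orbit_space rho Gxi Qlevel) = 1%E.
  apply: orbit_space_category.
    exists (Num.sqrt `|eps| *: z); split.
    - rewrite -[z]addr0; apply: smallU; rewrite ?normr0 ?sqrtr_ge0//.
      by rewrite -[`|eps|]mul1r; apply: sqle; rewrite // ler1n.
    - by apply/V0E; rewrite -scalemxAr Kz scaler0.
    - rewrite QE sformZl sformZr mulrA -expr2 sqr_sqrtr// [RHS]epsE.
      by rewrite -[sform A z z]mul1r -s1 -mulrA Az mulr1 mulrC.
  move=> u v [Uu /V0E Ku Qu] [Uv /V0E Kv Qv]; rewrite QE in Qu; rewrite QE in Qv.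
  have [||g Gg ->] := quadratic_level_orbit pos trans Ku Kv; rewrite ?Qu ?Qv//.
  exact: orbit_of_translate.
have [v REv] : exists v, RE v.
  pose r := Num.sqrt (2 * `|eps|).
  have rp : 0 < r by rewrite sqrtr_gt0 mulr_gt0.
  have rm : r <= m by apply: sqle.
  have [x [zeta [x1 Nz hx rex]]] := hRE r rp (le_lt_trans rm mr0).
  exists (r *: (z + x)); split; last by exists zeta.
    by apply: smallU => //; exact: ltW.
  rewrite hx sqr_sqrtr; last by rewrite mulr_ge0.
  by rewrite [RHS]epsE; field.
split; first by rewrite cat_h cat_Q.
  by rewrite cat_h; exact: at_least_orbits1 REv _.
move=> T [[sT cT _ comT] TG _] _.
apply: at_least_orbits1 REv _; rewrite lee_fin.
have clT : closed T by apply: compact_closed => //; exact: lie_hausdorff.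
have tangent := resonant_tangent he he1 hrho symA s1 pos mb.
have stable := resonant_inf_stable he he1 hrho invA invB.
have := resonant_dimension hG he he1 hrho hOmega hcan pos tangent stable sT clT TG comT Kz z0.
have -> : [set v : 'cV[R]_n | (A - B) *m v = 0] = V0.
  by apply/seteqP; split=> w /V0E.
move: (subspace_dim V0) (lie_dim e T) (lie_dim e Gxi) => l t g lgt.
have : (l%:R + 2 * t%:R <= 2 * (1 + g%:R) :> R).
  by move: lgt; rewrite -(ler_nat R) natrD !natrM natrD.
have [lt0|le0] := ltP 0 (2 * (1 + g%:R - t%:R) : R).
  by rewrite ler_pdivrMr//; lra.
move=> _; apply: (@le_trans _ _ 0); last exact: ler01.
by rewrite mulr_ge0_le0// invr_le0.
Qed.
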